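(* Suppose the marked times $((\xi_1,\tau_1),\ldots,(\xi_m,\tau_m))$ satisfy the density hypothesis with respect to $\mathcal{F}_\infty$: there exist a Borel probability measure $\nu$ on $E\times[0,\infty]$ and a nonnegative $(\mathcal{E}\otimes\mathcal{B}[0,\infty])^{\otimes m}\otimes\mathcal{F}_\infty$-measurable function $\gamma^*$ on $(E\times[0,\infty])^m\times\Omega$ with $$\mathbb{Q}[((\xi_1,\tau_1),\ldots,(\xi_m,\tau_m))\in A\mid\mathcal{F}_\infty]=\int_A\gamma^*((x_1,t_1),\ldots,(x_m,t_m))\,\nu^{\otimes m}(d(x_1,t_1),\ldots,d(x_m,t_m))$$ for all $A\in(\mathcal{E}\otimes\mathcal{B}[0,\infty])^{\otimes m}$. Then the $\mathbb{G}^{*m}$-optional splitting formula holds at times $\tau_1,\ldots,\tau_m$ with respect to $\mathbb{F}$.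
   Context: Let $(\Omega,\mathcal{A},\mathbb{Q})$ be a probability space with a right-continuous filtration $\mathbb{F}=(\mathcal{F}_t)_{t\ge0}$ such that $\mathcal{F}_0$ contains $\mathcal{N}^{\mathcal{F}_\infty}$, where for a $\sigma$-algebra $\mathcal{T}\subset\mathcal{A}$, $\mathcal{N}^{\mathcal{T}}$ denotes the $\sigma$-algebra generated by all subsets of $\mathcal{T}$-measurable $\mathbb{Q}$-null sets. Let $(E,\mathcal{E})$ be a separable complete metric space with its Borel $\sigma$-algebra, $\Delta\in E$, $E^\circ=E\setminus\{\Delta\}$. Let $\tau_1,\ldots,\tau_m$ be $[0,\infty]$-valued random variables and $\xi_1,\ldots,\xi_m$ be $E^\circ$-valued random variables. Define $H_i(t)=\Delta$ if $t<\tau_i$ and $H_i(t)=\xi_i$ if $\tau_i\le t$ ($t\ge0$). Let $\mathcal{H}^{m}_t=\sigma(H_i(s):1\le i\le m,0\le s\le t)$, $\mathcal{N}^{*m}=\mathcal{N}^{\mathcal{H}^m_\infty\vee\mathcal{F}_\infty}$, and $\mathcal{G}^{*m}_t=\mathcal{N}^{*m}\vee\bigcap_{s>t}(\mathcal{F}_s\vee\mathcal{H}^m_s)$, defining $\mathbb{G}^{*m}$. $\mathfrak{D}(E)$ is the space of càdlàg $E$-valued functions on $\mathbb{R}_+$ with the Skorokhod topology and Borel $\sigma$-algebra $\mathcal{D}$. $\sigma_{m,1}\le\cdots\le\sigma_{m,m}$ denotes the increasing reordering of $\tau_1,\ldots,\tau_m$, with $\sigma_{m,0}=0$, $\sigma_{m,m+1}=\infty$;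 $H_i^{R}$ denotes $H_i$ stopped at $R$. The $\mathbb{G}^{*m}$-optional splitting formula holds at times $\tau_1,\ldots,\tau_m$ with respect to $\mathbb{F}$ if for every $\mathbb{G}^{*m}$-optional $Y$ there exist $\mathcal{D}^{m}\otimes\mathcal{O}(\mathbb{F})$-measurable functions $Y^{(0)},\ldots,Y^{(m)}$ on $\mathfrak{D}(E)^m\times(\mathbb{R}_+\times\Omega)$ with $Y=\sum_{i=0}^mY^{(i)}(H_1^{\sigma_{m,i}},\ldots,H_m^{\sigma_{m,i}})\mathbf{1}_{[\sigma_{m,i},\sigma_{m,i+1})}$ up to indistinguishability outside a null set of $\mathcal{N}^{*m}$, where $Z(\Upsilon)(t,\omega)=Z(\Upsilon(\omega),t,\omega)$. *)

(* Defs.v *)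
From HB Require Import structures.
From mathcomp Require Import all_boot all_order all_algebra.
From mathcomp Require Import all_classical all_reals all_analysis.
From mathcomp Require Import measurable_realfun.

Unset Implicit Arguments.
Unset Strict Implicit.
Unset Printing Implicit Defensive.

Import Order.TTheory GRing.Theory Num.Theory.

Local Open Scope classical_set_scope.
Local Open Scope ring_scope.

Section metric.
Context {R : realType} {E : Type}.
Implicit Types (r : E -> E -> R).

Definition is_metric r :=
  [/\ forall x y, 0 <= r x y,
      forall x y, r x y = 0 <-> x = y,
      forall x y, r x y = r y x &
      forall x y z, r x z <= r x y + r y z].

Definition metric_complete r :=
  forall u : nat -> E,
    (forall e, 0 < e -> exists N, forall n k, (N <= n)%N -> (N <= k)%N ->
        r (u n) (u k) < e) ->
    exists l, forall e, 0 < e -> exists N, forall n, (N <= n)%N -> r (u n) l < e.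

Definition metric_separable r :=
  exists s : nat -> E, forall x e, 0 < e -> exists n, r x (s n) < e.

Definition metric_open r : set (set E) :=
  [set U | forall x, U x -> exists2 e, 0 < e & forall y, r x y < e -> U y].

Definition borel_of r : set (set E) := <<s metric_open r >>.

(* cadlag paths on R_+ = [0, +oo) (values at negative times are irrelevant) *)
Definition cadlag r (x : R -> E) :=
  (forall t, 0 <= t -> forall e, 0 < e -> exists2 dl, 0 < dl &
      forall s, t <= s -> s < t + dl -> r (x t) (x s) < e) /\
  (forall t, 0 < t -> exists l, forall e, 0 < e -> exists2 dl, 0 < dl &
      forall s, 0 <= s -> t - dl < s -> s < t -> r l (x s) < e).

(* ---- Skorokhod J1 metric on D([0,oo), E), Ethier-Kurtz (3.5.2) ---- *)
Local Open Scope ereal_scope.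

Definition sk_gamma (l : R -> R) : \bar R :=
  ereal_sup [set z | exists s t, (0 <= t)%R /\ (t < s)%R /\
     z = (`| ln ((l s - l t) / (s - t)) |)%:E].

Definition sk_Lambda (l : R -> R) :=
  [/\ (forall s t, (0 <= s)%R -> (s < t)%R -> (l s < l t)%R),
      (forall t, (0 <= t)%R -> (0 <= l t)%R),
      (forall v, (0 <= v)%R -> exists2 t, (0 <= t)%R & l t = v),
      (exists K : R, forall s t, (0 <= s)%R -> (0 <= t)%R ->
          (`|l s - l t| <= K * `|s - t|)%R) &
      sk_gamma l < +oo].

Definition sk_du r (x y : R -> E) (l : R -> R) (u : R) : \bar R :=
  ereal_sup [set z | exists t, (0 <= t)%R /\
     z = (Num.min (r (x (Num.min t u)) (y (Num.min (l t) u))) 1)%:E].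

Definition sk_dist r (x y : R -> E) : \bar R :=
  ereal_inf [set z | exists l, sk_Lambda l /\
     z = maxe (sk_gamma l)
       (\int[@lebesgue_measure R]_(u in [set u : R | (0 <= u)%R])
            ((expR (- u))%:E * sk_du r x y l u))].

Local Close Scope ereal_scope.

(* open sets of the Skorokhod topology (only cadlag paths matter) *)
Definition sk_open r : set (set (R -> E)) :=
  [set U | forall x, U x -> cadlag r x -> exists2 e, 0 < e &
     forall y, cadlag r y -> (sk_dist r x y < e%:E)%E -> U y].

Definition skorokhod_borel r : set (set (R -> E)) := <<s sk_open r >>.

Definition skorokhod_prod (m : nat) r : set (set ('I_m -> R -> E)) :=
  <<s [set A | exists i B, skorokhod_borel r B /\ A = [set w | B (w i)]] >>.

End metric.

Section omega.
Context {R : realType} {d : measure_display} {Omega : measurableType d}.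
Variable Q : probability Omega R.

Definition sjoin (T1 T2 : set (set Omega)) : set (set Omega) := <<s T1 `|` T2 >>.

Definition null_sigma (T : set (set Omega)) : set (set Omega) :=
  <<s [set N | exists M, T M /\ Q M = 0%E /\ N `<=` M] >>.

Definition is_filtration (F : R -> set (set Omega)) :=
  (forall t, 0 <= t -> sigma_algebra setT (F t) /\ F t `<=` measurable) /\
  (forall s t, 0 <= s -> s <= t -> F s `<=` F t).

Definition filt_right_continuous (F : R -> set (set Omega)) :=
  forall t, 0 <= t -> F t = \bigcap_(s in [set s | t < s]) F s.

Definition Finf (F : R -> set (set Omega)) : set (set Omega) :=
  <<s \bigcup_(t in [set t : R | 0 <= t]) F t >>.

Definition real_dist (a b : R) : R := `|a - b|.

Definition adapted (G : R -> set (set Omega)) (X : R -> Omega -> R) :=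
  forall t, 0 <= t -> forall B : set R, measurable B -> G t [set w | B (X t w)].

Definition optional_sigma (G : R -> set (set Omega)) : set (set (R * Omega)) :=
  <<s [set S | exists (X : R -> Omega -> R) (B : set R),
        [/\ adapted G X, (forall w, cadlag real_dist (X ^~ w)), measurable B &
            S = [set p | 0 <= p.1 /\ B (X p.1 p.2)]]] >>.

Definition is_optional (G : R -> set (set Omega)) (Y : R -> Omega -> R) :=
  forall B : set R, measurable B ->
    optional_sigma G [set p | 0 <= p.1 /\ B (Y p.1 p.2)].

End omega.

Section marked.
Context {R : realType} {d : measure_display} {Omega : measurableType d}.
Context {E : Type} (m : nat).
Variables (Q : probability Omega R) (F : R -> set (set Omega))
  (r : E -> E -> R) (Delta : E)
  (tau : 'I_m -> Omega -> \bar R) (xi : 'I_m -> Omega -> E).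

Local Open Scope ereal_scope.

Definition Hproc (i : 'I_m) (t : R) (w : Omega) : E :=
  if t%:E < tau i w then Delta else xi i w.

Definition Hsig (t : \bar R) : set (set Omega) :=
  <<s [set S | exists i s B, [/\ (0 <= s)%R, s%:E <= t, borel_of r B &
        S = [set w | B (Hproc i s w)]]] >>.

Definition Nstar : set (set Omega) := null_sigma Q (sjoin (Hsig +oo) (Finf F)).

Definition Gstar (t : R) : set (set Omega) :=
  sjoin Nstar (\bigcap_(s in [set s : R | (t < s)%R]) sjoin (F s) (Hsig s%:E)).

(* sigma_{m,k}: increasing reordering; sigma_{m,0} = 0, sigma_{m,m+1} = +oo *)
Definition sigma_ord (k : nat) (w : Omega) : \bar R :=
  if k == 0%N then 0
  else nth +oo (sort (fun a b : \bar R => a <= b) [seq tau i w | i <- enum 'I_m])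
           k.-1.

Definition Hstop (i : 'I_m) (S : Omega -> \bar R) (w : Omega) : R -> E :=
  fun t => if Order.min t%:E (S w) < tau i w then Delta else xi i w.

Definition DO_sigma : set (set (('I_m -> R -> E) * (R * Omega))) :=
  <<s [set S | exists A O, [/\ skorokhod_prod m r A, optional_sigma F O &
        S = A `*` O]] >>.

Definition splitting_formula :=
  forall Y : R -> Omega -> R, is_optional Gstar Y ->
  exists Ys : 'I_m.+1 -> ('I_m -> R -> E) -> R -> Omega -> R,
    (forall i (B : set R), measurable B ->
        DO_sigma [set p | (0 <= p.2.1)%R /\ B (Ys i p.1 p.2.1 p.2.2)]) /\
    exists N, [/\ Nstar N,
      (exists M, measurable M /\ Q M = 0 /\ N `<=` M) &
      forall w, ~ N w -> forall t : R, (0 <= t)%R ->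
        Y t w = (\sum_(i < m.+1)
                   Ys i (fun j => Hstop j (sigma_ord i) w) t w *
                   (if ((sigma_ord i w <= t%:E)%E && (t%:E < sigma_ord i.+1 w)%E)
                    then 1 else 0))%R].

End marked.

Section spaces.
Context {R : realType} {E : pointedType}.

Definition Zgen (r : E -> E -> R) : set (set (E * \bar R)) :=
  [set S | exists B C, [/\ borel_of r B, measurable C & S = B `*` C]].

Definition Ztype (r : E -> E -> R) := g_sigma_algebraType (Zgen r).

Definition Ygen (m : nat) (r : E -> E -> R) : set (set ('I_m -> Ztype r)) :=
  [set S | exists i (A : set (Ztype r)), measurable A /\ S = [set y | A (y i)]].

Definition Ytype (m : nat) (r : E -> E -> R) := g_sigma_algebraType (Ygen m r).

End spaces.

(* Main.v *)
Require Import Defs.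
From HB Require Import structures.
From mathcomp Require Import all_boot all_order all_algebra.
From mathcomp Require Import all_classical all_reals all_analysis.
From mathcomp Require Import measurable_realfun lra.

Import Order.TTheory GRing.Theory Num.Theory.
Import numFieldNormedType.Exports.
Local Open Scope classical_set_scope.
Local Open Scope ring_scope.

(* Write K for the space of m-tuples of marked times and [state k w] in K for the
   marked times of w up to the k-th order statistic. Before the (k+1)-st order
   statistic a G*-event at time t is the trace of an event of the product filtration
   K x F_t under w |-> (state k w, w). By the density hypothesis the law of
   (state k w, w) is absolutely continuous with respect to la x Q for a probability
   la on K, so it is enough to split almost everywhere for la x Q.

   G*-optional sets are generated by sets {T <= t} with T a debut along rational
   times: for X cadlag, {a < X_t} is obtained from the debuts of {X > c} and
   {X < c} after a rational time. Such a set corresponds to an increasing family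
   V_q in K x F_q (q rational), and {T <= t} is the set where V_q holds for all q > t.
   It is recognised by the martingales M^q_t = (la x Q)(V_q | K x F_t), as the set
   where M^q_t = 1 for all q > t. These martingales have versions that are
   right-continuous in t and measurable for K x O(F): for V a rectangle this is the
   existence of cadlag versions (Dubins' upcrossing inequality), and a monotone
   class argument with the maximal inequality gives the general case. *)

(** * Sigma-algebras and rational times *)

(** The marks range over an uncountable space, so martingale versions chosen separately for each
    value of the marks could not be assembled: their exceptional sets could not be united. All
    conditional probabilities are therefore taken on the product with [K], the marks being a
    parameter. Under [la x Q] the marks are independent of the second coordinate, so for a rectangle
    conditioning acts on that coordinate alone and the cadlag theorem without parameter applies. The
    detour through stopping times concerns optionality. Splitting a cadlag process at rational times
    and taking right limits would only give progressive dependence on time and outcome; conditional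
    probabilities of stopping events have right-continuous versions that are optional. The measure
    [la] depends on the number of order statistics passed. Truncation sends every later mark to the
    single value [(Delta, +oo)], so the truncated law may have atoms that the original product
    measure does not charge; the image of that measure under the same truncation charges them. *)

Section set_system_closure.
Context {T : Type} {S : set (set T)} (sS : sigma_algebra setT S).

Lemma sa_bigcup (A : (set T)^nat) : (forall n, S (A n)) -> S (\bigcup_n A n).
Proof. by case: sS => _ _; exact. Qed.

Lemma sa_not (p : T -> Prop) : S [set x | p x] -> S [set x | ~ p x].
Proof. by case: sS => _ h _ /h; rewrite setTD. Qed.

Lemma sa_const (c : Prop) : S [set _ | c].
Proof.
have S0 : S [set x | False] by case: sS => h _ _; exact: h.
have [hc|hc] := pselect c.
  rewrite (_ : [set _ | c] = [set x : T | ~ False]); first exact: sa_not.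
  by apply/seteqP; split => // x _ [].
by rewrite (_ : [set _ | c] = [set x : T | False])//; apply/seteqP; split => x // /hc.
Qed.

(** The side condition [c] does not depend on the point, so unions over rational times subject to an
    order constraint need no restricted index type. *)
Lemma sa_ex (c : nat -> Prop) (p : nat -> T -> Prop) :
  (forall n, c n -> S [set x | p n x]) -> S [set x | exists n, c n /\ p n x].
Proof.
move=> h.
rewrite (_ : mkset _ = \bigcup_n [set x | c n /\ p n x]); last first.
  by apply/seteqP; split => [x [n ?]|x [n _ ?]]; exists n.
apply: sa_bigcup => n; have [hc|hc] := pselect (c n).
  rewrite (_ : mkset _ = [set x | p n x]); first exact: h.
  by apply/seteqP; split => [x []|x].
rewrite (_ : mkset _ = [set _ | False]); first exact: sa_const.
by apply/seteqP; split => [x []|x].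
Qed.

Lemma sa_all (c : nat -> Prop) (p : nat -> T -> Prop) :
  (forall n, c n -> S [set x | p n x]) -> S [set x | forall n, c n -> p n x].
Proof.
move=> h; rewrite (_ : mkset _ = [set x | ~ exists n, c n /\ ~ p n x]).
  by apply/sa_not/sa_ex => n /h; exact: sa_not.
apply/seteqP; split => [x px [n [cn]]|x px n cn].
  by apply; exact: px.
by apply: contrapT => np; apply: px; exists n.
Qed.

Lemma sa_or (p q : T -> Prop) :
  S [set x | p x] -> S [set x | q x] -> S [set x | p x \/ q x].
Proof.
move=> Sp Sq; rewrite (_ : mkset _ =
  [set x | exists n, True /\ (if n is 0%N then p x else q x)]).
  by apply: (sa_ex (fun=> True) (fun n x => if n is 0%N then p x else q x)) => -[|n].
apply/seteqP; split => [x [px|qx]|x [[|n] [_ h]]]; first by exists 0%N.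
- by exists 1%N.
- by left.
- by right.
Qed.

Lemma sa_and (p q : T -> Prop) :
  S [set x | p x] -> S [set x | q x] -> S [set x | p x /\ q x].
Proof.
move=> Sp Sq; rewrite (_ : mkset _ = [set x | ~ (~ p x \/ ~ q x)]).
  by apply: sa_not; apply: sa_or; exact: sa_not.
apply/seteqP; split => [x [px qx] [|]//|x h].
by split; apply: contrapT => h'; apply: h; [left|right].
Qed.

Lemma sa_ex_fin (I : finType) (p : I -> T -> Prop) :
  (forall i, S [set x | p i x]) -> S [set x | exists i, p i x].
Proof.
move=> h; rewrite (_ : mkset _ =
  [set x | exists n, True /\ (exists i, enum_rank i = n :> nat /\ p i x)]).
  apply: sa_ex => n _; have [[i hi]|hn] := pselect (exists i : I, enum_rank i = n :> nat).
    rewrite (_ : mkset _ = [set x | p i x]); first exact: h.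
    apply/seteqP; split => [x [j []]|x px]; last by exists i.
    by rewrite -hi => /val_inj/enum_rank_inj ->.
  rewrite (_ : mkset _ = [set _ | False]); first exact: sa_const.
  by apply/seteqP; split => [x [i [hi _]]|x []]; apply: hn; exists i.
apply/seteqP; split => [x [i px]|x [n [_ [i [_ px]]]]]; last by exists i.
by exists (enum_rank i); split => //; exists i.
Qed.

End set_system_closure.

Lemma g_sigma_sa {T : Type} (G : set (set T)) : sigma_algebra setT <<s G >>.
Proof. exact: smallest_sigma_algebra. Qed.

Lemma g_sigma_ind {T : Type} (G H : set (set T)) :
  sigma_algebra setT H -> G `<=` H -> <<s G >> `<=` H.
Proof. by move=> sH GH; exact: smallest_sub. Qed.

Lemma g_sigma_preimage {T U : Type} (f : T -> U) (S : set (set T)) (G : set (set U)) :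
  sigma_algebra setT S -> (forall B, G B -> S [set x | B (f x)]) ->
  forall B, <<s G >> B -> S [set x | B (f x)].
Proof.
move=> sS hG; apply: (g_sigma_ind _ [set B | S [set x | B (f x)]]) => //.
split => /=; first exact: (sa_const sS).
- by move=> A SA; apply: (sa_and sS); [exact: (sa_const sS)|exact: (sa_not sS)].
- move=> A SA; rewrite (_ : mkset _ = [set x | exists n, True /\ A n (f x)]).
    by apply: (sa_ex sS) => n _; exact: SA.
  by apply/seteqP; split => x [n]; [exists n|move=> [_ ?]; exists n].
Qed.

Lemma measurable_sa d (T : measurableType d) :
  sigma_algebra setT (@measurable d T).
Proof.
split; [exact: measurable0|by move=> A mA; rewrite setTD; exact: measurableC|].
by move=> A mA; exact: bigcupT_measurable.
Qed.

Section dense_times.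
Context {R : realType}.

(** An enumeration, with repetitions, of the nonnegative rationals: codes of no rational give 0, and
    the absolute value makes every index a legitimate time. *)
Definition qt (n : nat) : R := `|ratr (odflt 0 (unpickle n : option rat))|.

Lemma qt_ge0 n : 0 <= qt n. Proof. exact: normr_ge0. Qed.

Lemma qt_dense (x y : R) : 0 <= x -> x < y -> exists n, x < qt n < y.
Proof.
move=> x0 xy; have [q] := rat_in_itvoo xy; rewrite in_itv /= => /andP[xq qy].
exists (pickle q); rewrite /qt pickleK /= ger0_norm ?xq//.
exact/ltW/(le_lt_trans x0).
Qed.

End dense_times.

Section finite_measure.
Context {d} {T : measurableType d} {R : realType}.
Variable P : {measure set T -> \bar R}.
Hypothesis P1 : P setT = 1%E.

Definition pr (A : set T) : R := fine (P A).

Lemma prE A : measurable A -> P A = (pr A)%:E.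
Proof.
move=> mA; rewrite /pr fineK// ge0_fin_numE// (@le_lt_trans _ _ (P setT))//.
  by apply: le_measure; rewrite ?inE.
by rewrite P1 ltry.
Qed.

Lemma prT : pr setT = 1. Proof. by rewrite /pr P1. Qed.

Lemma pr0 : pr set0 = 0. Proof. by rewrite /pr measure0. Qed.

Lemma pr_ge0 A : 0 <= pr A. Proof. by rewrite /pr fine_ge0. Qed.

Lemma pr_le A B : measurable A -> measurable B -> A `<=` B -> pr A <= pr B.
Proof.
by move=> mA mB AB; rewrite -lee_fin -!prE//; apply: le_measure; rewrite ?inE.
Qed.

Lemma pr_split A B : measurable A -> measurable B ->
  pr B = pr (A `&` B) + pr (B `\` A).
Proof.
move=> mA mB; apply: EFin_inj; rewrite EFinD -!prE//.
- by rewrite setIC -measureU ?setUIDK//; [exact: measurableI|exact: measurableD|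
    rewrite setDE setIACA setICr setI0].
- exact: measurableD.
- exact: measurableI.
Qed.

Lemma pr_cvg (A : (set T)^nat) : (forall n, measurable (A n)) ->
  (forall n m, (n <= m)%N -> A n `<=` A m) ->
  pr (A n) @[n --> \oo] --> pr (\bigcup_n A n).
Proof.
move=> mA ndA; have mU : measurable (\bigcup_n A n) by exact: bigcupT_measurable.
have : P (A n) @[n --> \oo] --> P (\bigcup_n A n).
  by apply: nondecreasing_cvg_mu => // n m nm; apply/subsetPset/ndA.
by rewrite prE// => /fine_cvg; apply.
Qed.

Lemma pr_eq0 A : measurable A -> pr A = 0 -> P A = 0%E.
Proof. by move=> mA h; rewrite prE// h. Qed.

End finite_measure.

(** * Maximal inequality for events observed at rational times *)

Section maximal_inequality.
Context {d} {T : measurableType d} {R : realType}.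
Variable P : {measure set T -> \bar R}.
Hypothesis P1 : P setT = 1%E.
Variable F : R -> set (set T).
Hypothesis fF : is_filtration F.

Local Notation pr := (pr P).

Lemma filt_sa t : 0 <= t -> sigma_algebra setT (F t).
Proof. by move=> /fF.1 []. Qed.

Lemma filt_meas t A : 0 <= t -> F t A -> measurable A.
Proof. by move=> /fF.1 [_]; exact. Qed.

(** First-entrance decomposition, by induction on the last time of the sorted list: the union [U] of
    the earlier events lies in [F (qt n)], so the part of [A n] outside [U] is an admissible [B],
    and the two disjoint pieces add up. *)
Lemma maximal_finite (C : set T) (A : (set T)^nat) (e : R) (s : seq nat) :
  measurable C ->
  sorted (relpre (@qt R) <=%R) s ->
  (forall n, F (qt n) (A n)) ->
  (forall n B, F (qt n) B -> B `<=` A n -> pr (C `&` B) <= e * pr B) ->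
  pr (C `&` [set x | exists n, n \in s /\ A n x]) <=
    e * pr [set x | exists n, n \in s /\ A n x].
Proof.
move=> mC + FA hA; elim/last_ind: s => [_|s n IH].
  rewrite (_ : mkset _ = set0); last first.
    by apply/seteqP; split => x // [n []].
  by rewrite setI0 pr0 mulr0.
move=> srt.
have srts : sorted (relpre (@qt R) <=%R) s.
  by apply: subseq_sorted srt; [by move=> x y z /=; exact: le_trans|exact: subseq_rcons].
have le_n i : i \in s -> qt i <= qt n :> R.
  move: srt; rewrite sorted_pairwise; last by move=> x y z /=; exact: le_trans.
  by rewrite pairwise_rcons => /andP[/allP h _] /h.
have {IH} := IH srts; set U := [set x | exists n, n \in s /\ A n x] => IH.
have FU : F (qt n) U.
  apply: (sa_ex (filt_sa _ (qt_ge0 n))) => i si.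
  by apply: (fF.2 (qt i)); [exact: qt_ge0|exact: le_n|exact: FA].
have FD : F (qt n) (A n `\` U).
  by apply: (sa_and (filt_sa _ (qt_ge0 n))); [exact: FA|exact: (sa_not (filt_sa _ (qt_ge0 n)))].
have UE : [set x | exists i, i \in rcons s n /\ A i x] = U `|` (A n `\` U).
  apply/seteqP; split => x.
    move=> [i [+ Ai]]; rewrite mem_rcons inE => /orP[/eqP <-|si].
      by have [Ux|nUx] := pselect (U x); [left|right].
    by left; exists i.
  move=> [[i [si Ai]]|[An _]]; first by exists i; split => //; rewrite mem_rcons inE si orbT.
  by exists n; rewrite mem_rcons inE eqxx.
have mU := filt_meas _ _ (qt_ge0 n) FU.
have mD := filt_meas _ _ (qt_ge0 n) FD.
have mW : measurable (U `|` (A n `\` U)) by exact: measurableU.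
rewrite UE (pr_split _ P1 _ _ mU mW) (pr_split _ P1 _ _ mU (measurableI _ _ mC mW)).
have -> : U `&` (U `|` A n `\` U) = U.
  by apply/seteqP; split => x; rewrite /=; tauto.
have -> : (U `|` A n `\` U) `\` U = A n `\` U.
  by apply/seteqP; split => x; rewrite /=; tauto.
have -> : U `&` (C `&` (U `|` A n `\` U)) = C `&` U.
  by apply/seteqP; split => x; rewrite /=; tauto.
have -> : (C `&` (U `|` A n `\` U)) `\` U = C `&` (A n `\` U).
  by apply/seteqP; split => x; rewrite /=; tauto.
by rewrite mulrDr lerD//; apply: (hA n) => // x [].
Qed.

(** The enumeration [qt] is not monotone, so the first [N] indices are sorted by time before the
    finite case applies; continuity from below lets [N] grow. *)
Lemma maximal_le (C : set T) (A : (set T)^nat) (e : R) :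
  measurable C -> (forall n, F (qt n) (A n)) ->
  (forall n B, F (qt n) B -> B `<=` A n -> pr (C `&` B) <= e * pr B) ->
  pr (C `&` \bigcup_n A n) <= e * pr (\bigcup_n A n).
Proof.
move=> mC FA hA.
pose U N := [set x | exists n, n \in sort (relpre (@qt R) <=%R) (iota 0 N) /\ A n x].
have UE N : U N = [set x | exists n, (n < N)%N /\ A n x].
  apply/seteqP; split => x [n].
    by rewrite mem_sort mem_iota add0n /= => h; exists n.
  by move=> h; exists n; rewrite mem_sort mem_iota add0n.
have mA n : measurable (A n) by exact: (filt_meas _ _ (qt_ge0 n)).
have mU N : measurable (U N).
  by rewrite UE; apply: (sa_ex (measurable_sa _ _)) => n _; exact: mA.
have ndU n m : (n <= m)%N -> U n `<=` U m.
  by move=> nm; rewrite !UE => x [i [ni Ai]]; exists i; split => //; exact: leq_trans nm.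
have bigU : \bigcup_n A n = \bigcup_n U n.
  apply/seteqP; split => x.
    by move=> [n _ An]; exists n.+1 => //; rewrite UE; exists n.
  by move=> [N _]; rewrite UE => -[n [_ An]]; exists n.
have le_N N : pr (C `&` U N) <= e * pr (U N).
  apply: maximal_finite => //; apply: sort_sorted => x y /=; exact: le_total.
have cvgC : pr (C `&` U n) @[n --> \oo] --> pr (\bigcup_n (C `&` U n)).
  apply: pr_cvg => // [n|n m nm]; first exact: measurableI.
  by apply: setIS; exact: ndU.
have cvgU : e * pr (U n) @[n --> \oo] --> e * pr (\bigcup_n U n).
  by apply: cvgM; [exact: cvg_cst|exact: pr_cvg].
by rewrite bigU setI_bigcupr; apply: (ler_cvg_to cvgC cvgU); exact: nearW.
Qed.

(** The upper bound for the complement of [C] with the constant [1 - e]. *)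
Lemma maximal_ge (C : set T) (A : (set T)^nat) (e : R) :
  measurable C -> (forall n, F (qt n) (A n)) ->
  (forall n B, F (qt n) B -> B `<=` A n -> e * pr B <= pr (C `&` B)) ->
  e * pr (\bigcup_n A n) <= pr (C `&` \bigcup_n A n).
Proof.
move=> mC FA hA.
have mU : measurable (\bigcup_n A n).
  by apply: bigcupT_measurable => n; exact: (filt_meas _ _ (qt_ge0 n)).
have h : pr (~` C `&` \bigcup_n A n) <= (1 - e) * pr (\bigcup_n A n).
  apply: maximal_le => //; first exact: measurableC.
  move=> n B FB BA; have mB := filt_meas _ _ (qt_ge0 n) FB.
  have := hA n B FB BA; rewrite [pr B](pr_split _ P1 _ _ mC mB).
  rewrite (_ : B `\` C = ~` C `&` B); last by rewrite setDE setIC.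
  lra.
move: h; rewrite (pr_split _ P1 _ _ mC mU).
rewrite (_ : _ `\` C = ~` C `&` \bigcup_n A n); last by rewrite setDE setIC.
lra.
Qed.

End maximal_inequality.

Section sub_measurable.
Context {T : Type} {R : realType}.

(** Measurability for a bare set system, because the sigma-algebra varies with time on one and the
    same type. *)
Definition sub_meas (S : set (set T)) (f : T -> R) :=
  forall B : set R, measurable B -> S [set x | B (f x)].

Lemma sub_measP (S : set (set T)) (f : T -> R) : sigma_algebra setT S ->
  (forall a, S [set x | a < f x]) -> sub_meas S f.
Proof.
move=> sS h B mB.
have := mB : (@measurable _ (g_sigma_algebraType (@ocitv R))) B.
rewrite RGenOInfty.measurableE.
apply: (g_sigma_preimage f) => //.
move=> _ [x ->]; rewrite /= (_ : mkset _ = [set y | x < f y]); first exact: h.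
by apply/seteqP; split => y; rewrite /= in_itv /= andbT.
Qed.

Lemma sub_meas_gt (S : set (set T)) (f : T -> R) a : sub_meas S f -> S [set x | a < f x].
Proof.
move=> h; have := h `]a, +oo[%classic (measurable_itv _).
by congr (S _); apply/seteqP; split => y; rewrite /= in_itv /= andbT.
Qed.

Lemma sub_meas_lt (S : set (set T)) (f : T -> R) a : sub_meas S f -> S [set x | f x < a].
Proof.
move=> h; have := h `]-oo, a[%classic (measurable_itv _).
by congr (S _); apply/seteqP; split => y; rewrite /= in_itv.
Qed.

End sub_measurable.

Lemma sub_meas_fun d (T : measurableType d) (R : realType) (S : set (set T)) (f : T -> R) :
  S `<=` measurable -> sub_meas S f -> measurable_fun setT f.
Proof. by move=> Sm h _ B mB; rewrite setTI; exact/Sm/h. Qed.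

(** * Upcrossings and cadlag martingales *)

Section crossings.
Context {R : realType}.
Implicit Types (f : R -> R) (a b u v t e dl l : R).

(* At least [k] upcrossings of [[a, b]] by [f] along the times [qt n] in [(u, v)];
   [downc] asks for one further passage below [a]. The starting time [-1] stands
   for "before time 0". *)
Fixpoint upc f a b (k : nat) u v : Prop :=
  if k is k'.+1 then
    exists n, qt n < v /\ (b < f (qt n) /\
    exists j, qt j < qt n :> R /\ (f (qt j) < a /\ upc f a b k' u (qt j)))
  else u < v.

Definition downc f a b k := exists j, True /\ (f (qt j) < a /\ upc f a b k (-1) (qt j)).

Lemma upc_mono f a b k u v u' v' : u' <= u -> v <= v' ->
  upc f a b k u v -> upc f a b k u' v'.
Proof.
elim: k u v u' v' => [|k IH] u v u' v' uu vv /=.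
  by move=> uv; rewrite (le_lt_trans uu)// (lt_le_trans uv).
move=> [n [nv [bn [j [jn [ja h]]]]]]; exists n; split; first exact: lt_le_trans vv.
by split => //; exists j; do 2 (split => //); apply: IH h.
Qed.

(** The recursion of [upc] removes the latest crossing, whereas times decreasing to a point produce
    ever earlier ones; this adds a crossing at the beginning. *)
Lemma upc_prepend f a b k j n u u' v : u < qt j -> qt j < qt n :> R -> qt n < u' ->
  f (qt j) < a -> b < f (qt n) -> upc f a b k u' v -> upc f a b k.+1 u v.
Proof.
move=> uj jn nu ja bn; elim: k v => [|k IH] v.
  move=> /= uv; exists n; split; first exact: lt_trans uv.
  by split => //; exists j.
move=> [n' [nv [bn' [j' [jn' [ja' h]]]]]]; exists n'; split => //; split => //.
by exists j'; do 2 (split => //); exact: IH.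
Qed.

Lemma qt_dense_neg (x y : R) : 0 < y -> x < y -> exists n, x < qt n < y.
Proof.
move=> y0 xy; have m0 : 0 <= Num.max x 0 by rewrite le_max lexx orbT.
have my : Num.max x 0 < y by rewrite gt_max xy y0.
have [n /andP[h1 h2]] := qt_dense _ _ m0 my.
by exists n; rewrite h2 andbT (le_lt_trans _ h1)// le_max lexx.
Qed.

(* If the upper and lower limits along the windows differed, two rational levels
   strictly between them would be crossed in every window. *)
Lemma window_limit (W : R -> nat -> Prop) f :
  (forall e, 0 < e -> exists n, W e n) ->
  (forall e e' n, e <= e' -> W e n -> W e' n) ->
  (forall n, 0 <= f (qt n) <= 1) ->
  (forall i j, qt i < qt j :> R ->
     (forall e, 0 < e -> exists n, W e n /\ f (qt n) < qt i) ->
     (forall e, 0 < e -> exists n, W e n /\ qt j < f (qt n)) -> False) ->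
  exists l, 0 <= l <= 1 /\ forall e, 0 < e -> exists2 dl, 0 < dl &
    forall n, W dl n -> `|f (qt n) - l| < e.
Proof.
move=> W0 Wm f01 hf.
(* [Y] collects the levels reached in every window, so its supremum is the upper limit; the crossing
   hypothesis [hf] forces the lower limit to agree with it. *)
pose Y := [set y : R | forall e, 0 < e -> exists n, W e n /\ y <= f (qt n)].
have Y0 : Y 0 by move=> e /W0 [n Wn]; exists n; split => //; case/andP: (f01 n).
have Yub : ubound Y 1.
  by move=> y /(_ _ ltr01)[n [_ yn]]; rewrite (le_trans yn)//; case/andP: (f01 n).
have hsY : has_sup Y by split; [exists 0|exists 1].
pose l := sup Y.
have l0 : 0 <= l by apply: ub_le_sup Y0; exact: hsY.2.
have l1 : l <= 1 by apply: ge_sup => //; exists 0.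
exists l; split; first by rewrite l0 l1.
move=> e e0.
have [d1 d10 hd1] : exists2 dl, 0 < dl & forall n, W dl n -> f (qt n) < l + e.
  apply: contrapT => h.
  have : Y (l + e).
    move=> dl dl0; apply: contrapT => h'; apply: h; exists dl => // n Wn.
    by rewrite ltNge; apply/negP => hn; apply: h'; exists n.
  by move=> /(ub_le_sup hsY.2); rewrite -/l; lra.
have [d2 d20 hd2] : exists2 dl, 0 < dl & forall n, W dl n -> l - e < f (qt n).
  apply: contrapT => h.
  have h2 dl : 0 < dl -> exists n, W dl n /\ f (qt n) <= l - e.
    move=> dl0; apply: contrapT => h'; apply: h; exists dl => // n Wn.
    by rewrite ltNge; apply/negP => hn; apply: h'; exists n.
  have le0 : 0 <= l - e.
    by have [n [_ hn]] := h2 _ ltr01; rewrite (le_trans _ hn)//; case/andP: (f01 n).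
  have lel : l - e < l by lra.
  have [j /andP[j1 j2]] := qt_dense _ _ le0 lel.
  have [i /andP[i1 i2]] := qt_dense _ _ le0 j1.
  apply: (hf i j i2) => dl dl0.
    by have [n [Wn hn]] := h2 dl dl0; exists n; split => //; exact: le_lt_trans i1.
  have lj0 : 0 < l - qt j by lra.
  have [y Yy] := sup_adherent lj0 hsY; rewrite -/l => jy'.
  have jy : qt j < y by lra.
  move: Yy => /(_ _ dl0)[n [Wn hn]]; exists n; split => //; exact: lt_le_trans hn.
exists (Num.min d1 d2); first by rewrite lt_min d10 d20.
move=> n Wn; rewrite ltr_norml; apply/andP; split.
  have := hd2 n (Wm _ _ _ _ Wn); rewrite ge_min lexx orbT => /(_ isT); lra.
by have := hd1 n (Wm _ _ _ _ Wn); rewrite ge_min lexx => /(_ isT); lra.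
Qed.

Definition rwin t e n := t < qt n < t + e.
Definition lwin t e n := t - e < qt n < t.

(** Each new crossing is fitted between [t] and those already found; hence the auxiliary claim keeps
    a starting time [u] strictly after [t]. *)
Lemma right_no_cross f a b t : 0 <= t ->
  (forall e, 0 < e -> exists n, rwin t e n /\ f (qt n) < a) ->
  (forall e, 0 < e -> exists n, rwin t e n /\ b < f (qt n)) ->
  forall k, downc f a b k.
Proof.
move=> t0 ha hb k.
have H v : t < v -> exists2 u, t < u < v & upc f a b k u v.
  elim: k v => [|k IH] v tv.
    by exists ((t + v) / 2); [apply/andP; split|]; rewrite /=; lra.
  have [u /andP[tu uv] hu] := IH v tv.
  have ut0 : 0 < u - t by lra.
  have [n [/andP[n1 n2] nb]] := hb _ ut0.
  have nt0 : 0 < qt n - t by lra.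
  have [j [/andP[j1 j2] ja]] := ha _ nt0.
  exists ((t + qt j) / 2); first by apply/andP; split; lra.
  by apply: (upc_prepend _ _ _ _ j n _ u) => //; lra.
have [j [/andP[j1 j2] ja]] := ha _ ltr01.
have [u /andP[tu _] hu] := H _ j1.
by exists j; split => //; split => //; apply: upc_mono hu => //; lra.
Qed.

(** The times accumulate from below, so crossings are appended after those already found, in the
    order of the recursion of [upc]. *)
Lemma left_no_cross f a b t : 0 < t ->
  (forall e, 0 < e -> exists n, lwin t e n /\ f (qt n) < a) ->
  (forall e, 0 < e -> exists n, lwin t e n /\ b < f (qt n)) ->
  forall k, downc f a b k.
Proof.
move=> t0 ha hb k.
have [v vt hv] : exists2 v, v < t & upc f a b k (-1) v.
  elim: k => [|k [v vt hv]]; first by exists 0 => //=; lra.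
  have tv0 : 0 < t - v by lra.
  have [j [/andP[j1 j2] ja]] := ha _ tv0.
  have tj0 : 0 < t - qt j by lra.
  have [n [/andP[n1 n2] nb]] := hb _ tj0.
  exists ((qt n + t) / 2); first by lra.
  exists n; split; first by lra.
  split => //; exists j; split; first by lra.
  by split => //; apply: upc_mono hv => //; lra.
have tv0 : 0 < t - v by lra.
have [j [/andP[j1 j2] ja]] := ha _ tv0.
by exists j; split => //; split => //; apply: upc_mono hv => //; lra.
Qed.

End crossings.

Section cadlag_martingale.
Context {d} {T : measurableType d} {R : realType}.
Variable P : {measure set T -> \bar R}.
Hypothesis P1 : P setT = 1%E.
Variable F : R -> set (set T).
Hypothesis fF : is_filtration F.

Local Notation pr := (pr P).
Implicit Types (t v a b : R).

Lemma int_bounded_le (B C : set T) (M : T -> R) (a : R) :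
  measurable B -> measurable C -> measurable_fun setT M ->
  (forall x, 0 <= M x) -> 0 <= a ->
  (\int[P]_(x in B) (M x)%:E = P (C `&` B))%E ->
  (forall x, B x -> M x <= a) -> pr (C `&` B) <= a * pr B.
Proof.
move=> mB mC mM M0 a0 hI hB; rewrite -lee_fin EFinM -!prE//; last exact: measurableI.
rewrite -hI -integral_cst//; apply: ge0_le_integral => //; first by move=> x _; rewrite lee_fin.
exact/measurable_EFinP/measurable_funTS.
Qed.

Lemma int_bounded_ge (B C : set T) (M : T -> R) (a : R) :
  measurable B -> measurable C -> measurable_fun setT M ->
  (forall x, 0 <= M x) -> 0 <= a ->
  (\int[P]_(x in B) (M x)%:E = P (C `&` B))%E ->
  (forall x, B x -> a <= M x) -> a * pr B <= pr (C `&` B).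
Proof.
move=> mB mC mM M0 a0 hI hB; rewrite -lee_fin EFinM -!prE//; last exact: measurableI.
rewrite -hI -integral_cst//; apply: ge0_le_integral => //.
exact/measurable_EFinP/measurable_funTS.
Qed.

Section upcrossing.
Variables (C : set T) (mC : measurable C) (N : R -> T -> R).
Hypothesis N01 : forall t w, 0 <= t -> 0 <= N t w <= 1.
Hypothesis adN : forall t, 0 <= t -> sub_meas (F t) (N t).
Hypothesis intN : forall t B, 0 <= t -> F t B ->
  (\int[P]_(x in B) (N t x)%:E = P (C `&` B))%E.

Let Np w := N ^~ w.

Lemma upc_adapted a b k v : 0 <= v -> F v [set w | upc (Np w) a b k (-1) v].
Proof.
elim: k v => [|k IH] v v0 /=; first exact: (sa_const (filt_sa _ fF _ v0)).
apply: (sa_ex (filt_sa _ fF _ v0)) => n nv.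
have q0 := @qt_ge0 R n.
apply: (fF.2 (qt n)) => //; first exact: ltW.
apply: (sa_and (filt_sa _ fF _ q0)); first exact: (sub_meas_gt _ _ _ (adN _ q0)).
apply: (sa_ex (filt_sa _ fF _ q0)) => j jn.
apply: (fF.2 (qt j)) => //; [exact: qt_ge0|exact: ltW|].
have q0' := @qt_ge0 R j.
apply: (sa_and (filt_sa _ fF _ q0')); first exact: (sub_meas_lt _ _ _ (adN _ q0')).
exact: IH.
Qed.

Let D a b k := [set w | downc (Np w) a b k].

Let mD a b k : measurable (D a b k).
Proof.
apply: (sa_ex (measurable_sa _ T)) => j _; apply: (filt_meas _ fF (qt j)); first exact: qt_ge0.
have q0 := @qt_ge0 R j.
apply: (sa_and (filt_sa _ fF _ q0)); first exact: (sub_meas_lt _ _ _ (adN _ q0)).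
exact: upc_adapted.
Qed.

Let N_ge0 n w : 0 <= N (qt n) w.
Proof. by have /andP[] := N01 (qt n) w (qt_ge0 n). Qed.

Let mN n : measurable_fun setT (N (qt n)).
Proof.
by apply: sub_meas_fun (adN _ (qt_ge0 n)) => B; exact: filt_meas fF _ _ (qt_ge0 n).
Qed.

(** Let D be a passage below [a] after [k] crossings and D' a later value above [b]. The maximal
    inequalities give pr(C and D) <= a pr(D) and b pr(D') <= pr(C and D'); as D' lies in D, a
    further crossing costs a factor [a / b]. *)
Lemma dubins_step a b k : 0 <= a -> a < b -> pr (D a b k.+1) <= a / b * pr (D a b k).
Proof.
move=> a0 ab; have b0 : 0 < b by exact: le_lt_trans ab.
have bi0 : 0 < b^-1 by rewrite invr_gt0.
pose A j := [set w | N (qt j) w < a /\ upc (Np w) a b k (-1) (qt j)].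
pose A' n := [set w | b < N (qt n) w /\
  exists j, qt j < qt n :> R /\ (N (qt j) w < a /\ upc (Np w) a b k (-1) (qt j))].
have FA j : F (qt j) (A j).
  have q0 := @qt_ge0 R j.
  apply: (sa_and (filt_sa _ fF _ q0)); first exact: (sub_meas_lt _ _ _ (adN _ q0)).
  exact: upc_adapted.
have FA' n : F (qt n) (A' n).
  have q0 := @qt_ge0 R n.
  apply: (sa_and (filt_sa _ fF _ q0)); first exact: (sub_meas_gt _ _ _ (adN _ q0)).
  apply: (sa_ex (filt_sa _ fF _ q0)) => j jn.
  by apply: (fF.2 (qt j)); [exact: qt_ge0|exact: ltW|exact: FA].
have DE : D a b k = \bigcup_j A j.
  by apply/seteqP; split => w [j]; [move=> [_ h]|move=> _ h]; exists j.
have mE : measurable (\bigcup_n A' n).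
  by apply: bigcupT_measurable => n; apply: (filt_meas _ fF (qt n)) => //; exact: qt_ge0.
have DE' : D a b k.+1 `<=` \bigcup_n A' n.
  by move=> w [j [_ [_ [n [_ [bn h]]]]]]; exists n.
have E'D : \bigcup_n A' n `<=` D a b k.
  by move=> w [n _ [_ [j [_ h]]]]; exists j.
have h1 : pr (C `&` \bigcup_j A j) <= a * pr (\bigcup_j A j).
  apply: (maximal_le P P1 F fF) => // n B FB BA.
  apply: (int_bounded_le _ _ (N (qt n))) => //; first exact: (filt_meas _ fF _ _ (qt_ge0 n) FB).
    by apply: intN => //; exact: qt_ge0.
  by move=> x /BA [/ltW].
have h2 : b * pr (\bigcup_n A' n) <= pr (C `&` \bigcup_n A' n).
  apply: (maximal_ge P P1 F fF) => // n B FB BA.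
  apply: (int_bounded_ge _ _ (N (qt n))) => //; first exact: (filt_meas _ fF _ _ (qt_ge0 n) FB).
  - exact: ltW.
  - by apply: intN => //; exact: qt_ge0.
  - by move=> x /BA [/ltW].
rewrite -DE in h1.
have h3 : pr (C `&` \bigcup_n A' n) <= pr (C `&` D a b k).
  by apply: pr_le => //; [exact: measurableI|exact: measurableI|exact: setIS].
have h4 : pr (D a b k.+1) <= pr (\bigcup_n A' n) by apply: pr_le.
apply: (le_trans h4); rewrite -(ler_pM2l b0) mulrA mulrCA divff ?gt_eqF// mulr1.
by rewrite (le_trans h2)// (le_trans h3).
Qed.

Lemma downc_null a b : 0 <= a -> a < b -> P (\bigcap_k D a b k) = 0%E.
Proof.
move=> a0 ab; have b0 : 0 < b by exact: le_lt_trans ab.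
have mI : measurable (\bigcap_k D a b k).
  by apply: bigcapT_measurable => k; exact: mD.
apply: pr_eq0 => //; apply/eqP; rewrite eq_le pr_ge0 andbT.
have le_k k : pr (\bigcap_k D a b k) <= (a / b) ^+ k.
  apply: (@le_trans _ _ (pr (D a b k))).
    by apply: pr_le => // w /(_ k I).
  elim: k => [|k IH].
    by rewrite expr0 -(prT P P1); apply: pr_le.
  rewrite exprS (le_trans (dubins_step _ _ _ a0 ab))// ler_wpM2l//.
  by rewrite divr_ge0// ltW.
have c0 : (a / b) ^+ k @[k --> \oo] --> (0 : R).
  by apply: cvg_expr; rewrite ger0_norm ?divr_ge0 ?(ltW b0)// ltr_pdivrMr ?mul1r.
apply: (ler_cvg_to _ c0); [exact: cvg_cst|exact: nearW].
Qed.

End upcrossing.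
End cadlag_martingale.

(** * Conditional probabilities by Radon-Nikodym derivatives *)

Section conditional_probability.
Context {d} {T : measurableType d} {R : realType}.
Variable P : {measure set T -> \bar R}.
Hypothesis P1 : P setT = 1%E.

Section restricted_measure.
Variables (S : set (set T)) (hS : <<s S >> `<=` measurable) (C : set T) (mC : measurable C).

(** Living on the smaller sigma-algebra, this measure has a density that is measurable for [S]. The
    two proofs are arguments so that the measure structure can be attached to the term. *)
Definition submeas (_ : <<s S >> `<=` @measurable d T) (_ : measurable C)
  (A : set (g_sigma_algebraType S)) : \bar R := P (C `&` A).

Let submeas0 : submeas hS mC set0 = 0%E.
Proof. by rewrite /submeas setI0 measure0. Qed.

Let submeas_ge0 A : (0 <= submeas hS mC A)%E.
Proof. exact: measure_ge0. Qed.

Let submeas_sigma_additive : semi_sigma_additive (submeas hS mC).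
Proof.
move=> F mF tF mUF; rewrite /submeas setI_bigcupr.
apply: measure_semi_sigma_additive.
- by move=> n; apply: measurableI => //; apply: hS; exact: mF.
- apply/trivIsetP => /= i j _ _ ij.
  by move/trivIsetP : tF => /(_ _ _ I I ij); rewrite setIACA => ->; rewrite setI0.
- by rewrite -setI_bigcupr; apply: measurableI => //; exact: (hS _ mUF).
Qed.

HB.instance Definition _ := isMeasure.Build _ _ _ (submeas hS mC)
  submeas0 submeas_ge0 submeas_sigma_additive.

Let submeas_fin : fin_num_fun (submeas hS mC).
Proof.
move=> A mA; rewrite /submeas (prE P P1)//; apply: measurableI => //; exact: (hS _ mA).
Qed.

HB.instance Definition _ := Measure_isFinite.Build _ _ _ (submeas hS mC) submeas_fin.

End restricted_measure.

Let cond_prob0 (S : set (set T)) (C : set T) :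
  sigma_algebra setT S -> S `<=` measurable -> measurable C ->
  exists f : T -> \bar R, [/\ forall x, (0 <= f x)%E, forall x, f x \is a fin_num,
    forall a, S [set x | (a%:E <= f x)%E], forall a, S [set x | (a%:E < f x)%E] &
    measurable_fun setT f /\
    forall B, S B -> (\int[P]_(x in B) f x = P (C `&` B))%E].
Proof.
move=> sS Sm mC; pose hP1 := P1.
have SE : <<s S >> = S by exact: sigma_algebra_id.
have hS : <<s S >> `<=` measurable by rewrite SE.
pose mu := submeas S setT hS (@measurableT _ T).
pose nu := submeas S C hS mC.
have numu : nu `<< mu.
  apply/null_content_dominatesP => A mA muA.
  have PA : P A = 0%E by rewrite -(setTI A); exact: muA.
  have mA' : measurable (A : set T) by exact: (hS _ mA).
  by apply: (subset_measure0 _ mA') => //; exact: measurableI.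
have [f [f0 ffin intf fE]] := radon_nikodym_sigma_finite numu.
have mf : measurable_fun setT f by exact: measurable_int intf.
have mf' : measurable_fun setT (f : T -> \bar R).
  by move=> _ B mB; exact: (hS _ (mf measurableT B mB)).
have fE' (B : set T) : S B -> (\int[P]_(x in B) f x = P (C `&` B))%E.
  move=> SB; have mB : @measurable _ (g_sigma_algebraType S) B by rewrite /measurable /= SE.
  have hCB : P (C `&` B) = (\int[mu]_(x in B) f x)%E := fE _ mB.
  rewrite hCB.
  (* The restriction of [P] is its image under the identity map, which turns the integral over [mu]
     into one over [P]. *)
  have midT : measurable_fun setT (id : T -> g_sigma_algebraType S).
    by move=> _ A mA; rewrite setTI; exact: (hS _ mA).
  have -> : (\int[mu]_(x in B) f x =
      \int[pushforward P (id : T -> g_sigma_algebraType S)]_(x in B) f x)%E.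
    by apply: eq_measure_integral => A mA _; rewrite /mu /= /submeas setTI.
  rewrite (ge0_integral_pushforward midT P mB)//.
  exact: (measurable_funS measurableT _ mf).
have Sge a : S [set x | (a%:E <= f x)%E].
  have := mf measurableT _ (emeasurable_itv `[a%:E, +oo[).
  rewrite setTI /measurable /= SE; congr (S _).
  by apply/seteqP; split => x; rewrite /= in_itv /= andbT.
exists f; split => //.
move=> a; have := mf measurableT _ (emeasurable_itv `]a%:E, +oo[).
rewrite setTI /measurable /= SE; congr (S _).
by apply/seteqP; split => x; rewrite /= in_itv /= andbT.
Qed.

(** The density is at most 1 only almost everywhere: a set where it is at least 1 + c has measure m
    with (1 + c) m <= m. Truncation at 1 alters it on the null set [A1] alone and gives the bound at
    every point. *)
Lemma cond_prob (S : set (set T)) (C : set T) :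
  sigma_algebra setT S -> S `<=` measurable -> measurable C ->
  exists N : T -> R, [/\ forall x, 0 <= N x <= 1, sub_meas S N &
    forall B, S B -> (\int[P]_(x in B) (N x)%:E = P (C `&` B))%E].
Proof.
move=> sS Sm mC.
have [f [f0 ffin Sge Sgt [mf fE']]] := cond_prob0 S C sS Sm mC.
pose A1 := [set x | (1 < f x)%E].
have SA1 : S A1 by exact: (Sgt 1).
have mA1 : measurable A1 by exact: Sm.
have PA1 : P A1 = 0%E.
  have -> : A1 = [set x | exists n, True /\ ((1 + n.+1%:R^-1)%:E <= f x)%E].
    apply/seteqP; split => x; last first.
      move=> [n [_]]; apply: lt_le_trans; rewrite lte_fin ltrDl.
      by rewrite invr_gt0.
    rewrite /A1 /= -(fineK (ffin x)) lte_fin -subr_gt0 => h.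
    have [n hn] := ltr_add_invr h; exists n; split => //.
    by rewrite lee_fin; apply: ltW; move: hn; rewrite add0r ltrBrDl.
  apply/negligibleP; first by apply: (sa_ex (measurable_sa _ T)) => n _; apply: Sm; exact: Sge.
  rewrite (_ : mkset _ = \bigcup_n [set x | ((1 + n.+1%:R^-1)%:E <= f x)%E]); last first.
    by apply/seteqP; split => x [n] => [[_]|_]; exists n.
  apply: negligible_bigcup => n.
  have SAn := Sge (1 + n.+1%:R^-1); have mAn := Sm _ SAn.
  apply/negligibleP => //; set An := mkset _ in SAn mAn *.
  have : ((1 + n.+1%:R^-1)%:E * P An <= P An)%E.
    rewrite -integral_cst//; apply: (@le_trans _ _ (\int[P]_(x in An) f x)%E).
      apply: ge0_le_integral => //.
      - by move=> x _; rewrite lee_fin addr_ge0.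
      - exact: measurable_funTS.
    rewrite fE'//; apply: le_measure; rewrite ?inE//; exact: measurableI.
  have := pr_ge0 P An; rewrite (prE P P1)// -EFinM lee_fin => p0 le1.
  have n0 : (0 < n.+1%:R^-1 :> R) by rewrite invr_gt0.
  move: p0 le1 n0; set p := pr P An; set c := n.+1%:R^-1 => p0 le1 n0.
  by apply: (pr_eq0 P P1) => //; rewrite -/p; nra.
pose N x := Num.min (fine (f x)) 1.
have SN : sub_meas S N.
  apply: sub_measP => // a.
  rewrite (_ : mkset _ = [set x | (a%:E < f x)%E /\ a < 1]).
    by apply: (sa_and sS); [exact: Sgt|exact: (sa_const sS)].
  apply/seteqP; split => x; rewrite /N /= lt_min -[in (_ < f x)%E](fineK (ffin x)) lte_fin.
    by move=> /andP[].
  by move=> [-> ->].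
exists N; split.
- move=> x; rewrite /N; apply/andP; split.
  + by rewrite le_min ler01 fine_ge0.
  + by rewrite ge_min lexx orbT.
- exact: SN.
- move=> B SB; have mB := Sm _ SB; rewrite -(fE' _ SB); apply: ae_eq_integral => //.
  + exact/measurable_EFinP/measurable_funTS/(sub_meas_fun _ _ _ _ _ Sm SN).
  + exact: measurable_funTS.
  + exists A1; split => // x /= /not_implyP [Bx]; apply: contra_notP.
    rewrite /A1 /N /= => /negP; rewrite -leNgt => fx1.
    by rewrite min_l ?fineK// -lee_fin fineK.
Qed.

End conditional_probability.

Section cadlag_martingale_existence.
Context {d} {T : measurableType d} {R : realType}.
Variable P : {measure set T -> \bar R}.
Hypothesis P1 : P setT = 1%E.
Variable F : R -> set (set T).
Hypothesis fF : is_filtration F.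
Hypothesis rcF : filt_right_continuous F.
Hypothesis nullF : forall A B : set T, measurable B -> P B = 0%E -> A `<=` B -> F 0 A.
Implicit Types (t s a b e dl l : R).

(** Conditional probabilities chosen separately for each time carry no path regularity. Off the null
    event of unboundedly many crossings of some rational pair of levels, right limits along rational
    times exist and define [M]; right-continuity of [F] makes them adapted, and dominated
    convergence preserves the integrals. *)
Lemma cadlag_martingale (C : set T) : measurable C ->
  exists M : R -> T -> R, [/\ forall t w, 0 <= M t w <= 1, adapted F M,
    forall w, cadlag real_dist (M ^~ w) &
    forall t B, 0 <= t -> F t B ->
      (\int[P]_(w in B) (M t w)%:E = P (C `&` B))%E].
Proof.
move=> mC.
have h t : exists Nt : T -> R, 0 <= t -> [/\ forall w, 0 <= Nt w <= 1,
    sub_meas (F t) Nt &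
    forall B, F t B -> (\int[P]_(w in B) (Nt w)%:E = P (C `&` B))%E].
  have [t0|t0] := leP 0 t; last by exists (fun=> 0).
  have [sF Fm] := fF.1 t t0.
  by have [Nt hNt] := cond_prob P P1 (F t) C sF Fm mC; exists Nt.
have [N hN] := choice h.
have N01 t w : 0 <= t -> 0 <= N t w <= 1 by move=> /hN[].
have adN t : 0 <= t -> sub_meas (F t) (N t) by move=> /hN[].
have intN t B : 0 <= t -> F t B -> (\int[P]_(x in B) (N t x)%:E = P (C `&` B))%E.
  by move=> /hN[_ _]; exact.
have mN t : 0 <= t -> measurable_fun setT (N t).
  by move=> t0; apply: sub_meas_fun (adN _ t0) => B; exact: (filt_meas _ fF).
pose good w := forall i j, qt i < qt j :> R -> exists k, ~ downc (N ^~ w) (qt i) (qt j) k.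
pose Bd := [set w | ~ good w].
have [mBd PBd] : measurable Bd /\ P Bd = 0%E.
  have BdE : Bd = \bigcup_i \bigcup_j
      [set w | qt i < qt j :> R /\ forall k, True -> downc (N ^~ w) (qt i) (qt j) k].
    apply/seteqP; split => w.
      move=> gw; apply: contrapT => h1; apply: gw => i j ij.
      apply: contrapT => h2; apply: h1; exists i => //; exists j => //; split => // k _.
      by apply: contrapT => h3; apply: h2; exists k.
    by move=> [i _ [j _ [ij h1]]] /(_ _ _ ij)[k]; apply; exact: h1.
  have mZ i j : measurable [set w | qt i < qt j :> R /\
      forall k, True -> downc (N ^~ w) (qt i) (qt j) k].
    apply: (sa_and (measurable_sa _ T)); first exact: (sa_const (measurable_sa _ T)).
    apply: (sa_all (measurable_sa _ T)) => k _.
    apply: (sa_ex (measurable_sa _ T)) => n _; have q0 := @qt_ge0 R n.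
    apply: (filt_meas _ fF (qt n)) => //.
    apply: (sa_and (filt_sa _ fF _ q0)); first exact: (sub_meas_lt _ _ _ (adN _ q0)).
    exact: (upc_adapted F fF N).
  have mB : measurable Bd.
    by rewrite BdE; apply: bigcupT_measurable => i; exact: bigcupT_measurable.
  split => //; apply/negligibleP => //; rewrite BdE.
  apply: negligible_bigcup => i; apply: negligible_bigcup => j; apply/negligibleP => //.
  have [ij|ij] := pselect (qt i < qt j :> R).
    rewrite -(downc_null P P1 F fF C mC N N01 adN intN (qt i) (qt j) (qt_ge0 i) ij).
    congr (P _); apply/seteqP; split => w; first by move=> [_ h1] k _; exact: h1.
    by move=> h1; split => // k _; exact: h1.
  by rewrite (_ : mkset _ = set0) ?measure0//; apply/seteqP; split => w // [].
(* Because [F 0] contains the bad event, paths may be redefined there without losing adaptedness. *)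
have F0Bd : F 0 Bd by exact: nullF mBd PBd _.
pose RL w t l := forall e, 0 < e -> exists2 dl, 0 < dl &
  forall n, rwin t dl n -> `|N (qt n) w - l| < e.
have rlim w t : good w -> 0 <= t -> exists l, 0 <= l <= 1 /\ RL w t l.
  move=> gw t0; apply: (window_limit (rwin t) (N ^~ w)).
  - by move=> e e0; apply: qt_dense => //; rewrite ltrDl.
  - by move=> e e' n ee /andP[h1 h2]; rewrite /rwin h1 (lt_le_trans h2)// lerD2l.
  - by move=> n; apply: N01; exact: qt_ge0.
  - move=> i j ij hi hj; have [k] := gw i j ij; apply.
    exact: (right_no_cross _ _ _ t).
have llim w t : good w -> 0 < t -> exists l, 0 <= l <= 1 /\ forall e, 0 < e ->
    exists2 dl, 0 < dl & forall n, lwin t dl n -> `|N (qt n) w - l| < e.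
  move=> gw t0; apply: (window_limit (lwin t) (N ^~ w)).
  - by move=> e e0; apply: qt_dense_neg => //; rewrite ltrBlDr ltrDl.
  - by move=> e e' n ee /andP[h1 h2]; rewrite /lwin h2 andbT (le_lt_trans _ h1)// lerD2l lerN2.
  - by move=> n; apply: N01; exact: qt_ge0.
  - move=> i j ij hi hj; have [k] := gw i j ij; apply.
    exact: (left_no_cross _ _ _ t).
(* On bad paths the set is empty, and the default 0 of [xget] makes the path constant. *)
pose M t w : R := xget 0 [set l | good w /\ (0 <= l <= 1 /\ RL w t l)].
have M01 t w : 0 <= M t w <= 1.
  rewrite /M; case: xgetP => [l -> [_ []]//|_]; by rewrite lexx ler01.
have Mbad t w : ~ good w -> M t w = 0.
  by move=> gw; rewrite /M xgetPN// => l [].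
have Mgood t w : good w -> 0 <= t -> RL w t (M t w).
  move=> gw t0; have [l hl] := rlim w t gw t0.
  have : [set l | good w /\ (0 <= l <= 1 /\ RL w t l)] l by [].
  by move=> /(xgetI 0)[_ []].
have Mclose w s l e : good w -> 0 <= s ->
    (exists2 dl, 0 < dl & forall n, rwin s dl n -> `|N (qt n) w - l| < e) ->
    `|M s w - l| <= e.
  move=> gw s0 [dl dl0 hdl]; rewrite leNgt; apply/negP => lt_e.
  have e0 : 0 < `|M s w - l| - e by rewrite subr_gt0.
  have [dl2 dl20 hdl2] := Mgood s w gw s0 _ e0.
  have m0 : s < s + Num.min dl dl2 by rewrite ltrDl lt_min dl0 dl20.
  have [n /andP[n1 n2]] := qt_dense _ _ s0 m0.
  have h1 : `|N (qt n) w - l| < e.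
    by apply: hdl; rewrite /rwin n1 (lt_le_trans n2)// lerD2l ge_min lexx.
  have h2 : `|N (qt n) w - M s w| < `|M s w - l| - e.
    by apply: hdl2; rewrite /rwin n1 (lt_le_trans n2)// lerD2l ge_min lexx orbT.
  have := ler_normD (M s w - N (qt n) w) (N (qt n) w - l).
  rewrite addrA subrK [`|M s w - N _ _|]distrC; lra.
have approx t : 0 <= t -> exists s : nat -> nat, forall k, t < qt (s k) < t + k.+1%:R^-1.
  move=> t0; have hk k : exists n, t < qt n < t + k.+1%:R^-1.
    by apply: qt_dense => //; rewrite ltrDl invr_gt0.
  by have [u hu] := choice hk; exists u.
have inv_lt e : 0 < e -> exists K, forall k, (K <= k)%N -> k.+1%:R^-1 < e.
  move=> e0; have [K] := ltr_add_invr e0; rewrite add0r => hK; exists K => k Kk.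
  by rewrite (le_lt_trans _ hK)// lef_pV2 ?posrE// ler_nat.
have adM : adapted F M.
  move=> t t0; apply: sub_measP; first exact: (filt_sa _ fF).
  move=> a; rewrite (rcF t t0) => s /= ts.
  have s0 : 0 <= s by exact/(le_trans t0)/ltW.
  have sFs := filt_sa _ fF _ s0.
  have [u hu] := approx t t0.
  have st0 : 0 < s - t by rewrite subr_gt0.
  have [K0 hK0] := inv_lt _ st0.
  have FBd : F s Bd by apply: (fF.2 0).
  (* A right limit exceeds [a] iff the values along [u] eventually exceed [a] by a fixed margin;
     starting at [K0] keeps all these times below [s]. *)
  rewrite (_ : mkset _ = [set w | (~ Bd w /\ exists m, True /\ exists K, (K0 <= K)%N /\
    forall k, (K <= k)%N -> a + m.+1%:R^-1 < N (qt (u k)) w) \/ (Bd w /\ a < 0)]).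
    apply: (sa_or sFs); last by apply: (sa_and sFs) => //; exact: (sa_const sFs).
    apply: (sa_and sFs); first exact: (sa_not sFs).
    apply: (sa_ex sFs) => m _; apply: (sa_ex sFs) => K K0K; apply: (sa_all sFs) => k Kk.
    have q0 := @qt_ge0 R (u k).
    apply: (fF.2 (qt (u k))) => //; last exact: (sub_meas_gt _ _ _ (adN _ q0)).
    have /andP[_ /ltW/le_trans->//] := hu k.
    by rewrite -lerBrDl ltW// hK0// (leq_trans K0K).
  apply/seteqP; split => w /=.
    have [gw|gw] := pselect (good w); last by rewrite Mbad//; right.
    move=> aM; left; split; first by move=> /(_ gw).
    have [m hm] := ltr_add_invr aM; exists m; split => //.
    have e0 : 0 < M t w - (a + m.+1%:R^-1) by rewrite subr_gt0.
    have [dl dl0 hdl] := Mgood t w gw t0 _ e0.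
    have [K1 hK1] := inv_lt _ dl0.
    exists (maxn K0 K1); split; first exact: leq_maxl.
    move=> k; rewrite geq_max => /andP[_ K1k].
    have /hdl : rwin t dl (u k).
      by have /andP[h1 h2] := hu k; rewrite /rwin h1 (lt_trans h2)// ltrD2l hK1.
    rewrite ltr_norml => /andP[+ _]; set c := m.+1%:R^-1; lra.
  move=> [[/contrapT gw [m [_ [K [K0K hK]]]]]|[gw a0]]; last by rewrite Mbad.
  have m0 : 0 < m.+1%:R^-1 :> R by rewrite invr_gt0.
  have [dl dl0 hdl] := Mgood t w gw t0 _ m0.
  have [K1 hK1] := inv_lt _ dl0.
  have /hdl : rwin t dl (u (maxn K K1)).
    have /andP[h1 h2] := hu (maxn K K1).
    by rewrite /rwin h1 (lt_trans h2)// ltrD2l hK1// leq_maxr.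
  have := hK (maxn K K1) (leq_maxl _ _); rewrite ltr_norml => h1 /andP[_ h2].
  move: h1 h2; set c := m.+1%:R^-1; lra.
exists M; split => //.
- move=> w; have [gw|gw] := pselect (good w); last first.
    split.
      move=> t t0 e e0; exists 1 => // s _ _.
      by rewrite /real_dist !Mbad// subrr normr0.
    move=> t t0; exists 0 => e e0; exists 1 => // s _ _ _.
    by rewrite /real_dist Mbad// subrr normr0.
  split.
    move=> t t0 e e0; have e20 : 0 < e / 2 by lra.
    have [dl dl0 hdl] := Mgood t w gw t0 _ e20; exists dl => // s ts sdl.
    rewrite /real_dist distrC; apply: (@le_lt_trans _ _ (e / 2)); last by lra.
    apply: Mclose => //; first exact: le_trans ts.
    exists (t + dl - s); first by lra.
    move=> n /andP[n1 n2]; apply: hdl; rewrite /rwin (le_lt_trans ts)//=; lra.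
  move=> t t0; have [l [_ hl]] := llim w t gw t0; exists l => e e0.
  have e20 : 0 < e / 2 by lra.
  have [dl dl0 hdl] := hl _ e20; exists dl => // s s0 ts st.
  rewrite /real_dist distrC; apply: (@le_lt_trans _ _ (e / 2)); last by lra.
  apply: Mclose => //; exists (t - s); first by lra.
  move=> n /andP[n1 n2]; apply: hdl; rewrite /lwin (lt_trans ts)//=; lra.
- move=> t B t0 FB.
  have [u hu] := approx t t0.
  have mB : measurable B by exact: (filt_meas _ fF _ _ t0).
  have mM : measurable_fun setT (M t).
    by apply: sub_meas_fun (adM _ t0) => A; exact: (filt_meas _ fF).
  have cvgM : \forall x \ae P, B x ->
      ((N (qt (u k)) x)%:E @[k --> \oo] --> (M t x)%:E).
    exists Bd; split => // x; apply: contra_notP => /contrapT gx _.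
    apply/fine_cvgP; split; first exact: nearW.
    apply/cvgrPdist_lt => e e0; have [dl dl0 hdl] := Mgood t x gx t0 _ e0.
    have [K hK] := inv_lt _ dl0; exists K => // k /= Kk.
    rewrite distrC; apply: hdl; have /andP[h1 h2] := hu k.
    by rewrite /rwin h1 (lt_trans h2)// ltrD2l hK.
  have mNk n : measurable_fun B (fun x => (N (qt (u n)) x)%:E).
    by apply/measurable_EFinP/measurable_funTS/mN; exact: qt_ge0.
  have mMB : measurable_fun B (fun x => (M t x)%:E).
    exact/measurable_EFinP/measurable_funTS.
  have ig : P.-integrable B (EFin \o cst (1 : R)).
    apply: measurable_bounded_integrable => //; last exact: bounded_cst.
    by rewrite (prE P P1)// ltry.
  have dom : \forall x \ae P, forall n, B x -> (`|(N (qt (u n)) x)%:E| <= 1)%E.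
    apply: aeW => x n _; have /andP[h1 h2] := N01 (qt (u n)) x (qt_ge0 _).
    by rewrite gee0_abs lee_fin.
  have [_ _ cvgI] := dominated_convergence mB mNk mMB cvgM ig dom.
  apply: (cvg_unique (@ereal_hausdorff R) cvgI).
  rewrite (_ : [sequence _]_n = cst (P (C `&` B))); first exact: cvg_cst.
  apply/funext => k /=; apply: intN; first exact: qt_ge0.
  by apply: (fF.2 t) => //; have /andP[/ltW] := hu k.
Qed.

End cadlag_martingale_existence.

(** * Martingales depending on a parameter *)

(** The right half of [cadlag] for real paths: an inequality valid at rational times just after [t]
    passes to [t] itself. *)
Definition rcont {R : realType} (g : R -> R) := forall t, 0 <= t -> forall e, 0 < e ->
  exists2 dl, 0 < dl & forall s, t <= s -> s < t + dl -> `|g t - g s| < e.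

Lemma rcont_cst {R : realType} (c : R) : rcont (fun=> c).
Proof. by move=> t t0 e e0; exists 1 => // s _ _; rewrite subrr normr0. Qed.

Lemma rcont_le {R : realType} (g h : R -> R) (t : R) : rcont g -> rcont h -> 0 <= t ->
  (exists2 dl, 0 < dl & forall n, t < qt n -> qt n < t + dl -> g (qt n) <= h (qt n)) ->
  g t <= h t.
Proof.
move=> rg rh t0 [dl dl0 hdl]; rewrite leNgt; apply/negP => hg.
have e0 : 0 < (g t - h t) / 2 by lra.
have [d1 d10 h1] := rg t t0 _ e0.
have [d2 d20 h2] := rh t t0 _ e0.
pose c := Num.min dl (Num.min d1 d2).
have c0 : t < t + c by rewrite ltrDl !lt_min dl0 d10 d20.
have [n /andP[n1 n2]] := qt_dense _ _ t0 c0.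
have [l1 l2 l3] : [/\ qt n < t + dl, qt n < t + d1 & qt n < t + d2].
  by split; apply: (lt_le_trans n2); rewrite lerD2l !ge_min lexx ?orbT.
have := hdl n n1 l1; have := h1 (qt n) (ltW n1) l2; have := h2 (qt n) (ltW n1) l3.
rewrite !ltr_norml => /andP[? ?] /andP[? ?] ?; lra.
Qed.

Lemma rcont_pos_part {R : realType} (g h : R -> R) : rcont g -> rcont h ->
  rcont (fun t => Num.max 0 (g t - h t)).
Proof.
move=> rg rh t t0 e e0; have e20 : 0 < e / 2 by lra.
have [d1 d10 h1] := rg t t0 _ e20.
have [d2 d20 h2] := rh t t0 _ e20.
exists (Num.min d1 d2); first by rewrite lt_min d10 d20.
move=> s ts sd.
have /(h1 s ts) : s < t + d1 by apply: (lt_le_trans sd); rewrite lerD2l ge_min lexx.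
have /(h2 s ts) : s < t + d2 by apply: (lt_le_trans sd); rewrite lerD2l ge_min lexx orbT.
rewrite !ltr_norml => /andP[a1 a2] /andP[b1 b2].
by rewrite /Num.max; case: ifPn => ?; case: ifPn => ?; apply/andP; split; lra.
Qed.

Lemma ae_all {d} {T : measurableType d} {R : realType} (P : {measure set T -> \bar R})
  (A : nat -> T -> Prop) : (forall n, \forall x \ae P, A n x) -> \forall x \ae P, forall n, A n x.
Proof.
move=> h; have := negligible_bigcup h; apply: negligibleS => x /= /existsNP[n hn].
by exists n.
Qed.

Lemma ae_null {d} {T : measurableType d} {R : realType} (P : {measure set T -> \bar R})
  (A : set T) : measurable A -> P A = 0%E -> \forall x \ae P, ~ A x.
Proof. by move=> mA PA; exists A; split => // x /= /contrapT. Qed.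

Section density_comparison.
Context {d} {T : measurableType d} {R : realType}.
Variable P : {measure set T -> \bar R}.
Hypothesis P1 : P setT = 1%E.
Local Notation pr := (pr P).

Lemma unit_integrable (f : T -> R) (B : set T) : measurable B ->
  measurable_fun setT f -> (forall x, 0 <= f x <= 1) -> P.-integrable B (EFin \o f).
Proof.
move=> mB mf f01; apply: measurable_bounded_integrable => //.
- by rewrite (prE P P1)// ltry.
- exact: measurable_funTS.
- exists 1; split => // c c1 x _ /=; have /andP[h1 h2] := f01 x.
  by rewrite ger0_norm// (le_trans h2)// ltW.
Qed.

(** Integrating the gap over [A] gives P(S and A) + c P(A) <= P(S' and A) <= P(S and A). *)
Lemma density_gap_null (f g : T -> R) (S S' A : set T) (c : R) :
  measurable S -> measurable S' -> measurable A ->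
  measurable_fun setT f -> measurable_fun setT g ->
  (forall x, 0 <= f x) -> 0 < c -> S' `<=` S ->
  (\int[P]_(x in A) (f x)%:E = P (S `&` A))%E ->
  (\int[P]_(x in A) (g x)%:E = P (S' `&` A))%E ->
  (forall x, A x -> f x + c <= g x) -> P A = 0%E.
Proof.
move=> mS mS' mA mf mg f0 c0 SS' If Ig hA.
have I : (\int[P]_(x in A) (f x)%:E + c%:E * P A <= \int[P]_(x in A) (g x)%:E)%E.
  have mfA : measurable_fun A (fun x => (f x)%:E) by exact/measurable_EFinP/measurable_funTS.
  rewrite -integral_cst// -ge0_integralD//; last 2 first.
  - by move=> x _; rewrite lee_fin.
  - by move=> x _; rewrite lee_fin ltW.
  apply: ge0_le_integral => //.
  - by move=> x _; rewrite lee_fin addr_ge0// ltW.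
  - exact: emeasurable_funD.
  - exact/measurable_EFinP/measurable_funTS.
have mSA : measurable (S `&` A) by exact: measurableI.
have mSA' : measurable (S' `&` A) by exact: measurableI.
move: I; rewrite If Ig !(prE P P1)// -EFinM -EFinD lee_fin => I.
have le2 : pr (S' `&` A) <= pr (S `&` A) by apply: (pr_le P P1) => //; exact: setSI.
have -> : pr A = 0 by have := pr_ge0 P A; nra.
by [].
Qed.

(** The order of [g] and [f] holds only almost everywhere; the positive part is nonnegative
    everywhere and has the same integrals as the difference. *)
Lemma density_diff (f g : T -> R) (S S' B : set T) :
  measurable S -> measurable S' -> measurable B ->
  measurable_fun setT f -> measurable_fun setT g ->
  (forall x, 0 <= f x <= 1) -> (forall x, 0 <= g x <= 1) -> S' `<=` S ->
  (\int[P]_(x in B) (f x)%:E = P (S `&` B))%E ->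
  (\int[P]_(x in B) (g x)%:E = P (S' `&` B))%E ->
  (\forall x \ae P, g x <= f x) ->
  (\int[P]_(x in B) (Num.max 0 (f x - g x))%:E = P ((S `\` S') `&` B))%E.
Proof.
move=> mS mS' mB mf mg f01 g01 SS' If Ig legf.
have mSB : measurable (S `&` B) by exact: measurableI.
have mSB' : measurable (S' `&` B) by exact: measurableI.
have mSD : measurable ((S `\` S') `&` B) by apply: measurableI => //; exact: measurableD.
have intf := unit_integrable f B mB mf f01.
have intg := unit_integrable g B mB mg g01.
transitivity (\int[P]_(x in B) ((f x)%:E - (g x)%:E))%E.
  apply: ae_eq_integral => //.
  - apply/measurable_EFinP/measurable_funTS; apply: measurable_maxr => //.
    exact: measurable_funB.
  - by apply: emeasurable_funB; exact/measurable_EFinP/measurable_funTS.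
  - by apply: filterS legf => x le_x _; rewrite max_r ?EFinB// subr_ge0.
rewrite integralB//= If Ig !(prE P P1)// -EFinB; congr (_%:E).
rewrite [pr (S `&` B)](pr_split P P1 S')//.
rewrite (_ : S' `&` (S `&` B) = S' `&` B); last by rewrite setIA (setIidl SS').
rewrite (_ : (S `&` B) `\` S' = (S `\` S') `&` B); last first.
  by apply/seteqP; split => x /=; tauto.
lra.
Qed.

(* Monotonicity in [n] holds only almost everywhere, hence dominated rather than
   monotone convergence. *)
Lemma density_sup (f : nat -> T -> R) (S : nat -> set T) (B : set T) :
  (forall n, measurable (S n)) -> measurable B ->
  (forall n, measurable_fun setT (f n)) ->
  (forall n x, 0 <= f n x <= 1) ->
  (forall n m, (n <= m)%N -> S n `<=` S m) ->
  (forall n, \int[P]_(x in B) (f n x)%:E = P (S n `&` B))%E ->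
  (\forall x \ae P, forall n m, (n <= m)%N -> f n x <= f m x) ->
  (\int[P]_(x in B) (sups (f ^~ x) 0)%:E = P (\bigcup_n S n `&` B))%E.
Proof.
move=> mS mB mf f01 ndS If ndf.
have ubf x : has_ubound (range (f ^~ x)).
  by exists 1 => _ [n _ <-]; case/andP: (f01 n x).
have msup : measurable_fun setT (fun x => sups (f ^~ x) 0).
  exact: measurable_fun_sups.
have fcvg : \forall x \ae P, B x -> (f n x)%:E @[n --> \oo] --> (sups (f ^~ x) 0)%:E.
  apply: filterS ndf => x ndx _; apply/fine_cvgP; split; first exact: nearW.
  have := @nondecreasing_cvgn R (f ^~ x) ndx (ubf x).
  rewrite (_ : sup _ = sups (f ^~ x) 0) //; rewrite /sups; congr (sup _).
  by apply/seteqP; split => y [n]; [move=> _ <-; exists n|move=> _ <-; exists n].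
have mfB n : measurable_fun B (fun x => (f n x)%:E).
  exact/measurable_EFinP/measurable_funTS.
have msB : measurable_fun B (fun x => (sups (f ^~ x) 0)%:E).
  exact/measurable_EFinP/measurable_funTS.
have ig : P.-integrable B (EFin \o cst (1 : R)).
  by apply: unit_integrable => // x; rewrite ler01 lexx.
have dom : \forall x \ae P, forall n, B x -> (`|(f n x)%:E| <= 1)%E.
  apply: aeW => x n _; have /andP[h1 h2] := f01 n x.
  by rewrite gee0_abs lee_fin.
have [_ _ cvgI] := dominated_convergence mB mfB msB fcvg ig dom.
apply: (cvg_unique (@ereal_hausdorff R) cvgI).
rewrite (_ : [sequence _]_n = P \o (fun n => S n `&` B)); last first.
  by apply/funext => n /=; exact: If.
rewrite setI_bigcupl; apply: nondecreasing_cvg_mu.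
- by move=> n; exact: measurableI.
- by apply: bigcupT_measurable => n; exact: measurableI.
- by move=> n m nm; apply/subsetPset; apply: setSI; exact: ndS.
Qed.

End density_comparison.

Section parametrized_martingales.
Context {R : realType} {d1 d2 : measure_display}
  {K : measurableType d1} {T : measurableType d2}.
Variables (la : probability K R) (Q : probability T R) (F : R -> set (set T)).
Hypothesis fF : is_filtration F.
Hypothesis rcF : filt_right_continuous F.
Hypothesis nullF : forall A B : set T, measurable B -> Q B = 0%E -> A `<=` B -> F 0 A.
Implicit Types (t s a b e dl l : R).

Local Notation PP := (la \x Q)%E.
Let OT := g_sigma_algebraType (@optional_sigma R d2 T F).

Let PP1 : PP setT = 1%E.
Proof. exact: probability_setT. Qed.

Local Notation pr := (pr PP).

Definition KF t : set (set (K * T)) :=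
  <<s [set S | exists A C, [/\ measurable A, F t C & S = A `*` C]] >>.

Lemma KF_filtration : is_filtration KF.
Proof.
split => [t t0|s t s0 st].
  split; first exact: g_sigma_sa.
  apply: g_sigma_ind; first exact: measurable_sa.
  move=> _ [A [C [mA FC ->]]]; apply: measurableX => //.
  exact: (filt_meas _ fF _ _ t0 FC).
apply: g_sigma_ind; first exact: g_sigma_sa.
move=> _ [A [C [mA FC ->]]]; apply: sub_sigma_algebra; exists A, C; split => //.
exact: (fF.2 s).
Qed.

Lemma KF_section t (B : set (K * T)) (k : K) : 0 <= t -> KF t B -> F t [set w | B (k, w)].
Proof.
move=> t0; move: B; have sF := filt_sa _ fF _ t0.
apply: (g_sigma_preimage (pair k)) => //.
move=> _ [A [C [mA FC ->]]] /=; apply: (sa_and sF) => //; exact: (sa_const sF).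
Qed.

Lemma optional_section t (O : set (R * T)) : 0 <= t -> optional_sigma F O ->
  F t [set w | O (t, w)].
Proof.
move=> t0; move: O; have sF := filt_sa _ fF _ t0.
apply: (g_sigma_preimage (pair t)) => //.
move=> _ [X [B [aX _ mB ->]]] /=; apply: (sa_and sF); first exact: (sa_const sF).
exact: aX.
Qed.

(** Joint measurability contains adaptedness: at a fixed time, optional sets have sections in [F t],
    so a jointly measurable set has a section in [KF t]. *)
Lemma prod_section t (S : set (K * OT)) : 0 <= t -> measurable S ->
  KF t [set x | S (x.1, (t, x.2))].
Proof.
move=> t0; rewrite measurable_prod_measurableType; move: S.
have sK : sigma_algebra setT (KF t) by exact: g_sigma_sa.
apply: (g_sigma_preimage (fun x : K * T => (x.1, (t, x.2) : OT))) => //.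
move=> _ [A mA [V mV <-]] /=; apply: sub_sigma_algebra.
exists A, [set w | V (t, w)]; split => //.
apply: optional_section => //.
by move: mV; rewrite /measurable /= sigma_algebra_id//; exact: g_sigma_sa.
Qed.

(** All generators of the optional sigma-algebra lie in nonnegative time, so points of negative time
    are not separated; hence a constant value there. *)
Lemma optional_measurable (X : R -> T -> R) : adapted F X ->
  (forall w, cadlag real_dist (X ^~ w)) ->
  measurable_fun setT (fun p : OT => if 0 <= p.1 then X p.1 p.2 else 0).
Proof.
move=> aX cX _ B mB; rewrite setTI; have sO := measurable_sa _ OT.
have G B' : measurable B' -> measurable ([set p | 0 <= p.1 /\ B' (X p.1 p.2)] : set OT).
  by move=> mB'; apply: sub_sigma_algebra; apply: sub_sigma_algebra; exists X, B'.
rewrite (_ : _ @^-1` B = [set p | (0 <= p.1 /\ B (X p.1 p.2)) \/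
    (~ (0 <= p.1 /\ setT (X p.1 p.2)) /\ B 0)]).
  apply: (sa_or sO); first exact: G.
  apply: (sa_and sO); last exact: (sa_const sO).
  by apply: (sa_not sO); apply: G; exact: measurableT.
apply/seteqP; split => -[t w] /=; have [t0|t0] := boolP (0 <= t).
- by left.
- by move=> B0; right; split => // -[].
- by move=> [[]//|[]]; case.
- by move=> [[]//|[]].
Qed.

(* [M] is a version of the martingale of conditional probabilities of [S] given
   [KF t] which is jointly optional, [k] being a parameter. *)
Definition cond_version (S : set (K * T)) (M : K -> R -> T -> R) :=
  [/\ measurable_fun setT (fun p : K * OT => M p.1 p.2.1 p.2.2),
      forall k t w, 0 <= M k t w <= 1,
      forall t B, 0 <= t -> KF t B ->
        (\int[PP]_(x in B) (M x.1 t x.2)%:E = PP (S `&` B))%E &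
      \forall x \ae PP, rcont (fun t => M x.1 t x.2)].

Lemma cond_version_sub_meas S M t : 0 <= t -> cond_version S M -> sub_meas (KF t) (fun x => M x.1 t x.2).
Proof.
move=> t0 [mM _ _ _] B mB.
have := mM measurableT B mB; rewrite setTI => /(prod_section _ _ t0).
by congr (KF _ _); apply/seteqP; split.
Qed.

Lemma cond_version_meas S M t : 0 <= t -> cond_version S M -> measurable_fun setT (fun x => M x.1 t x.2).
Proof.
move=> t0 gM; apply: sub_meas_fun (cond_version_sub_meas _ _ _ t0 gM) => B.
exact: (filt_meas _ KF_filtration).
Qed.

(** At each rational time a gap of at least [m.+1%:R^-1] in the wrong direction is null. Countably
    many such sets are discarded, and right-continuity extends the order to all times off a single
    null set. *)
Lemma cond_version_le S S' M M' : measurable S -> measurable S' -> cond_version S M -> cond_version S' M' -> S' `<=` S ->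
  \forall x \ae PP, forall t, 0 <= t -> M' x.1 t x.2 <= M x.1 t x.2.
Proof.
move=> mS mS' gM gM' SS'.
have H n m : \forall x \ae PP, ~ (m.+1%:R^-1 < M' x.1 (qt n) x.2 - M x.1 (qt n) x.2).
  set A := [set x : K * T | m.+1%:R^-1 < M' x.1 (qt n) x.2 - M x.1 (qt n) x.2].
  have q0 := @qt_ge0 R n.
  have KA : KF (qt n) A.
    have mD : measurable_fun setT (fun p : K * OT => M' p.1 p.2.1 p.2.2 - M p.1 p.2.1 p.2.2).
      by apply: measurable_funB; [case: gM'|case: gM].
    have := mD measurableT _ (measurable_itv `]m.+1%:R^-1, +oo[).
    rewrite setTI => /(prod_section _ _ q0); congr (KF _ _).
    by apply/seteqP; split => x; rewrite /= in_itv /= andbT.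
  have mA : measurable A by exact: (filt_meas _ KF_filtration _ _ q0).
  apply: ae_null => //.
  apply: (density_gap_null PP PP1 (fun x => M x.1 (qt n) x.2) (fun x => M' x.1 (qt n) x.2)
    S S' A m.+1%:R^-1) => //.
  - exact: (cond_version_meas S).
  - exact: (cond_version_meas S').
  - by move=> x; case: gM => _ /(_ x.1 (qt n) x.2)/andP[].
  - by case: gM => _ _ /(_ _ _ q0 KA).
  - by case: gM' => _ _ /(_ _ _ q0 KA).
  - by move=> x /ltW; rewrite lerBrDl.
have [_ _ _ rM] := gM; have [_ _ _ rM'] := gM'.
have HH := ae_all _ _ (fun n => ae_all _ _ (H n)).
apply: filterS3 HH rM rM' => x h rx rx' t t0.
apply: (rcont_le (fun t => M' x.1 t x.2) (fun t => M x.1 t x.2)) => //.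
exists 1 => // n _ _; rewrite -subr_le0 leNgt; apply/negP => /ltr_add_invr[m].
by rewrite add0r => /(h n m).
Qed.

Lemma cond_version_diff S S' M M' : measurable S -> measurable S' -> cond_version S M -> cond_version S' M' ->
  S' `<=` S -> cond_version (S `\` S') (fun k t w => Num.max 0 (M k t w - M' k t w)).
Proof.
move=> mS mS' gM gM' SS'; have leM := cond_version_le _ _ _ _ mS mS' gM gM' SS'.
have [mM M01 intM rM] := gM; have [mM' M01' intM' rM'] := gM'.
split.
- by apply: measurable_maxr => //; apply: measurable_funB.
- move=> k t w; have /andP[h1 h2] := M01 k t w; have /andP[h3 h4] := M01' k t w.
  by rewrite le_max lexx /= ge_max ler01 /=; lra.
- move=> t B t0 KB; have mB : measurable B by exact: (filt_meas _ KF_filtration _ _ t0).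
  apply: (density_diff PP PP1 (fun x => M x.1 t x.2) (fun x => M' x.1 t x.2)) => //.
  + exact: (cond_version_meas S).
  + exact: (cond_version_meas S').
  + exact: intM.
  + exact: intM'.
  + by apply: filterS leM => x; exact.
- apply: filterS2 rM rM' => x; exact: rcont_pos_part.
Qed.

End parametrized_martingales.

Section sups0.
Context {R : realType}.

Lemma sups0_ge (u : nat -> R) n : (forall n, u n <= 1) -> u n <= sups u 0.
Proof.
move=> u1; apply: ub_le_sup; last by exists n.
by exists 1 => _ [i _ <-].
Qed.

Lemma sups0_le (u : nat -> R) c : (forall n, u n <= c) -> sups u 0 <= c.
Proof. by move=> uc; apply: ge_sup; [exists (u 0%N); exists 0%N|move=> _ [i _ <-]]. Qed.

End sups0.

Lemma rcontD {R : realType} (g : R -> R) (c : R) : rcont g -> rcont (fun t => g t + c).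
Proof.
move=> rg t t0 e e0; have [dl dl0 h] := rg t t0 e e0; exists dl => // s ts sd.
by rewrite opprD addrACA subrr addr0; exact: h.
Qed.

Lemma rcont_uniform {R : realType} (g : R -> R) :
  (forall e : R, 0 < e -> exists2 h, rcont h & forall t, 0 <= t -> `|g t - h t| <= e) -> rcont g.
Proof.
move=> hg t t0 e e0; have e30 : 0 < e / 3 by lra.
have [h rh gh] := hg _ e30; have [dl dl0 hdl] := rh t t0 _ e30.
exists dl => // s ts sd; have s0 : 0 <= s by exact: le_trans ts.
have := hdl s ts sd; have := gh s s0; have := gh t t0.
rewrite !ler_norml !ltr_norml => /andP[? ?] /andP[? ?] /andP[? ?].
by apply/andP; split; lra.
Qed.

(** * Monotone class argument and recognition of stopping sets *)

Section stopping_sets.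
Context {R : realType} {d1 d2 : measure_display}
  {K : measurableType d1} {T : measurableType d2}.
Variables (la : probability K R) (Q : probability T R) (F : R -> set (set T)).
Hypothesis fF : is_filtration F.
Hypothesis rcF : filt_right_continuous F.
Hypothesis nullF : forall A B : set T, measurable B -> Q B = 0%E -> A `<=` B -> F 0 A.
Implicit Types (t s a b e dl l : R).

Local Notation PP := (la \x Q)%E.
Let OT := g_sigma_algebraType (@optional_sigma R d2 T F).

Let PP1 : PP setT = 1%E.
Proof. exact: probability_setT. Qed.

Local Notation pr := (pr PP).
Local Notation cond_version := (cond_version la Q F).
Local Notation KF := (@KF R d1 d2 K T F).

Let fKF : is_filtration KF.
Proof. exact: KF_filtration. Qed.

Section monotone_limit.
Variables (S : nat -> set (K * T)) (M : nat -> K -> R -> T -> R).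
Hypothesis mS : forall n, measurable (S n).
Hypothesis ndS : forall n m, (n <= m)%N -> S n `<=` S m.
Hypothesis gM : forall n, cond_version (S n) (M n).

Let Ms k t w := sups (fun n => M n k t w) 0.
Let U := \bigcup_n S n.

Let M01 n k t w : 0 <= M n k t w <= 1.
Proof. by case: (gM n) => _ + _ _; exact. Qed.

Let M1 n k t w : M n k t w <= 1.
Proof. by case/andP: (M01 n k t w). Qed.

Let leMs n k t w : M n k t w <= Ms k t w.
Proof. exact: (sups0_ge (fun n => M n k t w)). Qed.

Let Ms01 k t w : 0 <= Ms k t w <= 1.
Proof.
apply/andP; split; last exact: sups0_le.
by apply: le_trans (leMs 0%N k t w); case/andP: (M01 0%N k t w).
Qed.

Let mU : measurable U.
Proof. exact: bigcupT_measurable. Qed.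

Let mMs : measurable_fun setT (fun p : K * OT => Ms p.1 p.2.1 p.2.2).
Proof.
apply: (@measurable_fun_sups _ _ _ _ (fun n (p : K * OT) => M n p.1 p.2.1 p.2.2)).
  by move=> p _; exists 1 => _ [n _ <-]; exact: M1.
by move=> n; case: (gM n).
Qed.

Let intMs t B : 0 <= t -> KF t B ->
  (\int[PP]_(x in B) (Ms x.1 t x.2)%:E = PP (U `&` B))%E.
Proof.
move=> t0 KB; have mB : measurable B by exact: (filt_meas _ fKF _ _ t0).
apply: (density_sup PP PP1 (fun n x => M n x.1 t x.2)) => //.
- by move=> n; exact: (cond_version_meas la Q F fF (S n)).
- by move=> n; case: (gM n) => _ _ /(_ t B t0 KB).
- apply: (ae_all PP) => n; apply: (ae_all PP) => m.
  have [nm|nm] := leqP n m; last by apply: aeW.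
  have := cond_version_le la Q F fF _ _ _ _ (mS m) (mS n) (gM m) (gM n) (ndS _ _ nm).
  by apply: filterS => x /(_ t t0).
Qed.

Let sub_Ms t : 0 <= t -> sub_meas (KF t) (fun x => Ms x.1 t x.2).
Proof.
move=> t0 B mB; have := mMs measurableT B mB; rewrite setTI => /(prod_section F fF _ _ t0).
by congr (KF _ _); apply/seteqP; split.
Qed.

Let meas_Ms t : 0 <= t -> measurable_fun setT (fun x => Ms x.1 t x.2).
Proof.
by move=> t0; apply: sub_meas_fun (sub_Ms _ t0) => B; exact: (filt_meas _ fKF).
Qed.

Let A e n i := [set x : K * T | e < Ms x.1 (qt i) x.2 - M n x.1 (qt i) x.2].

Let KA e n i : KF (qt i) (A e n i).
Proof.
have mD : measurable_fun setT (fun p : K * OT => Ms p.1 p.2.1 p.2.2 - M n p.1 p.2.1 p.2.2).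
  by apply: measurable_funB => //; case: (gM n).
have := mD measurableT _ (measurable_itv `]e, +oo[).
rewrite setTI => /(prod_section F fF _ _ (qt_ge0 i)); congr (KF _ _).
by apply/seteqP; split => x; rewrite /= in_itv /= andbT.
Qed.

Let mA e n i : measurable (A e n i).
Proof. exact: (filt_meas _ fKF _ _ (qt_ge0 i)). Qed.

(** [Ms - M n] gives the conditional probabilities of the part of [U] outside [S n], so the maximal
    inequality bounds its supremum over rational times by the mass still missing. *)
Let sup_maximal e n : 0 < e -> e * pr (\bigcup_i A e n i) <= pr U - pr (S n).
Proof.
move=> e0; have mUS : measurable (U `\` S n) by exact: measurableD.
have SU : S n `<=` U by move=> x Sx; exists n.
have mAA : measurable (\bigcup_i A e n i) by exact: bigcupT_measurable.
have h : e * pr (\bigcup_i A e n i) <= pr ((U `\` S n) `&` \bigcup_i A e n i).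
  apply: (maximal_ge PP PP1 KF fKF) => // i B KB BA.
  have mB : measurable B by exact: (filt_meas _ fKF _ _ (qt_ge0 i)).
  apply: (int_bounded_ge PP PP1 _ _
    (fun x => Num.max 0 (Ms x.1 (qt i) x.2 - M n x.1 (qt i) x.2))) => //.
  - apply: measurable_maxr => //; apply: measurable_funB; first exact: (meas_Ms _ (qt_ge0 i)).
    exact: (cond_version_meas la Q F fF (S n) _ _ (qt_ge0 i)).
  - by move=> x; rewrite le_max lexx.
  - exact: ltW.
  - apply: (density_diff PP PP1 (fun x => Ms x.1 (qt i) x.2) (fun x => M n x.1 (qt i) x.2)) => //.
    + exact: (meas_Ms _ (qt_ge0 i)).
    + exact: (cond_version_meas la Q F fF (S n) _ _ (qt_ge0 i)).
    + by apply: intMs => //; exact: qt_ge0.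
    + by case: (gM n) => _ _ /(_ _ B (qt_ge0 i) KB).
    + by apply: aeW => x; exact: leMs.
  - by move=> x /BA /ltW h; rewrite le_max h orbT.
have h3 := pr_split PP PP1 _ _ (mS n) mU; rewrite (setIidl SU) in h3.
apply: (le_trans h); apply: (@le_trans _ _ (pr (U `\` S n))); last by rewrite h3 addrC addKr.
by apply: (pr_le PP PP1) => //; exact: measurableI.
Qed.

(** The missing mass tends to 0, so for almost every point and every [e] some right-continuous [M n]
    is within [e] of [Ms] at all times; a uniform limit of right-continuous paths is
    right-continuous. *)
Let rMs : \forall x \ae PP, rcont (fun t => Ms x.1 t x.2).
Proof.
have H j : \forall x \ae PP, ~ (\bigcap_n \bigcup_i A j.+1%:R^-1 n i) x.
  have e0 : 0 < j.+1%:R^-1 :> R by rewrite invr_gt0.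
  have mE : measurable (\bigcap_n \bigcup_i A j.+1%:R^-1 n i).
    by apply: bigcapT_measurable => n; exact: bigcupT_measurable.
  apply: ae_null => //; apply: (pr_eq0 PP PP1) => //; apply/eqP.
  rewrite eq_le pr_ge0 andbT -(pmulr_rle0 _ e0).
  have c1 : pr U - pr (S n) @[n --> \oo] --> pr U - pr U.
    by apply: cvgB; [exact: cvg_cst|exact: (pr_cvg PP PP1)].
  rewrite subrr in c1; apply: (ler_cvg_to _ c1); first exact: cvg_cst.
  apply: nearW => n; apply: le_trans (sup_maximal _ _ e0).
  rewrite ler_pM2l//; apply: (pr_le PP PP1) => //; first exact: bigcupT_measurable.
  by move=> x /(_ n I).
have rM := ae_all PP _ (fun n => let: And4 _ _ _ r := gM n in r).
apply: filterS2 (ae_all PP _ H) rM => x hx rx.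
apply: rcont_uniform => e e0; have [j] := ltr_add_invr e0; rewrite add0r => je.
have [n hn] : exists n, forall i, Ms x.1 (qt i) x.2 - M n x.1 (qt i) x.2 <= j.+1%:R^-1.
  apply: contrapT => h; apply: (hx j) => n _; apply: contrapT => h'; apply: h; exists n => i.
  by rewrite leNgt; apply/negP => h''; apply: h'; exists i.
exists (fun t => M n x.1 t x.2); first exact: rx.
move=> t t0; rewrite ger0_norm ?subr_ge0 ?leMs//.
(* Right-continuity of [Ms] is what is being proved, so the bound passes from rational to real times
   for each [M m] separately, before the supremum. *)
rewrite lerBlDl; apply: sups0_le => m.
apply: (rcont_le (fun t => M m x.1 t x.2) (fun t => M n x.1 t x.2 + e)) => //.
  exact: rcontD.
exists 1 => // i _ _; apply: (le_trans (leMs m _ _ _)).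
by have := hn i; move: je; set c := j.+1%:R^-1; lra.
Qed.

Lemma cond_version_sup : cond_version U Ms.
Proof. by split. Qed.

End monotone_limit.

(** The version is the indicator of [A] times the cadlag martingale of [C]. Tonelli integrates over
    [w] for fixed [k], where the section of [B] belongs to [F t]. *)
Lemma cond_version_rect (A : set K) (C : set T) : measurable A -> measurable C ->
  exists M, cond_version (A `*` C) M.
Proof.
move=> mA mC.
have [M [M01 aM cM intM]] := cadlag_martingale Q (probability_setT Q) F fF rcF nullF C mC.
pose M' t w := if 0 <= t then M t w else 0.
exists (fun k t w => \1_A k * M' t w); split.
- apply: measurable_funM.
    by apply: measurableT_comp => //; exact: measurable_indic.
  apply: (measurableT_comp (f := fun p : OT => M' p.1 p.2)) => //.
  exact: optional_measurable.
- move=> k t w; rewrite indicE /M'; have /andP[h1 h2] := M01 t w.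
  by case: (k \in A); case: ifP => _; rewrite ?mul1r ?mul0r ?lexx ?ler01 ?h1 ?h2.
- move=> t B t0 KB; have mB : measurable B by exact: (filt_meas _ fKF _ _ t0).
  have mMt : measurable_fun setT (M t).
    by apply: sub_meas_fun (aM _ t0) => V; exact: (filt_meas _ fF).
  rewrite integral_mkcond.
  set g := (X in (\int[_]_z X z)%E).
  have gE x : g x = (\1_A x.1 * M t x.2 * \1_B x)%:E.
    rewrite /g patchE /M' t0 [\1_B x]indicE; case: (x \in B); by rewrite ?mulr1 ?mulr0.
  have mg : measurable_fun setT g.
    rewrite (_ : g = EFin \o (fun x => \1_A x.1 * M t x.2 * \1_B x)); last exact/funext.
    apply/measurable_EFinP; apply: measurable_funM; last exact: measurable_indic.
    by apply: measurable_funM; apply: measurableT_comp => //; exact: measurable_indic.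
  have g0 x : (0 <= g x)%E.
    by rewrite gE lee_fin !mulr_ge0//; case/andP: (M01 t x.2).
  clearbody g; rewrite fubini_tonelli1// /product_measure1 /=; apply: eq_integral => k _.
  rewrite /fubini_F.
  have FB := KF_section F fF _ _ k t0 KB.
  have mBk : measurable [set w | B (k, w)] by exact: (filt_meas _ fF _ _ t0).
  have [kA|kA] := boolP (k \in A).
    rewrite (_ : xsection _ k = C `&` [set w | B (k, w)]); last first.
      apply/seteqP; split => w; rewrite /xsection /= !inE.
        by move=> [[]].
      by move=> [Cw Bw]; split => //; split => //; move: kA; rewrite inE.
    rewrite -(intM t _ t0 FB) [RHS]integral_mkcond; apply: eq_integral => w _.
    rewrite gE /= patchE !indicE kA mul1r /=.
    have -> : (w \in [set w | B (k, w)]) = ((k, w) \in B).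
      by apply/idP/idP; rewrite !inE.
    by case: ((k, w) \in B); rewrite ?mulr1 ?mulr0.
  rewrite (_ : xsection _ k = set0); last first.
    apply/seteqP; split => w //; rewrite /xsection /= !inE => -[[/= Ak]].
    by move: kA; rewrite notin_setE.
  rewrite measure0; apply: integral0_eq => w _.
  by rewrite gE indicE (negbTE kA) !mul0r.
- apply: aeW => x t t0 e e0.
  have [dl dl0 h] := (cM x.2).1 t t0 e e0; exists dl => // s ts sd.
  have s0 : 0 <= s by exact: le_trans ts.
  rewrite /M' t0 s0 indicE; case: (x.1 \in A); rewrite ?mul1r ?mul0r.
    exact: h.
  by rewrite subrr normr0.
Qed.

(** Rectangles form a pi-system; proper differences and increasing unions are the closure properties
    of a lambda-system. *)
Lemma cond_version_exists (S : set (K * T)) : measurable S -> exists M, cond_version S M.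
Proof.
rewrite measurable_prod_measurableType => mS.
pose H := [set S : set (K * T) | measurable S /\ exists M, cond_version S M].
suff : H S by case.
apply: (@lambda_system_subset _ [set A `*` B | A in measurable & B in measurable] _ setT) mS => //.
- move=> _ _ [A mA [B mB <-]] [A' mA' [B' mB' <-]].
  exists (A `&` A'); first exact: measurableI.
  by exists (B `&` B'); [exact: measurableI|rewrite setXI].
- split => //.
  + by split => //; rewrite -setXTT; exact: cond_version_rect.
  + move=> A B BA [mA [M gM]] [mB [M' gM']]; split; first exact: measurableD.
    by eexists; apply: (cond_version_diff la Q F fF) gM gM' BA.
  + move=> A ndA HA; have mA n : measurable (A n) by case: (HA n).
    split; first exact: bigcupT_measurable.
    have [M gM] := choice (fun n => (HA n).2).
    eexists; apply: (cond_version_sup A M) => // n m nm; exact/subsetPset/ndA.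
- move=> _ [A mA [B mB <-]]; split; [exact: measurableX|exact: cond_version_rect].
Qed.

Definition otime (p : OT) : R := if 0 <= p.1 then p.1 else 0.

Lemma otime_measurable : measurable_fun setT otime.
Proof.
apply: (optional_measurable F (fun t _ => t)).
- by move=> t t0 B mB; exact: (sa_const (filt_sa _ fF _ t0)).
- move=> w; split => [t t0 e e0|t t0].
    exists e => // s ts sd; rewrite /real_dist ltr_norml; lra.
  by exists t => e e0; exists e => // s s0 ts st; rewrite /real_dist ltr_norml; lra.
Qed.

(* With [M n] the martingale of [V n], the set [Z] is
   [forall n, t < qt n -> M n = 1]: on [V j] the martingale [M n] has value 1 from
   time [qt j] on, and off [V n] it almost surely never reaches 1 (maximal
   inequality for [1 - M n]). *)
Lemma stopping_split (V : nat -> set (K * T)) :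
  (forall n, KF (qt n) (V n)) ->
  (forall n m, qt n <= qt m :> R -> V n `<=` V m) ->
  exists2 Z : set (K * OT), measurable Z &
    \forall x \ae PP, forall t, 0 <= t ->
      Z (x.1, (t, x.2)) <-> (forall n, t < qt n -> V n x).
Proof.
move=> KV ndV.
have mV n : measurable (V n) by exact: (filt_meas _ fKF _ _ (qt_ge0 n)).
have [M gM] := choice (fun n => cond_version_exists (V n) (mV n)).
have mMn n i : measurable_fun setT (fun x => M n x.1 (qt i) x.2).
  exact: (cond_version_meas la Q F fF (V n) _ _ (qt_ge0 i)).
have M0 n k t w : 0 <= M n k t w by case: (gM n) => _ /(_ k t w)/andP[].
have M1 n k t w : M n k t w <= 1 by case: (gM n) => _ /(_ k t w)/andP[].
exists [set p : K * OT | forall n, True -> (qt n <= otime p.2 \/ 1 <= M n p.1 p.2.1 p.2.2)].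
  have sO := measurable_sa _ (K * OT)%type; apply: (sa_all sO) => n _; apply: (sa_or sO).
    have := measurableT_comp otime_measurable (@measurable_snd _ _ K OT).
    move=> /(_ measurableT _ (measurable_itv `[qt n, +oo[)); rewrite setTI; congr measurable.
    by apply/seteqP; split => p; rewrite /= in_itv /= andbT.
  have [mM _ _ _] := gM n.
  have := mM measurableT _ (measurable_itv `[(1 : R), +oo[); rewrite setTI; congr measurable.
  by apply/seteqP; split => p; rewrite /= in_itv /= andbT.
(* By monotonicity of [V] the event [A] lies in [V n], hence pr A = pr(V n and A) <= (1 - c) pr A
   with c = 1/(m+1), which forces pr A = 0. *)
have H1 n j m : \forall x \ae PP,
    ~ (qt j <= qt n :> R /\ (V j x /\ M n x.1 (qt j) x.2 < 1 - m.+1%:R^-1)).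
  have [jn|jn] := pselect (qt j <= qt n :> R); last by apply: aeW => x [].
  pose A := [set x | V j x /\ M n x.1 (qt j) x.2 < 1 - m.+1%:R^-1].
  have KA : KF (qt j) A.
    apply: (sa_and (filt_sa _ fKF _ (qt_ge0 j))); first exact: KV.
    exact: (sub_meas_lt _ _ _ (cond_version_sub_meas la Q F fF _ _ _ (qt_ge0 j) (gM n))).
  have mA : measurable A by exact: (filt_meas _ fKF _ _ (qt_ge0 j)).
  suff PA : PP A = 0%E by apply: filterS (ae_null PP A mA PA) => x hx [_]; exact: hx.
  have AV : V n `&` A = A.
    by apply/seteqP; split => x; [case|move=> Ax; split => //; apply: (ndV j n jn); case: Ax].
  have c0 : 0 < m.+1%:R^-1 :> R by rewrite invr_gt0.
  have c1 : m.+1%:R^-1 <= 1 :> R by rewrite invf_le1// ler1n.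
  have : pr (V n `&` A) <= (1 - m.+1%:R^-1) * pr A.
    apply: (int_bounded_le PP PP1 _ _ (fun x => M n x.1 (qt j) x.2)) => //.
    - by move: c1; set c := m.+1%:R^-1; lra.
    - by case: (gM n) => _ _ /(_ _ A (qt_ge0 j) KA).
    - by move=> x [_ /ltW].
  rewrite AV => hA; apply: (pr_eq0 PP PP1) => //; move: hA c0 (pr_ge0 PP A).
  by move: (pr A) => p; set c := m.+1%:R^-1; nra.
(* Off [V n] the rational values must stay below 1 by a margin, since only such a bound passes to
   real times. The maximal inequality at level 1 - c, c = 1/(m+1), leaves mass at most c outside
   [V n], for every [m]. *)
have H2 n : \forall x \ae PP,
    ~ (forall m, True -> (~ V n x /\ (\bigcup_i [set x | 1 - m.+1%:R^-1 < M n x.1 (qt i) x.2]) x)).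
  pose A m i := [set x : K * T | 1 - m.+1%:R^-1 < M n x.1 (qt i) x.2].
  have KA m i : KF (qt i) (A m i).
    exact: (sub_meas_gt _ _ _ (cond_version_sub_meas la Q F fF _ _ _ (qt_ge0 i) (gM n))).
  have mA m i : measurable (A m i) by exact: (filt_meas _ fKF _ _ (qt_ge0 i)).
  have mAA m : measurable (\bigcup_i A m i) by exact: bigcupT_measurable.
  have mE m : measurable [set x | ~ V n x /\ (\bigcup_i A m i) x].
    apply: (sa_and (measurable_sa _ (K * T)%type)); last exact: mAA.
    by apply: (sa_not (measurable_sa _ (K * T)%type)); exact: mV.
  pose E := [set x | forall m, True -> (~ V n x /\ (\bigcup_i A m i) x)].
  have mEE : measurable E.
    by apply: (sa_all (measurable_sa _ (K * T)%type)) => m _; exact: mE.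
  apply: (ae_null PP E) => //; apply: (pr_eq0 PP PP1) => //; apply/eqP.
  rewrite eq_le pr_ge0 andbT; apply/ler_addgt0Pl => e e0; rewrite addr0.
  have [m] := ltr_add_invr e0; rewrite add0r => me.
  apply: (@le_trans _ _ m.+1%:R^-1); last exact: ltW.
  have c0 : 0 < m.+1%:R^-1 :> R by rewrite invr_gt0.
  have c1 : m.+1%:R^-1 <= 1 :> R by rewrite invf_le1// ler1n.
  have h1 : (1 - m.+1%:R^-1) * pr (\bigcup_i A m i) <= pr (V n `&` \bigcup_i A m i).
    apply: (maximal_ge PP PP1 KF fKF) => // i B KB BA.
    have mB : measurable B by exact: (filt_meas _ fKF _ _ (qt_ge0 i)).
    apply: (int_bounded_ge PP PP1 _ _ (fun x => M n x.1 (qt i) x.2)) => //.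
    - by move: c1; set c := m.+1%:R^-1; lra.
    - by case: (gM n) => _ _ /(_ _ B (qt_ge0 i) KB).
    - by move=> x /BA /ltW.
  have h2 : pr E <= pr (\bigcup_i A m i `\` V n).
    apply: (pr_le PP PP1) => //; first exact: measurableD.
    by move=> x /(_ m I)[].
  have h3 := pr_split PP PP1 _ _ (mV n) (mAA m).
  have h4 : pr (\bigcup_i A m i) <= 1.
    by rewrite -(prT PP PP1); apply: (pr_le PP PP1).
  apply: (le_trans h2); move: h1 h3 h4 c0 c1.
  set c := m.+1%:R^-1; move: (pr (\bigcup_i A m i)) (pr (V n `&` \bigcup_i A m i))
    (pr (\bigcup_i A m i `\` V n)) => p q s; nra.
have rM := ae_all PP _ (fun n => let: And4 _ _ _ r := gM n in r).
have HH1 := ae_all PP _ (fun n => ae_all PP _ (fun j => ae_all PP _ (H1 n j))).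
apply: filterS3 HH1 (ae_all PP _ H2) rM => x h1 h2 rx t t0.
split => [Zx n tn|Vx n _]; rewrite /=.
  apply: contrapT => nV; apply: (h2 n) => m _; split => //.
  apply: contrapT => h.
  have : M n x.1 t x.2 <= 1 - m.+1%:R^-1.
    apply: (rcont_le (fun t => M n x.1 t x.2) (fun=> 1 - m.+1%:R^-1)) => //.
      exact: rcont_cst.
    exists 1 => // i _ _; rewrite leNgt; apply/negP => h'; apply: h; by exists i.
  have c0 : 0 < m.+1%:R^-1 :> R by rewrite invr_gt0.
  have [h'|h'] := Zx n I; first by move: h'; rewrite /otime /= t0 leNgt tn.
  by move=> Mle; move: c0 h' Mle => /=; set c := m.+1%:R^-1; lra.
have [nt|tn] := leP (qt n) t; first by left; rewrite /otime /= t0.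
right; apply: (rcont_le (fun=> 1) (fun t => M n x.1 t x.2)) => //.
  exact: rcont_cst.
exists (qt n - t); first by rewrite subr_gt0.
move=> j tj jn; have jn' : qt j <= qt n :> R by lra.
rewrite leNgt; apply/negP => Mlt.
have e0 : 0 < 1 - M n x.1 (qt j) x.2 by rewrite subr_gt0.
have [m] := ltr_add_invr e0; rewrite add0r => hm.
apply: (h1 n j m); split => //; split; first exact: Vx.
by move: hm; set c := m.+1%:R^-1; lra.
Qed.

End stopping_sets.

(** * Evaluation and decoding of Skorokhod paths *)

(** No measurability is assumed, because none is established for [sk_du] in [u]; the integral of a
    nonnegative function is a supremum over simple functions below it, hence monotone. *)
Lemma ge0_le_integral_fun d (T : measurableType d) (R : realType)
  (mu : {measure set T -> \bar R}) (D : set T) (f g : T -> \bar R) :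
  (forall x, D x -> (0 <= f x)%E) -> (forall x, D x -> (f x <= g x)%E) ->
  (\int[mu]_(x in D) f x <= \int[mu]_(x in D) g x)%E.
Proof.
move=> f0 fg; have g0 x : D x -> (0 <= g x)%E by move=> Dx; exact: le_trans (f0 _ Dx) (fg _ Dx).
rewrite !ge0_integralE//; apply: ereal_sup_le => _ [h hf <-].
exists h => // x; apply: (le_trans (hf x)); rewrite !patchE.
by case: ifPn => //; rewrite inE => /fg.
Qed.

Section skorokhod_evaluation.
Context {R : realType} {E : Type} (r : E -> E -> R).
Hypothesis mr : is_metric r.
Implicit Types (p q t s u e dl : R) (x y : R -> E) (l : R -> R).

Let r_ge0 a b : 0 <= r a b. Proof. by case: mr. Qed.
Let r_sym a b : r a b = r b a. Proof. by case: mr. Qed.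
Let r_tri a b c : r a c <= r a b + r b c. Proof. by case: mr. Qed.

Lemma sk_Lambda_0 l : sk_Lambda l -> l 0 = 0.
Proof.
move=> [inc pos surj _ _]; have [t t0 lt0] := surj 0 (lexx _).
have [tlt|tgt|teq] := ltgtP t 0; [by rewrite ltNge t0 in tlt| |by rewrite teq in lt0].
by have := inc 0 t (lexx _) tgt; rewrite lt0 ltNge pos.
Qed.

(** The chord of the time change from 0 to [s] has slope [l s / s], and [sk_gamma] bounds the
    modulus of its logarithm. *)
Lemma sk_Lambda_close l s e : sk_Lambda l -> 0 < s -> (sk_gamma l < e%:E)%E ->
  s * expR (- e) < l s < s * expR e.
Proof.
move=> hl s0 he; have l0 := sk_Lambda_0 l hl; have [inc _ _ _ _] := hl.
have ls0 : 0 < l s by rewrite -l0; exact: inc.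
have : `|ln (l s / s)| < e.
  rewrite -lte_fin; apply: le_lt_trans he; apply: ereal_sup_ubound.
  by exists s, 0; split => //; split => //; rewrite l0 !subr0.
rewrite ltr_norml => /andP[h1 h2].
have rs0 : 0 < l s / s by rewrite divr_gt0.
rewrite -(ltr_pdivlMl _ _ s0) -(ltr_pdivrMl _ _ s0) [s^-1 * _]mulrC.
by rewrite -[X in _ < X < _](lnK rs0) !ltr_expR h1 h2.
Qed.

(** Were [sk_du] at least [e] on all of [q + 1, q + 2], the integral would be at least
    [e * expR (- (q + 2))]: length 1 times the smallest weight there. The cut-off [u] lies beyond
    [q], so it leaves times before [q] untouched; [e <= 1] removes the truncation of distances at
    1. *)
Lemma sk_du_small x y l q e : 0 <= q -> 0 < e -> e <= 1 ->
  (\int[@lebesgue_measure R]_(u in [set u : R | (0 <= u)%R])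
     ((expR (- u))%:E * sk_du r x y l u) < (e * expR (- (q + 2)))%:E)%E ->
  exists2 u, q + 1 <= u & forall t, 0 <= t -> r (x (Num.min t u)) (y (Num.min (l t) u)) < e.
Proof.
move=> q0 e0 e1 hI.
have du0 u : (0 <= sk_du r x y l u)%E.
  apply: (@le_trans _ _ (Num.min (r (x (Num.min 0 u)) (y (Num.min (l 0) u))) 1)%:E).
    by rewrite lee_fin le_min r_ge0 ler01.
  by apply: ereal_sup_ubound; exists 0.
have [u [qu uq hu]] : exists u, [/\ q + 1 <= u, u <= q + 2 & (sk_du r x y l u < e%:E)%E].
  apply: contrapT => hn; move: hI; apply/negP; rewrite -leNgt.
  pose J := `[q + 1, q + 2]%classic : set R.
  have mJ : measurable J by exact: measurable_itv.
  apply: (@le_trans _ _ (\int[@lebesgue_measure R]_(u in [set u : R | (0 <= u)%R])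
      ((e * expR (- (q + 2))) * \1_J u)%:E)%E).
    have mD : measurable [set u : R | 0 <= u].
      rewrite (_ : mkset _ = `[0, +oo[%classic); first exact: measurable_itv.
      by apply/seteqP; split => u; rewrite /= in_itv /= andbT.
    under eq_integral do rewrite EFinM.
    rewrite ge0_integralZl//; last 2 first.
    - by apply/measurable_EFinP; exact: measurable_funTS.
    - by rewrite lee_fin mulr_ge0 ?expR_ge0 ?ltW.
    rewrite integral_indic// (_ : J `&` _ = J); last first.
      apply/seteqP; split => u; first by case.
      by rewrite /J /= in_itv /= => /andP[h1 h2]; split; [rewrite h1|lra].
    have hJ : lebesgue_measure (`[q + 1, q + 2]%classic : set R) = 1%:E.
      rewrite lebesgue_measure_itv /= lte_fin ltrD2l ltr1n -EFinB.
      by congr (_%:E); lra.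
    rewrite [X in (_ <= _ * X)%E](_ : _ = 1%:E); last exact: hJ.
    by rewrite -EFinM mulr1.
  apply: ge0_le_integral_fun => u /= u0.
    by rewrite lee_fin mulr_ge0// mulr_ge0 ?expR_ge0 ?ltW.
  rewrite indicE; have [|] := boolP (u \in J); last first.
    by rewrite mulr0 => _; rewrite mule_ge0// lee_fin expR_ge0.
  rewrite inE /J /= in_itv /= => /andP[h1 h2]; rewrite mulr1 mulrC EFinM.
  apply: lee_pmul => //.
  - by rewrite lee_fin ltW.
  - by rewrite lee_fin ler_expR lerN2.
  - by rewrite leNgt; apply/negP => hu; apply: hn; exists u.
exists u => // t t0; have : ((Num.min (r (x (Num.min t u)) (y (Num.min (l t) u))) 1)%:E < e%:E)%E.
  apply: le_lt_trans hu; by apply: ereal_sup_ubound; exists t.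
by rewrite lte_fin gt_min => /orP[//|]; rewrite ltNge e1.
Qed.

Lemma sk_hit_open p q (U : set E) : 0 <= p -> metric_open r U ->
  sk_open r [set x | exists s, p < s /\ (s < q /\ U (x s))].
Proof.
move=> p0 oU x [s [ps [sq Us]]] cx.
have s0 : 0 < s by exact: le_lt_trans ps.
have q0 : 0 <= q by exact/ltW/(lt_trans s0).
have [e0 e00 hU] := oU _ Us.
pose e := Num.min e0 1.
have egt0 : 0 < e by rewrite lt_min e00 ltr01.
have ele1 : e <= 1 by rewrite ge_min lexx orbT.
have c1 : 0 < e * expR (- (q + 2)) by rewrite mulr_gt0// expR_gt0.
have c2 : 0 < (s - p) / s by rewrite divr_gt0// subr_gt0.
have c3 : 0 < ln (q / s) by apply: ln_gt0; rewrite ltr_pdivlMr// mul1r.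
(* The first bound makes the values close; the second keeps [l s] above [p], since
   [expR (- eta) >= 1 - eta]; the third keeps [l s] below [q], since [s * expR (ln (q / s)) = q]. *)
exists (Num.min (e * expR (- (q + 2))) (Num.min ((s - p) / s) (ln (q / s)))).
  by rewrite !lt_min c1 c2 c3.
set eta := Num.min _ _ => y cy.
have [h1 h2 h3] : [/\ eta <= e * expR (- (q + 2)), eta <= (s - p) / s & eta <= ln (q / s)].
  by rewrite /eta; split; rewrite !ge_min lexx ?orbT.
move=> /ereal_inf_lt[_ [l [hl ->]]]; rewrite gt_max => /andP[hg hI].
have hI' := lt_le_trans hI (_ : (eta%:E <= (e * expR (- (q + 2)))%:E)%E).
have [u qu hu] := sk_du_small _ _ _ _ _ q0 egt0 ele1 (hI' h1).
have /andP[l1 l2] := sk_Lambda_close _ _ _ hl s0 hg.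
have lp : p < l s.
  apply: le_lt_trans l1; have := @expR_ge1Dx R (- eta) => h4.
  have : s * (1 - eta) <= s * expR (- eta) by rewrite ler_pM2l.
  have : eta * s <= s - p by rewrite -ler_pdivlMr.
  lra.
have lq : l s < q.
  apply: (lt_le_trans l2); rewrite -ler_pdivlMl// mulrC.
  have qs0 : 0 < q / s by rewrite divr_gt0// (lt_trans s0).
  by rewrite -[X in _ <= X](lnK qs0) ler_expR.
exists (l s); split => //; split => //; apply: hU.
have := hu s (ltW s0); rewrite !min_l; [|lra|lra].
by move=> h4; apply: (lt_le_trans h4); rewrite ge_min lexx.
Qed.

(** Openness is tested at cadlag paths only, so every set of other functions is measurable, which
    disposes of functions outside the Skorokhod space. *)
Lemma sk_noncadlag_open (U : set (R -> E)) : (forall x, U x -> ~ cadlag r x) -> sk_open r U.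
Proof. by move=> h x /h. Qed.

(** Evaluation at a fixed time is not continuous. But a cadlag path has [x q] in the open set [U]
    iff, for a short time after [q], it avoids some neighbourhood [W k] of the complement; hitting
    an open set during an open time interval is an open condition. *)
Lemma sk_eval q (B : set E) : 0 <= q -> borel_of r B ->
  skorokhod_borel r [set x | B (x q)].
Proof.
move=> q0; move: B; have sS : sigma_algebra setT (skorokhod_borel r) by exact: g_sigma_sa.
apply: (g_sigma_preimage (fun x => x q)) => //.
move=> U oU /=.
pose W (k : nat) := [set y | exists2 z, ~ U z & r y z < k.+1%:R^-1].
have oW k : metric_open r (W k).
  move=> y [z nUz yz]; exists (k.+1%:R^-1 - r y z); first by rewrite subr_gt0.
  move=> y' yy'; exists z => //; apply: (le_lt_trans (r_tri _ y _)).
  by rewrite r_sym; move: yy' yz; set c := k.+1%:R^-1; lra.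
pose hit k (n : nat) x := exists s, q < s /\ (s < q + n.+1%:R^-1 /\ W k (x s)).
rewrite (_ : mkset _ = [set x | (~ cadlag r x /\ U (x q)) \/
  (~ (~ cadlag r x) /\ exists k, True /\ exists n, True /\ ~ hit k n x)]).
  apply: (sa_or sS).
    by apply: sub_sigma_algebra; apply: sk_noncadlag_open => x [].
  apply: (sa_and sS).
    by apply: (sa_not sS); apply: sub_sigma_algebra; exact: sk_noncadlag_open.
  apply: (sa_ex sS) => k _; apply: (sa_ex sS) => n _; apply: (sa_not sS).
  by apply: sub_sigma_algebra; exact: sk_hit_open.
apply/seteqP; split => x /=; have [cx|cx] := pselect (cadlag r x).
- move=> Ux; right; split; first by apply.
  have [e e0 he] := oU _ Ux; have e20 : 0 < e / 2 by lra.
  have [k] := ltr_add_invr e20; rewrite add0r => hk; exists k; split => //.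
  have [dl dl0 hdl] := cx.1 q q0 _ e20.
  have [n] := ltr_add_invr dl0; rewrite add0r => hn; exists n; split => //.
  move=> [s [qs [sq [z nUz xz]]]]; apply: nUz; apply: he.
  apply: (le_lt_trans (r_tri _ (x s) _)).
  have : r (x q) (x s) < e / 2.
    by apply: hdl; [exact: ltW|apply: (lt_trans sq); rewrite ltrD2l].
  by move: xz hk; set c := k.+1%:R^-1; lra.
- by left.
- move=> [[]//|[_ [k [_ [n [_ nh]]]]]]; apply: contrapT => nU; apply: nh.
  have k0 : 0 < k.+1%:R^-1 :> R by rewrite invr_gt0.
  have n0 : 0 < n.+1%:R^-1 :> R by rewrite invr_gt0.
  have [dl dl0 hdl] := cx.1 q q0 _ k0.
  have m0 : 0 < Num.min dl n.+1%:R^-1 by rewrite lt_min dl0 n0.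
  have ml : Num.min dl n.+1%:R^-1 <= dl by rewrite ge_min lexx.
  have mn : Num.min dl n.+1%:R^-1 <= n.+1%:R^-1 by rewrite ge_min lexx orbT.
  move: m0 ml mn; set c := Num.min _ _ => m0 ml mn.
  exists (q + c / 2); split; first by lra.
  split; first by move: mn; set b := n.+1%:R^-1; lra.
  by exists (x q) => //; rewrite r_sym; apply: hdl; lra.
- by move=> [[]//|[]].
Qed.

End skorokhod_evaluation.

Lemma sub_emeasP {T : Type} {R : realType} (S : set (set T)) (f : T -> \bar R) :
  sigma_algebra setT S -> (forall a : R, S [set x | (f x < a%:E)%E]) ->
  forall C : set (\bar R), measurable C -> S [set x | C (f x)].
Proof.
move=> sS h C mC.
have := mC : emeasurable (@ocitv R) C; rewrite ErealGenInftyO.measurableE.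
apply: (g_sigma_preimage f) => //.
move=> _ [x ->]; rewrite /= (_ : mkset _ = [set y | (f y < x%:E)%E]); first exact: h.
by apply/seteqP; split => y; rewrite /= in_itv.
Qed.

(** * Reading a marked time off a stopped path *)

Section decoding.
Context {R : realType} {E : pointedType} (r : E -> E -> R) (Delta : E).
Hypothesis mr : is_metric r.
Implicit Types (x : R -> E).

(* A path that jumps at most once, away from [Delta], is recovered from its jump
   time and its value at the first integer time after the jump. *)
Definition jump_time x : \bar R :=
  ereal_inf [set z | exists n, x (qt n) <> Delta /\ z = (qt n)%:E].

Definition jump_index x (n : nat) :=
  (jump_time x <= n%:R%:E)%E /\ forall k, (k < n)%N -> ~ (jump_time x <= k%:R%:E)%E.

Definition jump_mark x : E := xget Delta [set z | exists n, jump_index x n /\ z = x n%:R].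

Definition decode x : E * \bar R := (jump_mark x, jump_time x).

Lemma jump_index_uniq x n n' : jump_index x n -> jump_index x n' -> n = n'.
Proof.
move=> [h1 h2] [h1' h2']; apply/eqP; rewrite eqn_leq.
by apply/andP; split; rewrite leqNgt; apply/negP => /[dup] lt; [move/h2|move/h2'].
Qed.

Lemma jump_time_lt x (a : R) :
  (jump_time x < a%:E)%E <-> exists n, qt n < a /\ x (qt n) <> Delta.
Proof.
split; first by move=> /ereal_inf_lt[_ [n [xn ->]]]; rewrite lte_fin => na; exists n.
move=> [n [na xn]]; apply: (@le_lt_trans _ _ (qt n)%:E); last by rewrite lte_fin.
by apply: ereal_inf_lbound; exists n.
Qed.

Lemma open_neq (c : E) : metric_open r [set z | z <> c].
Proof.
have [r0 rE rS rT] := mr; move=> z zc; exists (r z c).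
  by rewrite lt_neqAle r0 andbT eq_sym; apply/eqP => /rE.
by move=> y zy yc; move: zy; rewrite yc ltxx.
Qed.

Let sS : sigma_algebra setT (skorokhod_borel r).
Proof. exact: g_sigma_sa. Qed.

Lemma jump_time_meas (C : set (\bar R)) : measurable C ->
  skorokhod_borel r [set x | C (jump_time x)].
Proof.
move: C; apply: sub_emeasP => // a.
rewrite (_ : mkset _ = [set x | exists n, qt n < a /\ x (qt n) <> Delta]).
  apply: (sa_ex sS) => n _; apply: (sk_eval r mr (qt n) [set z | z <> Delta]).
    exact: qt_ge0.
  by apply: sub_sigma_algebra; exact: open_neq.
by apply/seteqP; split => x /jump_time_lt.
Qed.

Lemma jump_mark_meas (B : set E) : borel_of r B -> skorokhod_borel r [set x | B (jump_mark x)].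
Proof.
move=> bB.
have mle n : skorokhod_borel r [set x | (jump_time x <= n%:R%:E)%E].
  apply: (jump_time_meas [set z | (z <= n%:R%:E)%E]).
  rewrite (_ : mkset _ = `]-oo, n%:R%:E]%classic); first exact: emeasurable_itv.
  by apply/seteqP; split => z; rewrite /= in_itv.
have mji n : skorokhod_borel r [set x | jump_index x n].
  apply: (sa_and sS) => //; apply: (sa_all sS) => k _; exact: (sa_not sS).
rewrite (_ : mkset _ = [set x | (exists n, True /\ (jump_index x n /\ B (x n%:R))) \/
  ((~ exists n, True /\ jump_index x n) /\ B Delta)]).
  apply: (sa_or sS).
    apply: (sa_ex sS) => n _; apply: (sa_and sS) => //.
    by apply: (sk_eval r mr).
  apply: (sa_and sS); last exact: (sa_const sS).
  by apply: (sa_not sS); apply: (sa_ex sS) => n _; exact: mji.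
apply/seteqP; split => x; rewrite /= /jump_mark; case: xgetP => [z -> [n [jn ->]]|h].
- by move=> Bx; left; exists n.
- move=> BD; right; split => // -[n [_ jn]].
  by apply: (h (x n%:R)); exists n.
- move=> [[n' [_ [jn' Bx]]]|[]]; first by rewrite (jump_index_uniq _ _ _ jn jn').
  by case; exists n.
- move=> [[n [_ [jn Bx]]]|[]//].
  by case: (h (x n%:R)); exists n.
Qed.

Lemma decode_meas (A : set (Ztype r)) : measurable A -> skorokhod_borel r [set x | A (decode x)].
Proof.
move: A; apply: (g_sigma_preimage decode) => //.
move=> _ [B [C [bB mC ->]]] /=; apply: (sa_and sS); first exact: jump_mark_meas.
exact: jump_time_meas.
Qed.

Lemma decode_prod_meas (m : nat) (A : set (Ytype m r)) : measurable A ->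
  skorokhod_prod m r [set w | A (fun j => decode (w j))].
Proof.
have sP : sigma_algebra setT (skorokhod_prod m r) by exact: g_sigma_sa.
move: A; apply: (g_sigma_preimage (fun w j => decode (w j))) => //.
move=> _ [i [A [mA ->]]] /=; apply: sub_sigma_algebra.
by exists i, [set x | A (decode x)]; split => //; exact: decode_meas.
Qed.

(** The path is one of the stopped processes of the splitting formula: it jumps at a finite
    [tau <= S] and otherwise never leaves [Delta]. The two outcomes are those of [trunc_marks]. *)
Lemma decode_step (xi : E) (tau S : \bar R) : xi <> Delta -> (0 <= tau)%E ->
  decode (fun t => if (Order.min t%:E S < tau)%E then Delta else xi) =
  if ((tau <= S) && (tau < +oo))%E then (xi, tau) else (Delta, +oo%E).
Proof.
move=> xiD tau0; set x := fun t => _.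
case: ifPn => [/andP[tS tfin]|h].
  have [c c0 tc] : exists2 c, 0 <= c & tau = c%:E.
    by case: tau tau0 tfin {tS x} => [c c0 _|//|//]; exists c.
  have xE t : x t = if t < c then Delta else xi.
    by rewrite /x tc gt_min lte_fin; rewrite tc in tS; rewrite orbC ltNge tS.
  have jt : jump_time x = c%:E.
    apply/eqP; rewrite eq_le; apply/andP; split.
      apply/lee_addgt0Pr => e e0; apply: ltW; apply/jump_time_lt.
      have ce : c < c + e by rewrite ltrDl.
      have [n /andP[n1 n2]] := qt_dense _ _ c0 ce; exists n; split => //.
      by rewrite xE ltNge (ltW n1).
    rewrite leNgt; apply/negP => /jump_time_lt[n [nc xn]].
    by apply: xn; rewrite xE nc.
  rewrite /decode jt tc; congr pair; rewrite /jump_mark.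
  case: xgetP => [z -> [n [[jn _] ->]]|h].
    by rewrite xE; move: jn; rewrite jt lee_fin => jn; rewrite ltNge jn.
  (* A first integer not before the jump exists, so the default of [xget] cannot occur. *)
  exfalso; have exn : exists n, c <= n%:R.
    by exists (Num.bound c); apply: ltW; exact: archi_boundP.
  pose n := ex_minn exn.
  apply: (h (x n%:R)); exists n; split => //.
  rewrite /jump_index jt /n; case: ex_minnP => k ck hk; split; first by rewrite lee_fin.
  by move=> j jk; rewrite lee_fin => /hk; rewrite leqNgt jk.
have xE t : x t = Delta.
  rewrite /x; case: ifPn => //; rewrite gt_min negb_or -!leNgt => /andP[h1 h2].
  by move: h; rewrite h2 (le_lt_trans h1 (ltry _)).
have jt : jump_time x = +oo%E.
  rewrite /jump_time (_ : mkset _ = set0) ?ereal_inf0//.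
  by apply/seteqP; split => z // [n []].
rewrite /decode jt; congr pair; rewrite /jump_mark xgetPN// => z [n [[]]].
by rewrite jt leye_eq.
Qed.

End decoding.

(** * Order statistics and truncated marks *)

Section order_statistics.
Context {R : realType} {m : nat}.
Implicit Types (t : 'I_m -> \bar R) (k : nat) (c : R).
Local Open Scope ereal_scope.

(** [sigma_ord] as a function of a tuple of times, so that it can also be evaluated on points of
    [K]. *)
Definition ostat t k : \bar R :=
  if k == 0%N then 0
  else nth +oo (sort (fun a b : \bar R => a <= b) [seq t i | i <- enum 'I_m]) k.-1.

Definition nle t c : nat := #|[set l | (t l <= c%:E)%E]%SET|.

Lemma sorted_nth_le (s : seq (\bar R)) k c : sorted <=%O s ->
  (nth +oo s k <= c%:E) = (k < count [pred z : \bar R | (z <= c%:E)%E] s)%N.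
Proof.
elim: s k => [|x s IH] k; first by rewrite nth_nil leye_eq.
move=> /= ps; have srt := path_sorted ps.
have [xc|xc] := leP x c%:E.
  by case: k => [|k] /=; rewrite ?xc// IH.
have h0 : count [pred z : \bar R | (z <= c%:E)%E] s = 0%N.
  apply/eqP; rewrite -leqn0 leqNgt -has_count; apply/negP => /hasP[z zs zc].
  have /allP/(_ _ zs) xz := order_path_min le_trans ps.
  by move: xc; rewrite ltNge (le_trans xz zc).
rewrite h0 addn0 /=; case: k => [|k] /=; first by rewrite leNgt xc.
by rewrite IH// h0.
Qed.

(** Further facts on order statistics use the sort only through this count, so ties need no separate
    treatment. *)
Lemma ostat_le t k c : (0 < k)%N -> (ostat t k <= c%:E) = (k <= nle t c)%N.
Proof.
case: k => // k _; rewrite /ostat /= sorted_nth_le; last first.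
  by apply: sort_sorted => a b; exact: le_total.
congr (_ < _)%N; rewrite count_sort count_map /nle cardsE cardE -size_filter.
by rewrite enumT /enum_mem; congr (size _); apply: eq_filter => l.
Qed.

(** Otherwise some level [c'] between the k-th order statistic and [t j] counts at least [k] times
    and the level [t j] at least one more, so the next order statistic is at most [t j]. *)
Lemma ostat_gap t k (j : 'I_m) : (forall l, 0 <= t l) ->
  t j < ostat t k.+1 -> t j <= ostat t k.
Proof.
move=> t0 tj; have [c tc] : exists c, t j = c%:E.
  case: (t j) (t0 j) tj => [c _ _|_|//]; first by exists c.
  by rewrite ltNge leey.
case: k tj => [|k] tj.
  move: tj; rewrite ltNge tc ostat_le// => /negP[].
  by rewrite card_gt0; apply/set0Pn; exists j; rewrite inE tc.
rewrite leNgt; apply/negP => ltj.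
have [c' cc' oc'] : exists2 c', (c' < c)%R & ostat t k.+1 <= c'%:E.
  move: ltj; rewrite tc; case: (ostat t k.+1) => [c'|//|_].
    by rewrite lte_fin => ?; exists c'.
  by exists (c - 1)%R; [rewrite ltrBlDr ltrDl|rewrite leNye].
move: oc'; rewrite ostat_le// => h1.
move: tj; rewrite ltNge tc ostat_le// -ltnNge => h2.
have : (nle t c' < nle t c)%N.
  apply: proper_card; apply/properP; split.
    by apply/fintype.subsetP => l; rewrite !inE => /le_trans; apply; rewrite lee_fin ltW.
  by exists j; rewrite !inE tc ?lexx// lee_fin -ltNge.
by move=> /(leq_ltn_trans h1); rewrite ltnNge => /negP; apply.
Qed.

(** With ties some intervals are empty, but each time lies in exactly one, numbered by how many of
    the times have occurred. *)
Lemma ostat_itv t k c : (0 <= c)%R -> (k <= m)%N ->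
  ((ostat t k <= c%:E) && (c%:E < ostat t k.+1)) = (k == nle t c).
Proof.
move=> c0 km; rewrite ltNge (ostat_le _ k.+1)// -ltnNge ltnS eqn_leq.
by case: k km => [|k] km; [rewrite /ostat /= lee_fin c0|rewrite ostat_le].
Qed.

Lemma nle_le t c : (nle t c <= m)%N.
Proof. by rewrite -[X in (_ <= X)%N](card_ord m) max_card. Qed.

End order_statistics.

Section truncated_marks.
Context {R : realType} {E : pointedType} (r : E -> E -> R) (Delta : E) (m : nat).

(** Infinite times are erased even when the k-th order statistic is infinite, since a path never
    shows the mark of an infinite time. *)
Definition trunc_marks (k : nat) (y : Ytype m r) : Ytype m r := fun j =>
  if ((y j).2 <= ostat (fun l => (y l).2) k)%E && ((y j).2 < +oo)%E then y j
  else (Delta, +oo%E).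

Lemma borel_sa : sigma_algebra setT (borel_of r).
Proof. exact: g_sigma_sa. Qed.

Let sY := measurable_sa _ (Ytype m r).

Lemma Ytype_coord (j : 'I_m) (A : set (Ztype r)) : measurable A ->
  measurable ([set y | A (y j)] : set (Ytype m r)).
Proof. by move=> mA; apply: sub_sigma_algebra; exists j, A. Qed.

Lemma Ytype_time (j : 'I_m) : measurable_fun setT (fun y : Ytype m r => (y j).2).
Proof.
move=> _ C mC; rewrite setTI; apply: (Ytype_coord j [set z | C z.2]).
apply: sub_sigma_algebra; exists setT, C; split => //.
  by have := sa_const borel_sa True; congr borel_of; apply/seteqP; split.
by apply/seteqP; split => z //= [].
Qed.

(** The sort is replaced by finite unions over index sets [A]: all times with index in [A] are at
    most [a - n.+1%:R^-1]. *)
Lemma ostat_meas k : measurable_fun setT (fun y : Ytype m r => ostat (fun l => (y l).2) k).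
Proof.
move=> _ C mC; rewrite setTI; apply: (sub_emeasP _ _ sY) mC => a.
case: k => [|k]; first by rewrite /ostat /=; exact: (sa_const sY).
rewrite (_ : mkset _ = [set y : Ytype m r | exists n, True /\
    exists A : {set 'I_m}, (k.+1 <= #|A|)%N /\
      ~ exists l, ~ (l \in A -> ((y l).2 <= (a - n.+1%:R^-1)%:E)%E)]).
  apply: (sa_ex sY) => n _; apply: (sa_ex_fin sY) => A.
  apply: (sa_and sY); first exact: (sa_const sY).
  apply: (sa_not sY); apply: (sa_ex_fin sY) => l; apply: (sa_not sY).
  have [lA|lA] := boolP (l \in A); last first.
    have := sa_const sY True; congr measurable.
    by apply/seteqP; split => y.
  have := Ytype_time l measurableT _ (emeasurable_itv `]-oo, (a - n.+1%:R^-1)%:E]).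
  rewrite setTI; congr measurable.
  by apply/seteqP; split => y; rewrite /= in_itv /=; [move=> + _|apply].
have key y n : (ostat (fun l => (y l : Ztype r).2) k.+1 <= (a - n.+1%:R^-1)%:E)%E <->
    exists A : {set 'I_m}, (k.+1 <= #|A|)%N /\
      ~ exists l, ~ (l \in A -> ((y l).2 <= (a - n.+1%:R^-1)%:E)%E).
  rewrite ostat_le//; split => [h|[A [kA hA]]].
    exists [set l | ((y l).2 <= (a - n.+1%:R^-1)%:E)%E]%SET; split => // -[l]; apply.
    by rewrite inE.
  apply: (leq_trans kA); apply: subset_leq_card; apply/fintype.subsetP => l lA; rewrite inE.
  by apply: contrapT => h; apply: hA; exists l => /(_ lA).
apply/seteqP; split => y /=; last first.
  move=> [n [_ /key]] h; apply: (le_lt_trans h).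
  by rewrite lte_fin ltrBlDr ltrDl invr_gt0.
case hE : (ostat _ k.+1) => [c||] //=.
  rewrite lte_fin -subr_gt0 => h; have [n] := ltr_add_invr h; rewrite add0r => hn.
  exists n; split => //; apply/key; rewrite hE lee_fin.
  by move: hn; set b := n.+1%:R^-1; lra.
by move=> _; exists 0%N; split => //; apply/key; rewrite hE leNye.
Qed.

Lemma trunc_marks_meas k : measurable_fun setT (trunc_marks k).
Proof.
move=> _ B mB; rewrite setTI; apply: (g_sigma_preimage _ _ _ sY) mB => _ [j [A [mA ->]]].
rewrite /trunc_marks.
have mc : measurable [set y : Ytype m r | ((y j).2 <= ostat (fun l => (y l).2) k)%E /\ ((y j).2 < +oo)%E].
  apply: (sa_and sY).
    rewrite -[X in measurable X]setTI.
    by apply: emeasurable_fun_le => //; [exact: Ytype_time|exact: ostat_meas].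
  have := Ytype_time j measurableT _ (emeasurable_itv `]-oo, +oo%E[).
  rewrite setTI; congr measurable; by apply/seteqP; split => y; rewrite /= in_itv.
rewrite (_ : mkset _ = [set y : Ytype m r |
  ((((y j).2 <= ostat (fun l => (y l).2) k)%E /\ ((y j).2 < +oo)%E) /\ A (y j)) \/
  (~ (((y j).2 <= ostat (fun l => (y l).2) k)%E /\ ((y j).2 < +oo)%E) /\ A (Delta, +oo%E))]).
  apply: (sa_or sY); apply: (sa_and sY) => //.
  - exact: Ytype_coord.
  - exact: (sa_not sY).
  - exact: (sa_const sY).
apply/seteqP; split => y /=; case: ifPn => [/andP h|/andP h]; tauto.
Qed.

End truncated_marks.

(** * Absolute continuity from the density hypothesis *)

Section image_probability.
Context {d1 d2 : measure_display} {T1 : measurableType d1} {T2 : measurableType d2}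
  {R : realType}.
Variables (P : {measure set T1 -> \bar R}) (P1 : P setT = 1%E)
  (f : T1 -> T2) (mf : measurable_fun setT f).

Definition image_prob (_ : P setT = 1%E) (_ : measurable_fun setT f) (A : set T2) :=
  P (f @^-1` A).

Let image_prob0 : image_prob P1 mf set0 = 0%E.
Proof. by rewrite /image_prob preimage_set0 measure0. Qed.

Let image_prob_ge0 A : (0 <= image_prob P1 mf A)%E.
Proof. exact: measure_ge0. Qed.

Let image_prob_sigma_additive : semi_sigma_additive (image_prob P1 mf).
Proof.
move=> F mF tF mUF; rewrite /image_prob preimage_bigcup.
apply: measure_semi_sigma_additive.
- by move=> n; rewrite -[X in measurable X]setTI; exact: mf.
- apply/trivIsetP => /= i j _ _ ij; rewrite -preimage_setI.
  by move/trivIsetP : tF => /(_ _ _ I I ij) ->; rewrite preimage_set0.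
- by rewrite -preimage_bigcup -[X in measurable X]setTI; exact: mf.
Qed.

HB.instance Definition _ := isMeasure.Build _ _ _ (image_prob P1 mf)
  image_prob0 image_prob_ge0 image_prob_sigma_additive.

Let image_probT : image_prob P1 mf setT = 1%E.
Proof. by rewrite /image_prob preimage_setT. Qed.

HB.instance Definition _ := Measure_isProbability.Build _ _ _ (image_prob P1 mf) image_probT.

Lemma integral_image_prob (D : set T2) (g : T2 -> \bar R) : measurable D ->
  measurable_fun setT g -> (forall y, (0 <= g y)%E) ->
  (\int[image_prob P1 mf]_(y in D) g y = \int[P]_(x in f @^-1` D) g (f x))%E.
Proof.
move=> mD mg g0.
by rewrite -(ge0_integral_pushforward mf P mD) //; exact: measurable_funTS.
Qed.

End image_probability.

Section density_measure.
Context {d : measure_display} {T : measurableType d} {R : realType}.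
Variables (P : {measure set T -> \bar R}) (g : T -> \bar R)
  (mg : measurable_fun setT g) (g0 : forall x, (0 <= g x)%E).

Definition dens_meas (_ : measurable_fun setT g) (_ : forall x, (0 <= g x)%E) (A : set T) :=
  (\int[P]_(x in A) g x)%E.

Let dens_meas0 : dens_meas mg g0 set0 = 0%E.
Proof. exact: integral_set0. Qed.

Let dens_meas_ge0 A : (0 <= dens_meas mg g0 A)%E.
Proof. by apply: integral_ge0 => x _; exact: g0. Qed.

Let dens_meas_sigma_additive : semi_sigma_additive (dens_meas mg g0).
Proof. exact: semi_sigma_additive_nng_induced. Qed.

HB.instance Definition _ := isMeasure.Build _ _ _ (dens_meas mg g0)
  dens_meas0 dens_meas_ge0 dens_meas_sigma_additive.

End density_measure.

Section density_absolute_continuity.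
Context {R : realType} {d1 d2 d3 : measure_display} {Y : measurableType d1}
  {W : measurableType d2} {U : measurableType d3}.
Variables (Q : probability W R) (mu : probability Y R).
Variables (j : W -> U) (mj : measurable_fun setT j).

Definition Qimg : probability U R := image_prob Q j (probability_setT Q) mj.

(** The joint law of [v] and [j] and the measure with density [gam] are finite and agree on
    rectangles, hence coincide. [U] stands for [Omega] with the smaller sigma-algebra [Finf F], [j]
    being the identity. *)
Lemma law_absolutely_continuous (v : W -> Y) (gam : Y -> U -> R) :
  measurable_fun setT v ->
  measurable_fun setT (fun p : Y * U => gam p.1 p.2) ->
  (forall y u, 0 <= gam y u) ->
  (forall A C, measurable A -> measurable C ->
    Q ([set w | A (v w)] `&` j @^-1` C) =
    (\int[Q]_(w in j @^-1` C) \int[mu]_(y in A) (gam y (j w))%:E)%E) ->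
  forall N : set (Y * U), measurable N -> (mu \x Qimg)%E N = 0%E ->
  Q [set w | N (v w, j w)] = 0%E.
Proof.
move=> mv mg g0 hg N mN N0.
have mvj : measurable_fun setT (fun w => (v w, j w)) by exact: measurable_fun_pair.
have mge : measurable_fun setT (fun p : Y * U => (gam p.1 p.2)%:E).
  exact/measurable_EFinP.
have ge0 (p : Y * U) : (0 <= (gam p.1 p.2)%:E)%E by rewrite lee_fin.
pose m1 := image_prob Q (fun w => (v w, j w)) (probability_setT Q) mvj.
pose m2 := dens_meas (mu \x Qimg)%E _ mge ge0.
have m12 : m1 N = m2 N.
  apply: (measure_unique [set A `*` B | A in measurable & B in measurable] (fun=> setT)) => //.
  - exact: measurable_prod_measurableType.
  - move=> _ _ [A mA [B mB <-]] [A' mA' [B' mB' <-]].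
    exists (A `&` A'); first exact: measurableI.
    by exists (B `&` B'); [exact: measurableI|rewrite setXI].
  - by move=> _; exists setT => //; exists setT => //; rewrite setXTT.
  - by rewrite bigcup_const.
  - move=> _ [A mA [C mC <-]]; rewrite /m1 /m2 /= /image_prob /dens_meas.
    rewrite (_ : _ @^-1` _ = [set w | A (v w)] `&` j @^-1` C); last by apply/seteqP; split.
    rewrite hg// integral_mkcond.
    set f := (X in _ = (\int[_]_z X z)%E).
    have fE p : f p = (gam p.1 p.2 * \1_A p.1 * \1_C p.2)%:E.
      rewrite /f patchE in_setX !indicE.
      by case: (p.1 \in A); case: (p.2 \in C); rewrite /= ?mulr1 ?mulr0 ?mul0r.
    have mf : measurable_fun setT f.
      rewrite (_ : f = EFin \o (fun p => gam p.1 p.2 * \1_A p.1 * \1_C p.2)); last exact/funext.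
      apply/measurable_EFinP; apply: measurable_funM; last first.
        by apply: measurableT_comp => //; exact: measurable_indic.
      by apply: measurable_funM => //; apply: measurableT_comp => //; exact: measurable_indic.
    have f0 p : (0 <= f p)%E by rewrite fE lee_fin !mulr_ge0.
    clearbody f; rewrite fubini_tonelli2//.
    rewrite (integral_image_prob Q _ j mj setT (fubini_G mu f))//; last 2 first.
    + exact: measurable_fun_fubini_tonelli_G.
    + by move=> u; apply: integral_ge0.
    rewrite preimage_setT [LHS]integral_mkcond; apply: eq_integral => w _.
    rewrite /fubini_G patchE; have -> : (w \in j @^-1` C) = (j w \in C).
      by apply/idP/idP; rewrite !inE.
    case: ifPn => jC.
      rewrite [LHS]integral_mkcond; apply: eq_integral => y _.
      rewrite fE patchE !indicE /= jC mulr1.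
      by case: (y \in A); rewrite ?mulr1 ?mulr0.
    apply/esym; apply: integral0_eq => y _.
    by rewrite fE [\1_C _]indicE /= (negbTE jC) mulr0.
  - by move=> _; rewrite /= /image_prob preimage_setT probability_setT ltry.
have : m1 N = 0%E.
  rewrite m12 /m2 /= /dens_meas; apply: null_set_integral => //.
  exact: measurable_funTS.
by [].
Qed.

(** Carries null sets from the image of [mu] back to [mu] itself; [th] will be the truncation of the
    marks. *)
Lemma image_product_null (d4 : measure_display) (K : measurableType d4) (th : Y -> K)
  (mth : measurable_fun setT th) (N : set (K * U)) : measurable N ->
  (image_prob mu th (probability_setT mu) mth \x Qimg)%E N = 0%E ->
  (mu \x Qimg)%E [set p | N (th p.1, p.2)] = 0%E.
Proof.
move=> mN; rewrite /product_measure1 => <-.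
rewrite (integral_image_prob mu _ th mth setT (fun k => Qimg (xsection N k)))//.
exact: measurable_fun_xsection.
Qed.

End density_absolute_continuity.

(** * Splitting of optional sets *)

Section rational_levels.
Context {R : realType}.

Definition rq (n : nat) : R := ratr (odflt 0 (unpickle n : option rat)).

Lemma rq_dense (x y : R) : x < y -> exists n, x < rq n < y.
Proof.
move=> xy; have [q] := rat_in_itvoo xy; rewrite in_itv /= => h.
by exists (pickle q); rewrite /rq pickleK.
Qed.

(* The rational level [rq c] is taken between [a] and [x t], away from the left
   limit: either the path enters above it exactly at time [t], or it stays above
   it on a neighbourhood of [t]. *)
Lemma cadlag_gt (x : R -> R) (a t : R) : cadlag real_dist x -> 0 <= t ->
  (a < x t <-> (~ 0 < t /\ a < x 0) \/ exists i, True /\ exists c, a < rq c /\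
    (qt i < t /\ (((forall l, t < qt l ->
          exists j, (qt i < qt j :> R /\ qt j < qt l :> R) /\ rq c < x (qt j)) /\
        ~ (exists j, qt i < qt j :> R /\ (qt j < t /\ rq c < x (qt j)))) \/
      ~ (forall l, t < qt l ->
          exists j, (qt i < qt j :> R /\ qt j < qt l :> R) /\ x (qt j) < rq c)))).
Proof.
move=> [rc ll] t0.
(* By right-continuity, values at least [c > a] at times arbitrarily soon after [t] force
   [x t > a]. *)
have above c : a < c -> (forall e, 0 < e -> exists j, [/\ t <= qt j, qt j < t + e & c <= x (qt j)]) ->
    a < x t.
  move=> ac h; rewrite ltNge; apply/negP => xa.
  have e0 : 0 < c - x t by rewrite subr_gt0 (le_lt_trans xa).
  have [dl dl0 hdl] := rc t t0 _ e0.
  have [j [tj jd cx]] := h dl dl0.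
  have := hdl _ tj jd; rewrite /real_dist distrC => /(le_lt_trans (ler_norm _)).
  by rewrite ltrD2r ltNge cx.
split; last first.
  move=> [[/negP]|]; first by rewrite -leNgt => t1 a0; rewrite (_ : t = 0)//; apply/le_anti/andP.
  move=> [i [_ [c [ac [it h]]]]]; apply: (above _ ac) => e e0.
  have te : t < t + e by rewrite ltrDl.
  case: h => [[hl hn]|hn].
    have [l /andP[tl le]] := qt_dense _ _ t0 te.
    have [j [[ij jl] cx]] := hl l tl; exists j; split; last exact: ltW.
      by rewrite leNgt; apply/negP => jt; apply: hn; exists j.
    exact: lt_trans le.
  have [l [tl hl]] : exists l, t < qt l /\ forall j, qt i < qt j :> R -> qt j < qt l :> R -> rq c <= x (qt j).
    apply: contrapT => h; apply: hn => l tl; apply: contrapT => h'; apply: h; exists l; split => // j ij jl.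
    by rewrite leNgt; apply/negP => xc; apply: h'; exists j.
  have tm : t < Num.min (t + e) (qt l) by rewrite lt_min te tl.
  have [j /andP[tj]] := qt_dense _ _ t0 tm; rewrite lt_min => /andP[je jl].
  by exists j; split; [exact: ltW|exact: je|apply: hl => //; exact: lt_trans tj].
move=> ax; have [tp|tn] := ltP 0 t; last first.
  by left; split; [|rewrite (_ : 0 = t)//; apply/le_anti/andP].
right; have [L hL] := ll t tp.
have right c : c < x t -> exists2 dl, 0 < dl & forall s, t <= s -> s < t + dl -> c < x s.
  move=> cx; have e0 : 0 < x t - c by rewrite subr_gt0.
  have [dl dl0 hdl] := rc t t0 _ e0; exists dl => // s ts sd.
  have := hdl s ts sd; rewrite /real_dist => /(le_lt_trans (ler_norm _)).
  by rewrite ltrD2l ltrN2.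
have [Lx|xL] := ltP L (x t).
  have mx : Num.max a L < x t by rewrite gt_max ax Lx.
  have [c /andP[]] := rq_dense _ _ mx; rewrite gt_max => /andP[ac Lc] cx.
  have e0 : 0 < rq c - L by rewrite subr_gt0.
  have [dl dl0 hdl] := hL _ e0.
  have dt : t - dl < t by rewrite ltrBlDr ltrDl.
  have [i /andP[di it]] := qt_dense_neg _ _ tp dt.
  exists i; split => //; exists c; split => //; split => //; left; split.
    move=> l tl; have [e ep he] := right _ cx.
    have tm : t < Num.min (t + e) (qt l) by rewrite lt_min tl ltrDl ep.
    have [j /andP[tj]] := qt_dense _ _ t0 tm; rewrite lt_min => /andP[je jl].
    exists j; split; first by split => //; exact: lt_trans tj.
    by apply: he => //; exact: ltW.
  move=> [j [ij [jt cj]]].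
  have := hdl (qt j) (qt_ge0 j) (lt_trans di ij) jt.
  rewrite /real_dist distrC => /(le_lt_trans (ler_norm _)).
  by rewrite ltrD2r ltNge (ltW cj).
have [c /andP[ac cx]] := rq_dense _ _ ax.
have e0 : 0 < L - rq c by rewrite subr_gt0 (lt_le_trans cx).
have [dl dl0 hdl] := hL _ e0.
have dt : t - dl < t by rewrite ltrBlDr ltrDl.
have [i /andP[di it]] := qt_dense_neg _ _ tp dt.
exists i; split => //; exists c; split => //; split => //; right => h.
have [e ep he] := right _ cx.
have te : t < t + e by rewrite ltrDl.
have [l /andP[tl le]] := qt_dense _ _ t0 te.
have [j [[ij jl] xc]] := h l tl.
have [jt|tj] := ltP (qt j) t.
  have := hdl (qt j) (qt_ge0 j) (lt_trans di ij) jt.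
  rewrite /real_dist => /(le_lt_trans (ler_norm _)).
  by rewrite ltrD2l ltrN2 ltNge (ltW xc).
by have := he _ tj (lt_trans jl le); rewrite ltNge (ltW xc).
Qed.

End rational_levels.

(** * Traces of [Gstar] events on the truncated marks *)

Section marked_times.
Context {R : realType} {d : measure_display} {Omega : measurableType d}
  (Q : probability Omega R) (F : R -> set (set Omega))
  {E : pointedType} (r : E -> E -> R) (Delta : E) (m : nat)
  (tau : 'I_m -> Omega -> \bar R) (xi : 'I_m -> Omega -> E).
Hypothesis mr : is_metric r.
Hypothesis fF : is_filtration F.
Hypothesis rcF : filt_right_continuous F.
Hypothesis nullF : null_sigma Q (Finf F) `<=` F 0.
Hypothesis mtau : forall i, measurable_fun setT (tau i).
Hypothesis tau0 : forall i w, (0 <= tau i w)%E.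
Hypothesis mxi : forall i (B : set E), borel_of r B -> measurable [set w | B (xi i w)].
Hypothesis xiD : forall i w, xi i w <> Delta.

Local Notation Oinf := (g_sigma_algebraType (Finf F)).
Local Notation K := (Ytype m r).
Local Notation Hs := (Hsig m r Delta tau xi).
Local Notation Gs := (Gstar m Q F r Delta tau xi).
Local Notation J := (sjoin (Hs +oo%E) (Finf F)).
Local Notation KFinf := (@KF R _ _ K Oinf F).

Definition marks (w : Omega) : K := fun j => (xi j w, tau j w).
Definition state (k : nat) (w : Omega) : K := trunc_marks r Delta m k (marks w).

Lemma Finf_sa : sigma_algebra setT (Finf F).
Proof. exact: g_sigma_sa. Qed.

Lemma Finf_measE : @measurable _ Oinf = Finf F.
Proof. exact: sigma_algebra_id Finf_sa. Qed.

Lemma F_Finf t : 0 <= t -> F t `<=` Finf F.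
Proof. by move=> t0 A FA; apply: sub_sigma_algebra; exists t. Qed.

Lemma Finf_meas : Finf F `<=` measurable.
Proof.
apply: g_sigma_ind; first exact: measurable_sa.
by move=> A [t /= t0]; exact: (filt_meas _ fF).
Qed.

Lemma filtration_Finf : @is_filtration R _ Oinf F.
Proof.
split; last exact: fF.2.
move=> t t0; split; first exact: (fF.1 t t0).1.
by rewrite Finf_measE; exact: F_Finf.
Qed.

Lemma id_Finf_meas : measurable_fun setT (id : Omega -> Oinf).
Proof. by move=> _ B; rewrite Finf_measE setTI => /Finf_meas. Qed.

(** The restriction to [Finf F] makes all null sets lie in [F 0], as the existence of cadlag
    versions requires; null sets of [Omega] itself need not. *)
Definition Qinf : probability Oinf R := @Qimg R _ _ Omega Oinf Q (id : Omega -> Oinf) id_Finf_meas.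

Lemma null_Finf (A B : set Oinf) : measurable B -> Qinf B = 0%E -> A `<=` B -> F 0 A.
Proof.
rewrite Finf_measE => FB QB AB; apply: nullF; apply: sub_sigma_algebra.
by exists B.
Qed.

Lemma Hs_sa t : sigma_algebra setT (Hs t).
Proof. exact: g_sigma_sa. Qed.

Lemma J_sa : sigma_algebra setT J.
Proof. exact: g_sigma_sa. Qed.

(** Marks avoid [Delta], so the process has left [Delta] exactly when its time has occurred. *)
Lemma tau_le_Hs j s t : 0 <= s -> (s%:E <= t)%E -> Hs t [set w | (tau j w <= s%:E)%E].
Proof.
move=> s0 st; apply: sub_sigma_algebra; exists j, s, [set z | z <> Delta]; split => //.
  by apply: sub_sigma_algebra; exact: open_neq.
apply/seteqP; split => w /=; rewrite /Hproc leNgt; case: ifPn => //= _ _.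
Qed.

Lemma tau_Hs j (C : set (\bar R)) : measurable C -> Hs +oo%E [set w | C (tau j w)].
Proof.
move: C; have sH := Hs_sa +oo%E; apply: (sub_emeasP _ _ sH) => a.
rewrite (_ : mkset _ = [set w | exists n, qt n < a /\ (tau j w <= (qt n)%:E)%E]).
  by apply: (sa_ex sH) => n _; apply: tau_le_Hs; [exact: qt_ge0|exact: leey].
apply/seteqP; split => w /=; last first.
  by move=> [n [na h]]; apply: (le_lt_trans h); rewrite lte_fin.
case: (tau j w) (tau0 j w) => [c| |]//; rewrite lee_fin lte_fin => c0 ca.
have [n /andP[n1 n2]] := qt_dense _ _ c0 ca; exists n; split => //.
by rewrite lee_fin ltW.
Qed.

(* The mark of an infinite time is not observed by [Hs +oo], so it is erased. *)
Definition finite_marks (w : Omega) : K := fun j =>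
  if (tau j w < +oo)%E then (xi j w, tau j w) else (Delta, +oo%E).

(** Truncation erases infinite times anyway; hence the state is observable from [Hs +oo] although
    the full marks need not be. *)
Lemma state_finite_marks k w : state k w = trunc_marks r Delta m k (finite_marks w).
Proof.
have tE l : (finite_marks w l).2 = tau l w.
  by rewrite /finite_marks; case: ifPn => //=; rewrite -leNgt leye_eq => /eqP ->.
apply/funext => j; rewrite /state /trunc_marks tE /marks /=.
rewrite (_ : (fun l => (finite_marks w l).2) = tau ^~ w); last exact/funext.
by case: ifPn => // /andP[_ h]; rewrite /finite_marks h.
Qed.

Lemma finite_marks_Hs (A : set K) : measurable A -> Hs +oo%E [set w | A (finite_marks w)].
Proof.
have sH := Hs_sa +oo%E; move: A; apply: (g_sigma_preimage finite_marks) => // _ [j [A [mA ->]]] /=.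
move: A mA; apply: (g_sigma_preimage (finite_marks ^~ j)) => // _ [B [C [bB mC ->]]] /=.
have mfin : Hs +oo%E [set w | (tau j w < +oo)%E].
  apply: (tau_Hs j [set z | (z < +oo)%E]).
  rewrite (_ : mkset _ = `]-oo, +oo%E[%classic); first exact: emeasurable_itv.
  by apply/seteqP; split => z; rewrite /= in_itv.
rewrite (_ : mkset _ = [set w | ((exists n, True /\ ((tau j w <= n%:R%:E)%E /\
    B (Hproc m Delta tau xi j n%:R w))) /\ C (tau j w)) \/
    (~ (tau j w < +oo)%E /\ (B Delta /\ C +oo%E))]).
  apply: (sa_or sH).
    apply: (sa_and sH); last exact: tau_Hs.
    apply: (sa_ex sH) => n _; apply: (sa_and sH).
      by apply: tau_le_Hs; [exact: ler0n|exact: leey].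
    by apply: sub_sigma_algebra; exists j, n%:R, B; split => //; exact: leey.
  apply: (sa_and sH); first exact: (sa_not sH).
  exact: (sa_const sH).
apply/seteqP; split => w; rewrite /finite_marks /=.
  case: ifPn => [tfin [/= Bx Cx]|tfin [/= BD Co]]; last by right; split => //; apply/negP.
  left; split => //.
  case hE : (tau j w) (tau0 j w) tfin => [c| |]//; rewrite lee_fin => c0 _.
  exists (Num.bound c); split => //; have h := archi_boundP c0.
  by split; [rewrite lee_fin ltW|rewrite /Hproc hE lte_fin ltNge (ltW h)].
move=> [[[n [_ [h Bx]]] Cx]|[/negP/negbTE -> //]].
rewrite (le_lt_trans h (ltry _)); split => //=.
by move: Bx; rewrite /Hproc ltNge h.
Qed.

Lemma state_Hs k (A : set K) : measurable A -> Hs +oo%E [set w | A (state k w)].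
Proof.
move=> mA; have := trunc_marks_meas r Delta m k measurableT A mA; rewrite setTI.
move=> /finite_marks_Hs; congr (Hs _ _); apply/seteqP; split => w /=; by rewrite state_finite_marks.
Qed.

(** Places the pulled-back exceptional sets in [J], from whose null sets [Nstar] is built. *)
Lemma pair_J k (N : set (K * Oinf)) : measurable N -> J [set w | N (state k w, w)].
Proof.
rewrite measurable_prod_measurableType; move: N.
apply: (g_sigma_preimage (fun w : Omega => (state k w, w : Oinf))); first exact: J_sa.
move=> _ [A mA [C mC <-]] /=; apply: (sa_and J_sa); apply: sub_sigma_algebra.
  by left; exact: state_Hs.
by right; move: mC; rewrite Finf_measE.
Qed.

Lemma Hs_meas t : Hs t `<=` measurable.
Proof.
have sM := measurable_sa _ Omega.
apply: g_sigma_ind => // _ [j [s [B [s0 _ bB ->]]]].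
rewrite (_ : mkset _ = [set w | ((s%:E < tau j w)%E /\ B Delta) \/
    (~ (s%:E < tau j w)%E /\ B (xi j w))]).
  have mt : measurable [set w | (s%:E < tau j w)%E].
    have := mtau j measurableT _ (emeasurable_itv `]s%:E, +oo[); rewrite setTI.
    by congr measurable; apply/seteqP; split => w; rewrite /= in_itv /= andbT.
  apply: (sa_or sM); apply: (sa_and sM) => //; [exact: (sa_const sM)|exact: (sa_not sM)|exact: mxi].
apply/seteqP; split => w /=; rewrite /Hproc; case: ifPn => h.
- by left.
- by right.
- by case=> -[].
- by case=> -[].
Qed.

Lemma J_meas : J `<=` measurable.
Proof.
apply: g_sigma_ind; first exact: measurable_sa.
by move=> A []; [exact: Hs_meas|exact: Finf_meas].
Qed.

Definition nullJ (A : set Omega) := J A /\ Q A = 0%E.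

Lemma nullJ_bigcup (A : nat -> set Omega) : (forall n, nullJ (A n)) -> nullJ (\bigcup_n A n).
Proof.
move=> h; have JU : J (\bigcup_n A n) by apply: (sa_bigcup J_sa) => n; case: (h n).
split => //; apply/negligibleP; first exact: J_meas.
apply: negligible_bigcup => n; apply/negligibleP; last by case: (h n).
by apply: J_meas; case: (h n).
Qed.

Lemma nullJ0 : nullJ set0.
Proof. by split; [case: J_sa|rewrite measure0]. Qed.

Lemma nullJU (A B : set Omega) : nullJ A -> nullJ B -> nullJ (A `|` B).
Proof.
move=> hA hB; rewrite (_ : A `|` B = \bigcup_n (if n is 0%N then A else B)).
  by apply: nullJ_bigcup => -[|n].
apply/seteqP; split => [w [Aw|Bw]|w [[|n] _ h]]; first by exists 0%N.
- by exists 1%N.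
- by left.
- by right.
Qed.

(** Sets that agree with a member of [S] off a null set of [J] form a sigma-algebra, which contains
    both [S] and [Nstar]. *)
Lemma Nstar_join (S : set (set Omega)) : sigma_algebra setT S ->
  forall G, sjoin (Nstar m Q F r Delta tau xi) S G ->
  exists G' M, [/\ S G', nullJ M & forall w, ~ M w -> (G w <-> G' w)].
Proof.
move=> sS.
pose H := [set G | exists G' M, [/\ S G', nullJ M & forall w, ~ M w -> (G w <-> G' w)]].
have sH : sigma_algebra setT H.
  split.
  - exists set0, set0; split => //; [by case: sS|exact: nullJ0].
  - move=> A [G' [M [SG nM h]]]; exists [set w | ~ G' w], M; split => //.
      exact: (sa_not sS).
    by move=> w /h hw; rewrite setTD /=; tauto.
  - move=> A HA; have [G' h1] := choice HA; have [M h2] := choice h1.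
    exists (\bigcup_n G' n), (\bigcup_n M n); split.
    + by apply: (sa_bigcup sS) => n; case: (h2 n).
    + by apply: nullJ_bigcup => n; case: (h2 n).
    + move=> w nM; have hw n : A n w <-> G' n w.
        by case: (h2 n) => _ _; apply => Mn; apply: nM; exists n.
      by split => -[n _ /hw ?]; exists n.
apply: g_sigma_ind => // G [|SG]; last first.
  by exists G, set0; split => //; exact: nullJ0.
move: G; apply: g_sigma_ind => // G [M [JM [QM GM]]].
exists set0, M; split => //; first by case: sS.
by move=> w nM; split => // /GM.
Qed.

Lemma Gs_approx t s (G : set Omega) : t < s -> Gs t G ->
  exists G' M, [/\ sjoin (F s) (Hs s%:E) G', nullJ M & forall w, ~ M w -> (G w <-> G' w)].
Proof.
move=> ts GG.
have sI : sigma_algebra setT (\bigcap_(s in [set s : R | t < s]) sjoin (F s) (Hs s%:E)).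
  by apply: sigma_algebra_bigcap => u _; exact: g_sigma_sa.
have [G' [M [IG nM h]]] := Nstar_join _ sI G GG.
by exists G', M; split => //; exact: IG.
Qed.

Lemma Gs_sa t : sigma_algebra setT (Gs t).
Proof. exact: g_sigma_sa. Qed.

Lemma Gs_mono s t : s <= t -> Gs s `<=` Gs t.
Proof.
move=> st; apply: g_sigma_ind; first exact: Gs_sa.
move=> G [NG|IG]; apply: sub_sigma_algebra; [by left|right => u /= tu].
by apply: IG => /=; exact: le_lt_trans tu.
Qed.

(* Before the next order statistic the paths of the [Hproc j] up to time [s] are
   functions of [state k w]. *)
Lemma sjoin_trace k s (G : set Omega) : 0 <= s -> sjoin (F s) (Hs s%:E) G ->
  exists A : set (K * Oinf), KFinf s A /\
    forall w, (s%:E < ostat (tau ^~ w) k.+1)%E -> (G w <-> A (state k w, w)).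
Proof.
move=> s0; move: G; have sK : sigma_algebra setT (KFinf s) by exact: g_sigma_sa.
pose H := [set G : set Omega | exists A : set (K * Oinf), KFinf s A /\
    forall w, (s%:E < ostat (tau ^~ w) k.+1)%E -> (G w <-> A (state k w, w))].
have sH : sigma_algebra setT H.
  split.
  - by exists set0; split; [case: sK|].
  - move=> G [A [KA h]]; exists [set x | ~ A x]; split; first exact: (sa_not sK).
    by move=> w /h hw; rewrite setTD /=; tauto.
  - move=> G HG; have [A hA] := choice HG; exists (\bigcup_n A n); split.
      by apply: (sa_bigcup sK) => n; case: (hA n).
    by move=> w sw; split => -[n _ h]; exists n => //; case: (hA n) => _ /(_ w sw); tauto.
apply: g_sigma_ind => // G [FG|].
  exists (setT `*` G); split; last by move=> w _; split => [|[]].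
  by apply: sub_sigma_algebra; exists setT, G.
move: G; apply: g_sigma_ind => // _ [j [u [B [u0 us bB ->]]]].
exists [set x : K * Oinf | ((u%:E < (x.1 j).2)%E /\ B Delta) \/
   (~ (u%:E < (x.1 j).2)%E /\ B (x.1 j).1)]; split.
  have rect (A : set K) : measurable A -> KFinf s [set x | A x.1].
    move=> mA; apply: sub_sigma_algebra; exists A, setT; split => //.
      by have := sa_const (filt_sa _ fF _ s0) True; congr (F s); apply/seteqP; split.
    by apply/seteqP; split => x //= [].
  apply: (rect [set y : K | ((u%:E < (y j).2)%E /\ B Delta) \/
   (~ (u%:E < (y j).2)%E /\ B (y j).1)]).
  have sY := measurable_sa _ K.
  have mt : measurable [set y : K | (u%:E < (y j).2)%E].
    have := Ytype_time r m j measurableT _ (emeasurable_itv `]u%:E, +oo[); rewrite setTI.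
    by congr measurable; apply/seteqP; split => y; rewrite /= in_itv /= andbT.
  apply: (sa_or sY); apply: (sa_and sY) => //; [exact: (sa_const sY)|exact: (sa_not sY)|].
  apply: (Ytype_coord r m j [set z | B z.1]); apply: sub_sigma_algebra.
  by exists B, setT; split => //; apply/seteqP; split => z //= [].
move=> w sw /=.
have su : (u%:E < ostat (tau ^~ w) k.+1)%E by exact: le_lt_trans sw.
rewrite /state /trunc_marks /marks /Hproc /=.
(* If the time is after [u], its truncation is itself or [+oo], both after [u]. Otherwise it
   precedes the next order statistic, so by [ostat_gap] it is kept with its mark. *)
have [ut|tu] := ltP u%:E (tau j w).
  case: ifPn => _ /=; rewrite ?ut ?ltry; by split => [?|[[]|[]]//]; left.
have tk : (tau j w <= ostat (tau ^~ w) k)%E.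
  by apply: ostat_gap => //; exact: le_lt_trans su.
rewrite tk (le_lt_trans tu (ltry _)) /= ltNge tu.
by split => [?|[[]//|[]//]]; right.
Qed.

(* [VK n] is the union of the traces of the [V j] at times [qt l] with
   [qt j < qt l < qt n]; the slack absorbs the right limit in [Gstar]. *)
Lemma lift_stopping k (V : nat -> set Omega) :
  (forall n, Gs (qt n) (V n)) ->
  (forall n n', qt n <= qt n' :> R -> V n `<=` V n') ->
  exists VK : nat -> set (K * Oinf), [/\ forall n, KFinf (qt n) (VK n),
    forall n n', qt n <= qt n' :> R -> VK n `<=` VK n' &
    exists2 M, nullJ M & forall w, ~ M w -> forall t, 0 <= t ->
      (t%:E < ostat (tau ^~ w) k.+1)%E ->
      (forall n, t < qt n -> V n w) <-> (forall n, t < qt n -> VK n (state k w, w))].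
Proof.
move=> GV ndV.
have h (jl : nat * nat) : exists AM : set (K * Oinf) * set Omega,
    qt jl.1 < qt jl.2 :> R -> [/\ KFinf (qt jl.2) AM.1, nullJ AM.2 &
      forall w, ~ AM.2 w -> ((qt jl.2)%:E < ostat (tau ^~ w) k.+1)%E ->
        (V jl.1 w <-> AM.1 (state k w, w))].
  have [lt|] := pselect (qt jl.1 < qt jl.2 :> R); last by exists (set0, set0).
  have [G' [M [SG nM hM]]] := Gs_approx _ _ _ lt (GV jl.1).
  have [A [KA hA]] := sjoin_trace k _ _ (qt_ge0 _) SG.
  exists (A, M) => _; split => // w nMw lw; rewrite (hM w nMw); exact: hA.
have [AM hAM] := choice h.
exists (fun n => [set x | exists j, True /\ exists l,
  (qt j < qt l :> R /\ qt l < qt n :> R) /\ (AM (j, l)).1 x]); split.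
- move=> n; have sK : sigma_algebra setT (KFinf (qt n)) by exact: g_sigma_sa.
  apply: (sa_ex sK) => j _; apply: (sa_ex sK) => l [jl ln].
  have [KA _ _] := hAM (j, l) jl.
  exact: ((@KF_filtration R _ _ K Oinf F filtration_Finf).2 (qt l) (qt n) (qt_ge0 l) (ltW ln) _ KA).
- move=> n n' nn' x [j [_ [l [[jl ln] Ax]]]]; exists j; split => //; exists l; split => //.
  by split => //; exact: lt_le_trans nn'.
exists (\bigcup_j \bigcup_l [set w | qt j < qt l :> R /\ (AM (j, l)).2 w]).
  apply: nullJ_bigcup => j; apply: nullJ_bigcup => l.
  have [jl|jl] := pselect (qt j < qt l :> R).
    have [_ nM _] := hAM (j, l) jl; rewrite (_ : mkset _ = (AM (j, l)).2) //.
    by apply/seteqP; split => [w []|w].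
  by rewrite (_ : mkset _ = set0); [exact: nullJ0|apply/seteqP; split => [w []|w]].
move=> w nM t t0 ts.
have key j l : qt j < qt l :> R -> ((qt l)%:E < ostat (tau ^~ w) k.+1)%E ->
    (V j w <-> (AM (j, l)).1 (state k w, w)).
  move=> jl ls; have [_ _] := hAM (j, l) jl; apply => //.
  by move=> Mw; apply: nM; exists j => //; exists l.
(* The bound [c] leaves room after [t] for rational times that precede both [qt n] and the next
   order statistic, where the trace identity holds. *)
have dense n : t < qt n -> exists c, [/\ t < c, c <= qt n & (c%:E <= ostat (tau ^~ w) k.+1)%E].
  move=> tn; move: ts; case: (ostat _ _) => [c| |] //.
    rewrite lte_fin => tc; exists (Num.min (qt n) c).
    by rewrite lt_min tn tc ge_min lexx lee_fin ge_min lexx orbT.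
  by move=> _; exists (qt n); rewrite leey.
split => H n tn; have [c [tc cn cs]] := dense n tn.
  have [j /andP[tj jc]] := qt_dense _ _ t0 tc.
  have [l /andP[jl lc]] := qt_dense _ _ (qt_ge0 j) jc.
  exists j; split => //; exists l; split; first by split => //; exact: lt_le_trans cn.
  apply/(key j l jl); last exact: H.
  by apply: lt_le_trans cs; rewrite lte_fin.
have [n' /andP[tn' n'c]] := qt_dense _ _ t0 tc.
have [j [_ [l [[jl ln'] Ax]]]] := H n' tn'.
apply: (ndV j n); first by apply: ltW; rewrite (lt_trans jl)// (lt_trans ln')// (lt_le_trans n'c).
apply/(key j l jl) => //; apply: lt_le_trans cs; rewrite lte_fin.
exact: lt_trans n'c.
Qed.

Local Notation OT := (g_sigma_algebraType (@optional_sigma R _ Oinf F)).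

(** * Splittable sets of times and outcomes *)

Variable la : nat -> probability K R.
Hypothesis AC : forall k (N : set (K * Oinf)), measurable N -> (la k \x Qinf)%E N = 0%E ->
  Q [set w | N (state k w, w)] = 0%E.

(** Exceptional sets change side here: a null set of the product is pulled back along the state, and
    the result is null by [AC] and in [J] by [pair_J]. *)
Lemma stopping_split_state k (V : nat -> set Omega) :
  (forall n, Gs (qt n) (V n)) ->
  (forall n n', qt n <= qt n' :> R -> V n `<=` V n') ->
  exists2 Z : set (K * OT), measurable Z & exists2 M, nullJ M &
    forall w, ~ M w -> forall t, 0 <= t -> (t%:E < ostat (tau ^~ w) k.+1)%E ->
      (forall n, t < qt n -> V n w) <-> Z (state k w, (t, w)).
Proof.
move=> GV ndV.
have [VK [KVK ndVK [M1 nM1 hM1]]] := lift_stopping k V GV ndV.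
have [Z mZ [N [mN N0 hN]]] := @stopping_split R _ _ K Oinf (la k) Qinf F filtration_Finf rcF null_Finf VK KVK ndVK.
exists Z => //; exists (M1 `|` [set w | N (state k w, w)]).
  by apply: nullJU => //; split; [exact: pair_J|exact: AC].
move=> w nMw t t0 ts.
have nM1w : ~ M1 w by move=> h; apply: nMw; left.
have hZ : forall t, 0 <= t -> Z (state k w, (t, w)) <-> (forall n, t < qt n -> VK n (state k w, w)).
  by apply: contrapT => h; apply: nMw; right; apply: hN.
by rewrite (hZ t t0); exact: hM1.
Qed.

(** The identity is demanded at all times before the next order statistic, also before the k-th one,
    as the trace lemma provides it; a single null set serves all [k] and [t]. *)
Definition splittable (S : set (R * Omega)) := exists (Z : nat -> set (K * OT)) M,
  [/\ forall k, measurable (Z k), nullJ M &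
    forall w, ~ M w -> forall t, 0 <= t -> forall k, (t%:E < ostat (tau ^~ w) k.+1)%E ->
      (S (t, w) <-> Z k (state k w, (t, w)))].

Lemma splittable_eq (S S' : set (R * Omega)) :
  (forall t w, 0 <= t -> (S (t, w) <-> S' (t, w))) -> splittable S -> splittable S'.
Proof.
move=> SS' [Z [M [mZ nM h]]]; exists Z, M; split => // w nMw t t0 k tk.
by rewrite -(SS' t w t0); exact: h.
Qed.

Lemma splittable_sa : sigma_algebra setT splittable.
Proof.
split.
- by exists (fun=> set0), set0; split => //; exact: nullJ0.
- move=> S [Z [M [mZ nM h]]]; exists (fun k => ~` Z k), M; split => //.
    by move=> k; exact: measurableC.
  by move=> w nMw t t0 k tk; have := h w nMw t t0 k tk; rewrite setTD /=; tauto.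
- move=> S HS; have [Z h1] := choice HS; have [M h2] := choice h1.
  exists (fun k => \bigcup_n Z n k), (\bigcup_n M n); split.
  + by move=> k; apply: bigcupT_measurable => n; case: (h2 n).
  + by apply: nullJ_bigcup => n; case: (h2 n).
  + move=> w nM t t0 k tk.
    have hw n : S n (t, w) <-> Z n k (state k w, (t, w)).
      by case: (h2 n) => _ _ h; apply: h => // Mn; apply: nM; exists n.
    by split => -[n _ /hw ?]; exists n.
Qed.

Lemma stopping_splittable (V : nat -> set Omega) :
  (forall n, Gs (qt n) (V n)) ->
  (forall n n', qt n <= qt n' :> R -> V n `<=` V n') ->
  splittable [set p | forall n, p.1 < qt n -> V n p.2].
Proof.
move=> GV ndV.
have h k : exists ZM : set (K * OT) * set Omega, [/\ measurable ZM.1, nullJ ZM.2 &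
    forall w, ~ ZM.2 w -> forall t, 0 <= t -> (t%:E < ostat (tau ^~ w) k.+1)%E ->
      (forall n, t < qt n -> V n w) <-> ZM.1 (state k w, (t, w))].
  by have [Z mZ [M nM hM]] := stopping_split_state k V GV ndV; exists (Z, M).
have [ZM hZM] := choice h.
exists (fun k => (ZM k).1), (\bigcup_k (ZM k).2); split.
- by move=> k; case: (hZM k).
- by apply: nullJ_bigcup => k; case: (hZM k).
- move=> w nM t t0 k tk /=; case: (hZM k) => _ _; apply => // Mk.
  by apply: nM; exists k.
Qed.

(** The complement is the stopping set of the deterministic time [s]. *)
Lemma time_splittable (s : R) : splittable [set p | p.1 < s].
Proof.
apply: (splittable_eq [set p | ~ (forall n, p.1 < qt n -> s < qt n)]).
  move=> t w t0 /=; split => [h|ts h].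
    rewrite ltNge; apply/negP => st; apply: h => n; exact: le_lt_trans.
  have [n /andP[tn ns]] := qt_dense _ _ t0 ts.
  by have := h n tn; rewrite ltNge (ltW ns).
apply: (sa_not splittable_sa); apply: (stopping_splittable (fun n => [set _ | s < qt n])).
  by move=> n; exact: (sa_const (Gs_sa _)).
by move=> n n' nn' w /= h; exact: lt_le_trans nn'.
Qed.

(** The family describes the stopping time equal to [qt n] on [C] and infinite elsewhere; an
    intermediate [qt i] makes the inequality strict. *)
Lemma event_splittable n (C : set Omega) : Gs (qt n) C ->
  splittable [set p | qt n < p.1 /\ C p.2].
Proof.
move=> GC; apply: (splittable_eq [set p | exists i, qt n < qt i :> R /\
    (~ p.1 < qt i /\ (forall l, p.1 < qt l -> qt n < qt l :> R /\ C p.2))]).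
  move=> t w t0 /=; split.
    move=> [i [ni [ti h]]]; have ti' : qt i <= t by rewrite leNgt; apply/negP.
    have [l /andP[tl _]] := qt_dense _ _ t0 (ltr_pwDr ltr01 (lexx t)).
    by split; [exact: lt_le_trans ti'|case: (h l tl)].
  move=> [nt Cw]; have [i /andP[ni it]] := qt_dense _ _ (qt_ge0 n) nt.
  exists i; split => //; split; first by rewrite ltNge (ltW it).
  by move=> l tl; split => //; exact: lt_trans tl.
have sS := splittable_sa.
apply: (sa_ex sS) => i _; apply: (sa_and sS); first exact: (sa_not sS) (time_splittable _).
apply: (stopping_splittable (fun l => [set w | qt n < qt l :> R /\ C w])); last first.
  by move=> l l' ll' w [h Cw]; split => //; exact: lt_le_trans ll'.
move=> l; have [nl|nl] := pselect (qt n < qt l :> R).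
  rewrite (_ : mkset _ = C); first exact: (Gs_mono (qt n) (qt l) (ltW nl)).
  by apply/seteqP; split => [w []|w].
rewrite (_ : mkset _ = [set _ | False]); first exact: (sa_const (Gs_sa _)).
by apply/seteqP; split => [w []|w].
Qed.

Lemma hitting_splittable i (A : nat -> set Omega) : (forall j, Gs (qt j) (A j)) ->
  splittable [set p | forall l, p.1 < qt l ->
    exists j, (qt i < qt j :> R /\ qt j < qt l :> R) /\ A j p.2].
Proof.
move=> GA; apply: (stopping_splittable (fun l => [set w |
    exists j, (qt i < qt j :> R /\ qt j < qt l :> R) /\ A j w])).
  move=> l; apply: (sa_ex (Gs_sa _)) => j [_ jl].
  exact: (Gs_mono (qt j) (qt l) (ltW jl)).
move=> l l' ll' w [j [[ij jl] Aj]]; exists j; split => //; split => //.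
exact: lt_le_trans ll'.
Qed.

(** Each clause of [cadlag_gt] is a countable combination of hitting sets, events at rational times
    and deterministic times. At time 0 the stopping family is constant in [n]. *)
Lemma optional_splittable (S : set (R * Omega)) : optional_sigma Gs S -> splittable S.
Proof.
have sS := splittable_sa; move: S; apply: g_sigma_ind => // _ [X [B [aX cX mB ->]]].
apply: (splittable_eq [set p | B (X p.1 p.2)]); first by move=> t w t0 /=; tauto.
apply: (sub_measP _ (fun p : R * Omega => X p.1 p.2) sS _ B mB) => a.
apply: (splittable_eq [set p | (~ 0 < p.1 /\ a < X 0 p.2) \/ exists i, True /\ exists c, a < rq c /\
    (qt i < p.1 /\ (((forall l, p.1 < qt l ->
          exists j, (qt i < qt j :> R /\ qt j < qt l :> R) /\ rq c < X (qt j) p.2) /\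
        ~ (exists j, qt i < qt j :> R /\ (qt j < p.1 /\ rq c < X (qt j) p.2))) \/
      ~ (forall l, p.1 < qt l ->
          exists j, (qt i < qt j :> R /\ qt j < qt l :> R) /\ X (qt j) p.2 < rq c)))]).
  by move=> t w t0 /=; rewrite -(cadlag_gt (X ^~ w) a t (cX w) t0).
have gtX j c : Gs (qt j) [set w | c < X (qt j) w].
  exact: (sub_meas_gt _ _ c (aX (qt j) (qt_ge0 j))).
have ltX j c : Gs (qt j) [set w | X (qt j) w < c].
  exact: (sub_meas_lt _ _ c (aX (qt j) (qt_ge0 j))).
apply: (sa_or sS).
  apply: (sa_and sS).
    apply: (sa_not sS); apply: (splittable_eq [set p | exists i, True /\ ~ (p.1 < qt i) /\ 0 < qt i :> R]).
      move=> t w t0 /=; split.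
        by move=> [i [_ [/negP ti i0]]]; apply: (lt_le_trans i0); rewrite leNgt.
      move=> tp; have [i /andP[i0 it]] := qt_dense _ _ (lexx 0) tp.
      by exists i; split => //; rewrite ltNge (ltW it).
    apply: (sa_ex sS) => i _; apply: (sa_and sS); last exact: (sa_const sS).
    exact: (sa_not sS) (time_splittable _).
  apply: (splittable_eq [set p | forall n, p.1 < qt n -> a < X 0 p.2]).
    move=> t w t0 /=; split => // h.
    have [l /andP[tl _]] := qt_dense _ _ t0 (ltr_pwDr ltr01 (lexx t)); exact: h l tl.
  apply: (stopping_splittable (fun n => [set w | a < X 0 w])) => n; last first.
    by move=> n' _; exact: subset_refl.
  apply: (Gs_mono 0 (qt n) (qt_ge0 n)); exact: (sub_meas_gt _ _ a (aX 0 (lexx 0))).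
apply: (sa_ex sS) => i _; apply: (sa_ex sS) => c _; apply: (sa_and sS).
  apply: (splittable_eq [set p | qt i < p.1 /\ True]); first by move=> t w t0 /=; tauto.
  exact: (event_splittable i setT (sa_const (Gs_sa _) True)).
apply: (sa_or sS); last first.
  by apply: (sa_not sS); apply: (hitting_splittable i (fun j => [set w | X (qt j) w < rq c])) => j.
apply: (sa_and sS).
  by apply: (hitting_splittable i (fun j => [set w | rq c < X (qt j) w])) => j.
apply: (sa_not sS); apply: (sa_ex sS) => j _.
exact: (event_splittable j [set w | rq c < X (qt j) w]).
Qed.

Lemma marks_meas : measurable_fun setT marks.
Proof.
have sM := measurable_sa _ Omega; move=> _ A mA; rewrite setTI; move: A mA.
apply: (g_sigma_preimage marks) => // _ [j [A [mA ->]]] /=.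
move: A mA; apply: (g_sigma_preimage (marks ^~ j)) => // _ [B [C [bB mC ->]]] /=.
apply: (sa_and sM); first exact: mxi.
by have := mtau j measurableT C mC; rewrite setTI.
Qed.

Lemma decode_Hstop k w :
  (fun j => decode Delta (Hstop m Delta tau xi j (sigma_ord m tau k) w)) = state k w.
Proof. by apply/funext => j; exact: decode_step. Qed.

Lemma decode_DO_meas (A : set (K * OT)) : measurable A ->
  DO_sigma m F r [set p | A (fun j => decode Delta (p.1 j), p.2)].
Proof.
have sD : sigma_algebra setT (DO_sigma m F r) by exact: g_sigma_sa.
rewrite measurable_prod_measurableType; move: A.
apply: (g_sigma_preimage (fun p : ('I_m -> R -> E) * (R * Omega) =>
  ((fun j => decode Delta (p.1 j)) : K, p.2 : OT))) => // _ [A mA [C mC <-]].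
apply: sub_sigma_algebra; exists [set w | A (fun j => decode Delta (w j))], C; split => //.
  exact: (decode_prod_meas r Delta mr).
by have := mC; rewrite (_ : @measurable _ OT = optional_sigma F)//;
  exact: sigma_algebra_id (g_sigma_sa _).
Qed.

(* The [k]-th component of [Y] is the supremum of the rational levels [rq n] over
   the sets that split [{rq n < Y}]. *)
Lemma splitting_formula_AC : splitting_formula m Q F r Delta tau xi.
Proof.
move=> Y oY.
have sO := measurable_sa _ (K * OT)%type.
have h n : splittable [set p | 0 <= p.1 /\ rq n < Y p.1 p.2].
  apply: optional_splittable; have := oY `]rq n, +oo[%classic (measurable_itv _).
  by congr (optional_sigma _ _); apply/seteqP; split => p; rewrite /= in_itv /= andbT.
have [Z h1] := choice h; have [M h2] := choice h1.
pose g k (x : K * OT) : \bar R := ereal_sup [set z | exists n, Z n k x /\ z = (rq n)%:E].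
(* A rational level below [a] that no admissible level exceeds: this form makes measurability of [g]
   a matter of countable operations. *)
have gE k x (a : R) : (g k x < a%:E)%E <->
    exists l, rq l < a /\ forall n, rq l < rq n :> R -> ~ Z n k x.
  split => [ga|[l [la' hl]]]; last first.
    apply: (@le_lt_trans _ _ (rq l)%:E); last by rewrite lte_fin.
    apply: ge_ereal_sup => _ [n [Zn ->]]; rewrite lee_fin leNgt.
    by apply/negP => /hl.
  have [b ba gb] : exists2 b, b < a & (g k x <= b%:E)%E.
    move: ga; case: (g k x) => [b||]//; first by rewrite lte_fin => ?; exists b.
    by exists (a - 1); [rewrite ltrBlDr ltrDl|rewrite leNye].
  have [l /andP[bl la']] := rq_dense _ _ ba; exists l; split => // n ln Zn.
  have : ((rq n)%:E <= b%:E)%E by apply: le_trans gb; apply: ereal_sup_ubound; exists n.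
  by rewrite lee_fin leNgt (lt_trans bl ln).
have mg k (C : set (\bar R)) : measurable C -> measurable [set x | C (g k x)].
  move: C; apply: (sub_emeasP _ _ sO) => a.
  rewrite (_ : mkset _ = [set x | exists l, rq l < a /\
      forall n, rq l < rq n :> R -> ~ Z n k x]).
    apply: (sa_ex sO) => l _; apply: (sa_all sO) => n _; apply: (sa_not sO).
    by case: (h2 n) => + _ _; exact.
  by apply/seteqP; split => x /gE.
(* Where [g] is infinite, [fine] gives 0; at the arguments that matter off the null set, [g] is the
   finite value [Y t w]. *)
exists (fun i path t w => fine (g i (fun j => decode Delta (path j), (t, w)))); split.
  move=> i B mB; have sD : sigma_algebra setT (DO_sigma m F r) by exact: g_sigma_sa.
  apply: (sa_and sD).
    apply: sub_sigma_algebra; exists setT, [set p | 0 <= p.1]; split.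
    - by have := sa_const (g_sigma_sa _ : sigma_algebra setT (skorokhod_prod m r)) True;
        congr (skorokhod_prod _ _); apply/seteqP; split.
    - apply: sub_sigma_algebra; exists (fun _ _ => 0), setT; split => //.
      + by move=> t t0 C mC; exact: (sa_const (filt_sa _ fF _ t0)).
      + move=> w; split => [t _ e e0|t _].
          by exists 1 => // s _ _; rewrite /real_dist subrr normr0.
        by exists 0 => e e0; exists 1 => // s _ _ _; rewrite /real_dist subrr normr0.
      + by apply/seteqP; split => [p ?|p []].
    - by apply/seteqP; split => [p ?|p []].
  rewrite (_ : mkset _ = [set p | B (fine (g i (fun j => decode Delta (p.1 j), p.2)))]); last first.
    by apply/seteqP; split => -[? []].
  apply: (decode_DO_meas [set x | B (fine (g i x))]).
  apply: (mg i [set z | B (fine z)]).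
  by have := (@fine_measurable R setT measurableT) measurableT B mB; rewrite setTI.
have nM : nullJ (\bigcup_n M n) by apply: nullJ_bigcup => n; case: (h2 n).
exists (\bigcup_n M n); split.
- by case: nM => JM QM; apply: sub_sigma_algebra; exists (\bigcup_n M n); split; [|split].
- by case: nM => /J_meas mM QM; exists (\bigcup_n M n); split; [|split].
move=> w nMw t t0.
have lt_nle : (nle (tau ^~ w) t < m.+1)%N by rewrite ltnS nle_le.
pose i0 : 'I_m.+1 := Ordinal lt_nle.
have cE (i : 'I_m.+1) : ((sigma_ord m tau i w <= t%:E)%E &&
    (t%:E < sigma_ord m tau i.+1 w)%E) = (i == i0).
  by rewrite -val_eqE /=; apply: ostat_itv => //; rewrite -ltnS.
(* Only the summand whose index counts the times up to [t] survives. *)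
rewrite (bigD1 i0)//= big1 ?addr0; last first.
  by move=> i /negbTE ii0; rewrite cE ii0 mulr0.
have := cE i0; rewrite eqxx => cE0; rewrite [X in if X then _ else _]cE0 mulr1 decode_Hstop.
have ti0 : (t%:E < ostat (tau ^~ w) i0.+1)%E by have /andP[] := cE0.
have ZE n : Z n i0 (state i0 w, (t, w)) <-> rq n < Y t w.
  case: (h2 n) => _ _ /(_ w) hn; have {}hn := hn (fun Mn => nMw (ex_intro2 _ _ n I Mn)) t t0 i0 ti0.
  by move: hn => /=; tauto.
suff -> : g i0 (state i0 w, (t, w)) = (Y t w)%:E by [].
apply/eqP; rewrite eq_le; apply/andP; split.
  by apply: ge_ereal_sup => _ [n [/ZE Zn ->]]; rewrite lee_fin ltW.
rewrite leNgt; apply/negP => /gE[l [lY hl]].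
have [n /andP[ln nY]] := rq_dense _ _ lY.
by apply: (hl n ln); apply/ZE.
Qed.

End marked_times.

(** * From the density hypothesis to absolute continuity of the states *)

Theorem mainTheorem19 (R : realType) (d : measure_display)
  (Omega : measurableType d) (Q : probability Omega R)
  (F : R -> set (set Omega))
  (E : pointedType) (r : E -> E -> R) (Delta : E) (m : nat)
  (tau : 'I_m -> Omega -> \bar R) (xi : 'I_m -> Omega -> E) :
  is_metric r -> metric_complete r -> metric_separable r ->
  is_filtration F -> filt_right_continuous F ->
  null_sigma Q (Finf F) `<=` F 0 ->
  (forall i, measurable_fun setT (tau i)) ->
  (forall i w, (0 <= tau i w)%E) ->
  (forall i (B : set E), borel_of r B -> measurable [set w | B (xi i w)]) ->
  (forall i w, xi i w <> Delta) ->
  (exists (nu : probability (Ztype r) R)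
          (mu : {measure set (Ytype m r) -> \bar R})
          (gamma : Ytype m r -> Omega -> R),
     [/\ nu [set z | (0 <= z.2)%E] = 1%E,
         (forall A : 'I_m -> set (Ztype r), (forall i, measurable (A i)) ->
            mu [set y | forall i, A i (y i)] = \big[*%E/1%E]_(i < m) nu (A i)),
         (forall y w, 0 <= gamma y w),
         (forall B : set R, measurable B ->
            <<s [set S | exists (A : set (Ytype m r)) (C : set Omega),
                   [/\ measurable A, Finf F C & S = A `*` C]] >>
              [set p | B (gamma p.1 p.2)]) &
         (forall (A : set (Ytype m r)) (C : set Omega),
            measurable A -> Finf F C ->
            Q ([set w | A (fun i => (xi i w, tau i w))] `&` C) =
            (\int[Q]_(w in C) \int[mu]_(y in A) (gamma y w)%:E)%E)]) ->
  splitting_formula m Q F r Delta tau xi.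
Proof.
move=> mr _ _ fF rcF nullF mtau tau0 mxi xiD [nu [mu [gam [_ muE g0 mg hg]]]].
(* [mu] is prescribed on product sets; the full one gives its total mass. *)
have mu1 : mu setT = 1%E.
  have := muE (fun=> setT) (fun=> measurableT).
  by rewrite big1 => [<-|i _]; [congr (mu _); apply/seteqP; split|exact: probability_setT].
pose mup : probability (Ytype m r) R := image_prob mu id mu1 (@measurable_id _ _ setT).
pose th k := trunc_marks_meas r Delta m k.
pose la k : probability (Ytype m r) R := image_prob mup _ (probability_setT mup) (th k).
apply: (splitting_formula_AC Q F r Delta m tau xi mr fF rcF nullF mtau tau0 mxi xiD la) => k N mN N0.
have mgam : measurable_fun setT (fun p : Ytype m r * g_sigma_algebraType (Finf F) => gam p.1 p.2).
  move=> _ B mB; rewrite setTI measurable_prod_measurableType; move: (mg B mB).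
  apply: g_sigma_ind; first exact: g_sigma_sa.
  move=> _ [A [C [mA FC ->]]]; apply: sub_sigma_algebra; exists A => //; exists C => //.
  exact: sub_sigma_algebra.
have mN' : measurable [set p : Ytype m r * g_sigma_algebraType (Finf F) |
    N (trunc_marks r Delta m k p.1, p.2)].
  rewrite -[X in measurable X]setTI; apply: (_ : measurable_fun setT (fun p => (_, _))) => //.
  apply: measurable_fun_pair => //=.
  exact: (measurableT_comp (th k) measurable_fst).
(* The density concerns the full marks, so absolute continuity is obtained against [mup]; pulling
   [N] back by the truncation yields it for the state against [la k]. *)
have L := @law_absolutely_continuous R _ _ _ (Ytype m r) Omega (g_sigma_algebraType (Finf F))
  Q mup id (id_Finf_meas F fF) (marks r m tau xi) gam _ mgam g0 _ _ mN'.
apply: L.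
- exact: marks_meas.
- move=> A C mA; rewrite Finf_measE => FC; rewrite preimage_id.
  rewrite [LHS](hg A C mA FC); apply: eq_integral => w _.
  rewrite (integral_image_prob mu mu1 id _ A (fun y => (gam y w)%:E))//.
  + apply/measurable_EFinP.
    exact: (measurableT_comp mgam (pair2_measurable (w : g_sigma_algebraType (Finf F)))).
  + by move=> y; rewrite lee_fin.
- exact: (@image_product_null R _ _ _ (Ytype m r) Omega (g_sigma_algebraType (Finf F))
    Q mup id (id_Finf_meas F fF) _ (Ytype m r) (trunc_marks r Delta m k) (th k) N mN N0).
Qed.
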